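(* Let $\Bbbk$ be an algebraically closed field and let $A$ be a basic finite-dimensional $\Bbbk$-algebra with a fixed set of orthogonal primitive idempotents $\{e_\lambda\}_{\lambda\in\Lambda}$ such that $\sum_{\lambda\in\Lambda}e_\lambda=1$. Assume that the associated category $\mathcal{A}$ of $A$ is directed, and let $\check{A}$ be the associated graded algebra of $A$ with respect to $J=\bigoplus_{\lambda\neq\mu\in\Lambda}e_\mu Ae_\lambda$. Then the following are equivalent: (1) $A$ is standardly stratified (resp., properly stratified) for all linear orders on $\Lambda$; (2) the associated graded algebra $\check{A}$ is standardly stratified (resp., properly stratified) for all linear orders on $\Lambda$; (3) $\check{A}$ is the tensor algebra generated by $A_0=\bigoplus_{\lambda\in\Lambda}e_\lambda Ae_\lambda$ and $\check{A}_1$, where $\check{A}_1$ is a left (resp., left and right) projective $A_0$-module.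
   Context: All modules are finitely generated left modules unless otherwise stated; the zero module is regarded as projective. $P_\lambda=Ae_\lambda$, $S_\lambda=P_\lambda/\mathrm{rad}\,P_\lambda$. Associated category. $\mathcal{A}$ is the $\Bbbk$-linear category with objects $e_\lambda$, $\lambda\in\Lambda$, and morphism spaces $\mathcal{A}(e_\lambda,e_\mu)=e_\mu Ae_\lambda$. It is directed if there is a partial order $\leqslant$ on $\Lambda$ such that $e_\mu Ae_\lambda\neq0$ implies $\lambda\leqslant\mu$. In that case $J$ is a two-sided ideal of $A$ and $A=A_0\oplus J$ as vector spaces, with $A_0\cong A/J$. Associated graded algebra. $\check{A}=\bigoplus_{i\geqslant0}\check{A}_i$ with $\check{A}_0=A/J\cong A_0$ and $\check{A}_i=J^i/J^{i+1}$ for $i\geqslant1$. It is regarded as an algebra with the orthogonal primitive idempotents $e_\lambda\in A_0=\check{A}_0$, $\lambda\in\Lambda$. Tensor algebra. For an $(A_0,A_0)$-bimodule $X$, the tensor algebra generated by $A_0$ and $X$ is $A_0[X]=A_0\oplus X\oplus(X\otimes_{A_0}X)\oplus\cdots$. Condition (3) says $\check{A}\cong A_0[\check{A}_1]$ together with the projectivity of $\check{A}_1$. Stratification. For a linear order $\preccurlyeq$ on $\Lambda$, the standard module $\Delta_\lambda$ is the largest quotient of $P_\lambda$ all of whose composition factors $S_\mu$ satisfy $\mu\preccurlyeq\lambda$. The proper standard module $\overline{\Delta}_\lambda$ is the largest quotient of $P_\lambda$ all of whose composition factors $S_\mu$ satisfy $\mu\prec\lambda$, except for one copy of $S_\lambda$.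 $\mathcal{F}(\Delta)$ (resp. $\mathcal{F}(\overline{\Delta})$) is the category of modules having a finite filtration with factors isomorphic to standard (resp. proper standard) modules. The algebra is standardly stratified for $\preccurlyeq$ if its left regular module lies in $\mathcal{F}(\Delta)$, and properly stratified for $\preccurlyeq$ if its left regular module lies in $\mathcal{F}(\Delta)\cap\mathcal{F}(\overline{\Delta})$. The same definitions apply to $\check{A}$. *)

(* Defs.v *)
From HB Require Import structures.
From mathcomp Require Import all_boot all_order all_algebra all_field.

Set Implicit Arguments.
Unset Strict Implicit.
Unset Printing Implicit Defensive.

Import GRing.Theory.
Local Open Scope ring_scope.

(* V / U is realised on the chosen complement U^C of U; [vpi U] is the
   canonical projection (surjective with kernel U: [limg_vpi], [lker_vpi]). *)
Section VectorQuotient.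
Variables (K : fieldType) (V : vectType K) (U : {vspace V}).

Definition vquot : vectType K := subvs_of (U^C)%VS.

Definition vpi : 'Hom(V, vquot) :=
  (linfun (vsproj (U^C)%VS) \o daddv_pi (U^C)%VS U)%VF.

Lemma vpiE v : vsval (vpi v) = daddv_pi (U^C)%VS U v.
Proof. by rewrite comp_lfunE lfunE /= vsprojK // memv_pi. Qed.

Let dxCU : (U^C :&: U = 0)%VS. Proof. by rewrite capvC capv_compl. Qed.

Lemma vpi_val (q : vquot) : vpi (vsval q) = q.
Proof. by apply: val_inj; rewrite /= vpiE daddv_pi_id ?subvsP. Qed.

Lemma limg_vpi : limg vpi = fullv.
Proof.
apply/vspaceP => q; rewrite memvf; apply/idP.
by rewrite -(vpi_val q) memv_img ?memvf.
Qed.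

Lemma vpi_rep v : v - vsval (vpi v) \in U.
Proof.
rewrite vpiE -{1}[v](daddv_pi_add dxCU) ?addv_complf ?memvf //; last first.
  by rewrite addvC addv_complf memvf.
by rewrite addrC addKr memv_pi.
Qed.

Lemma lker_vpi : lker vpi = U.
Proof.
apply/vspaceP => v; rewrite memv_ker; apply/eqP/idP => [v0|Uv].
  by have := vpi_rep v; rewrite v0 /= subr0.
apply: val_inj; rewrite /=; apply/eqP; rewrite -memv0 -dxCU memv_cap subvsP.
by rewrite -memvN -(rpredDr _ Uv) ?rpredN //= addrC vpi_rep.
Qed.

End VectorQuotient.

(* Finitely generated modules over a finite-dimensional algebra are the
   finite-dimensional ones.  The product [mul] is a parameter so that left and
   right modules (= left modules for the opposite product) are both covered. *)
Section Modules.
Variables (K : fieldType) (B : falgType K) (mul : B -> B -> B).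

Record fdmod := FdMod {
  mod_sort :> vectType K;
  act : 'Hom(B, 'End(mod_sort));
  act1 : act 1 = \1%VF;
  actM : forall a b, act (mul a b) = (act a \o act b)%VF
}.
Implicit Types M N P Q D : fdmod.

Definition is_modhom M N (f : 'Hom(M, N)) : Prop :=
  forall a x, f (act M a x) = act N a (f x).

Definition is_epi M N (f : 'Hom(M, N)) : Prop := is_modhom f /\ limg f = fullv.

Definition mod_iso M N : Prop :=
  exists f : 'Hom(M, N), [/\ is_modhom f, lker f = 0%VS & limg f = fullv].

Definition projective P : Prop :=
  forall M N (p : 'Hom(M, N)) (f : 'Hom(P, N)), is_epi p -> is_modhom f ->
  exists2 g : 'Hom(P, M), is_modhom g & (p \o g)%VF = f.

Definition stable M (U : {vspace M}) : Prop :=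
  forall a x, x \in U -> act M a x \in U.

Definition maximal_submodule M (U : {vspace M}) : Prop :=
  [/\ stable U, U != fullv
    & forall V : {vspace M}, stable V -> (U <= V)%VS -> V = U \/ V = fullv].

Definition is_radical M (U : {vspace M}) : Prop :=
  forall x, x \in U <-> forall V : {vspace M}, maximal_submodule V -> x \in V.

Definition short_exact N M Q (i : 'Hom(N, M)) (p : 'Hom(M, Q)) : Prop :=
  [/\ is_modhom i, lker i = 0%VS, is_epi p & limg i = lker p].

(* [filtration F M s]: M has a filtration 0 = M_0 <= ... <= M_n = M whose
   successive factors, from the top down, lie in the classes F i, i in s. *)
Inductive filtration (I : Type) (F : I -> fdmod -> Prop) :
    fdmod -> seq I -> Prop :=
| Filtration0 M : (fullv : {vspace M}) = 0%VS -> filtration F M [::]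
| FiltrationS N M Q (f : 'Hom(N, M)) (p : 'Hom(M, Q)) (i : I) (s : seq I) :
    short_exact f p -> F i Q -> filtration F N s -> filtration F M (i :: s).

(* D is, up to isomorphism, the largest quotient of P with the property C:
   every quotient of P satisfying C is a quotient of D under P. *)
Definition largest_quotient (C : fdmod -> Prop) P D : Prop :=
  C D /\ exists2 p : 'Hom(P, D), is_epi p &
    forall Q (q : 'Hom(P, Q)), C Q -> is_epi q ->
    exists2 g : 'Hom(D, Q), is_modhom g & q = (g \o p)%VF.

Section Submodule.
Variables (M : fdmod) (U : {vspace M}) (stU : stable U).

Definition subact_fun (a : B) : 'End(subvs_of U) :=
  linfun (vsproj U \o act M a \o vsval).

Lemma subactE a x : vsval (subact_fun a x) = act M a (vsval x).
Proof. by rewrite lfunE /= vsprojK // stU ?subvsP. Qed.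

Fact subact_linear : linear subact_fun.
Proof.
move=> c a b; apply/lfunP => x; apply: val_inj; rewrite add_lfunE scale_lfunE.
rewrite [RHS]/= !subactE -[LHS]/(vsval _) subactE linearP /=.
by rewrite add_lfunE scale_lfunE.
Qed.
HB.instance Definition _ := GRing.isSemilinear.Build K B _ _ subact_fun
  (GRing.semilinear_linear subact_linear).

Definition subact : 'Hom(B, 'End(subvs_of U)) := linfun subact_fun.

Fact subact1 : subact 1 = \1%VF.
Proof.
apply/lfunP => x; apply: val_inj; rewrite lfunE -[LHS]/(vsval _) subactE.
by rewrite act1 !id_lfunE.
Qed.
Fact subactM a b : subact (mul a b) = (subact a \o subact b)%VF.
Proof.
apply/lfunP => x; apply: val_inj; rewrite comp_lfunE !(lfunE subact_fun).
by rewrite -[LHS]/(vsval _) -[RHS]/(vsval _) !subactE actM comp_lfunE.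
Qed.

Definition submod : fdmod := FdMod subact1 subactM.

Lemma act_submod a x : vsval (act submod a x) = act M a (vsval x).
Proof. by rewrite /= (lfunE subact_fun) subactE. Qed.
End Submodule.

Section Quotient.
Variables (M : fdmod) (U : {vspace M}) (stU : stable U).

Definition quotact_fun (a : B) : 'End(vquot U) :=
  linfun (vpi U \o act M a \o vsval).

Lemma quotactE a x : quotact_fun a (vpi U x) = vpi U (act M a x).
Proof.
rewrite lfunE /=; apply/eqP; rewrite -subr_eq0 -linearB -linearB /= -memv_ker.
by rewrite lker_vpi stU // -memvN opprB vpi_rep.
Qed.

Fact quotact_linear : linear quotact_fun.
Proof.
move=> c a b; apply/lfunP => x; rewrite -[x]vpi_val add_lfunE scale_lfunE.
by rewrite !quotactE linearP /= add_lfunE scale_lfunE linearP.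
Qed.
HB.instance Definition _ := GRing.isSemilinear.Build K B _ _ quotact_fun
  (GRing.semilinear_linear quotact_linear).

Definition quotact : 'Hom(B, 'End(vquot U)) := linfun quotact_fun.

Fact quotact1 : quotact 1 = \1%VF.
Proof.
apply/lfunP => x; rewrite -[x]vpi_val (lfunE quotact_fun) quotactE.
by rewrite act1 !id_lfunE.
Qed.
Fact quotactM a b : quotact (mul a b) = (quotact a \o quotact b)%VF.
Proof.
apply/lfunP => x; rewrite -[x]vpi_val comp_lfunE !(lfunE quotact_fun) !quotactE.
by rewrite actM comp_lfunE.
Qed.

Definition quotmod : fdmod := FdMod quotact1 quotactM.

Lemma act_quotmod a x : act quotmod a (vpi U x) = vpi U (act M a x).
Proof. by rewrite /= (lfunE quotact_fun) quotactE. Qed.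
End Quotient.

End Modules.

Arguments FdMod {K B mul mod_sort act}.
Arguments act {K B mul}.

Notation lmodule B := (@fdmod _ B *%R).
Notation rmodule B := (@fdmod _ B (fun a b => b * a)).

Section RegularModule.
Variables (K : fieldType) (R : falgType K).

Fact regact1 : linfun (@amull K R) 1 = \1%VF.
Proof. by rewrite lfunE /= amull1. Qed.

Fact regactM a b :
  linfun (@amull K R) (a * b)
    = (linfun (@amull K R) a \o linfun (@amull K R) b)%VF.
Proof. by rewrite !lfunE /= amullM. Qed.

Definition regmod : lmodule R := FdMod regact1 regactM.

Lemma regmodE a x : act regmod a x = a * x.
Proof. by rewrite /= !lfunE. Qed.
End RegularModule.
Arguments regmod {K} R.

(* X (x) Y is the space of matrices indexed by bases of X and Y. *)
Section KTensor.
Variables (K : fieldType) (X Y : vectType K).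

Definition ktensor_type : vectType K := 'M[K]_(\dim {:X}, \dim {:Y}).

Definition ktensor (x : X) (y : Y) : ktensor_type :=
  \matrix_(i, j) (coord (vbasis {:X}) i x * coord (vbasis {:Y}) j y).

Definition bilinear_map (Z : vectType K) (f : X -> Y -> Z) : Prop :=
  (forall y, linear (f^~ y)) /\ (forall x, linear (f x)).

Definition ktensor_lift (Z : vectType K) (f : X -> Y -> Z)
    (M : ktensor_type) : Z :=
  \sum_i \sum_j M i j *: f (vbasis {:X})`_i (vbasis {:Y})`_j.

Lemma ktensor_lift_linear (Z : vectType K) (f : X -> Y -> Z) : linear (ktensor_lift f).
Proof.
move=> c M N; rewrite scaler_sumr -big_split /=; apply: eq_bigr => i _.
rewrite scaler_sumr -big_split /=; apply: eq_bigr => j _.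
by rewrite !mxE scalerDl scalerA.
Qed.

HB.instance Definition _ (Z : vectType K) (f : X -> Y -> Z) :=
  GRing.isSemilinear.Build K ktensor_type Z _ (ktensor_lift f)
    (GRing.semilinear_linear (ktensor_lift_linear f)).

Lemma ktensor_bilinear : bilinear_map ktensor.
Proof.
split=> [y c x x'|x c y y']; apply/matrixP => i j; rewrite !mxE linearP /=.
  by rewrite mulrDl mulrA.
by rewrite mulrDr mulrCA.
Qed.

Lemma bilinear_sum (Z : vectType K) (f : X -> Y -> Z) x y : bilinear_map f ->
  f x y = \sum_i \sum_j (coord (vbasis {:X}) i x * coord (vbasis {:Y}) j y)
            *: f (vbasis {:X})`_i (vbasis {:Y})`_j.
Proof.
case=> fl fr.
pose gl y := GRing.isSemilinear.Build K X Z _ (f^~ y)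
  (GRing.semilinear_linear (fl y)).
pose Gl y : {linear X -> Z} := HB.pack (f^~ y) (gl y).
pose gr x := GRing.isSemilinear.Build K Y Z _ (f x)
  (GRing.semilinear_linear (fr x)).
pose Gr x : {linear Y -> Z} := HB.pack (f x) (gr x).
rewrite {1}(coord_vbasis (memvf x)) -[LHS]/(Gl y _) linear_sum.
apply: eq_bigr => i _; rewrite linearZ /= {1}(coord_vbasis (memvf y)).
rewrite -[f _ _]/(Gr _ _) linear_sum scaler_sumr; apply: eq_bigr => j _.
by rewrite linearZ /= scalerA.
Qed.

Lemma ktensor_liftE (Z : vectType K) (f : X -> Y -> Z) x y :
  bilinear_map f -> ktensor_lift f (ktensor x y) = f x y.
Proof.
move=> /bilinear_sum->; apply: eq_bigr => i _; apply: eq_bigr => j _.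
by rewrite mxE.
Qed.

Lemma ktensor_decomp (M : ktensor_type) : M = ktensor_lift ktensor M.
Proof.
have fr (V : vectType K) : free (vbasis {:V}) by exact: basis_free (vbasisP _).
apply/matrixP => i0 j0; rewrite summxE (bigD1 i0) //= [X in _ + X]big1 => [|i ni].
  rewrite addr0 summxE (bigD1 j0) //= big1 => [|j nj].
    by rewrite addr0 !mxE !coord_free // !eqxx !mulr1.
  by rewrite !mxE !coord_free // (negPf nj) !mulr0.
rewrite summxE big1 // => j _; rewrite !mxE !coord_free //.
by rewrite (negPf ni) mul0r mulr0.
Qed.

Lemma ktensor_ext (Z : vectType K) (f g : 'Hom(ktensor_type, Z)) :
  (forall x y, f (ktensor x y) = g (ktensor x y)) -> f = g.
Proof.
move=> fg; apply/lfunP => M; rewrite (ktensor_decomp M) !linear_sum.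
apply: eq_bigr => i _; rewrite !linear_sum; apply: eq_bigr => j _.
by rewrite !linearZ /= fg.
Qed.
End KTensor.

Section Tensor.
Variables (K : fieldType) (R : falgType K).

Record bimodule := Bimodule {
  bimod_left :> lmodule R;
  ract : 'Hom(R, 'End(bimod_left));
  ract1 : ract 1 = \1%VF;
  ractM : forall a b, ract (a * b) = (ract b \o ract a)%VF;
  act_ract : forall a b x,
    act bimod_left a (ract b x) = ract b (act bimod_left a x)
}.

Definition bimod_right (X : bimodule) : rmodule R :=
  @FdMod K R (fun a b => b * a) X (ract X) (ract1 X) (fun a b => ractM X b a).

Variables (X : bimodule) (Y : lmodule R).

(* K-span of the elements xa (x) y - x (x) ay; by trilinearity it is enough to
   let x, a, y run through bases, see [mem_tensor_relations]. *)
Definition tensor_relations : {vspace ktensor_type X Y} :=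
  (\sum_(i < \dim {:X}) \sum_(j < \dim {:R}) \sum_(l < \dim {:Y})
     let x := (vbasis {:X})`_i in
     let a := (vbasis {:R})`_j in
     let y := (vbasis {:Y})`_l in
     <[ktensor (ract X a x) y - ktensor x (act Y a y)]>)%VS.

Lemma mem_tensor_relations x a y :
  ktensor (ract X a x) y - ktensor x (act Y a y) \in tensor_relations.
Proof.
have [bl br] := @ktensor_bilinear K X Y.
pose g a x' y' := ktensor (ract X a x') y' - ktensor x' (act Y a y').
have g_bil b : bilinear_map (g b).
  by split=> [y' c x1 x2|x' c y1 y2]; rewrite /g !linearP /= ?bl ?br scalerBr
    opprD addrACA.
have g_lin x' y' : linear (fun b => g b x' y').
  move=> c b1 b2; rewrite /g !linearP /= !add_lfunE !scale_lfunE bl br.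
  by rewrite scalerBr opprD addrACA.
rewrite -/(g a x y) (bilinear_sum x y (g_bil a)).
apply: memv_suml => i _; apply: memv_suml => l _; apply: memvZ.
pose gm := GRing.isSemilinear.Build K R _ _ (fun b => g b _ _)
  (GRing.semilinear_linear (g_lin (vbasis {:X})`_i (vbasis {:Y})`_l)).
pose G : {linear R -> ktensor_type X Y} := HB.pack (fun b => g b _ _) gm.
rewrite -[g _ _ _]/(G a) (coord_vbasis (memvf a)) linear_sum.
apply: memv_suml => j _; rewrite linearZ; apply: memvZ.
rewrite memvE (sumv_sup i) // (sumv_sup j) // (sumv_sup l) //.
Qed.

(* The left action b (x (x) y) = bx (x) y. *)
Definition ktensor_act_fun (b : R) : 'End(ktensor_type X Y) :=
  linfun (ktensor_lift (fun x y => ktensor (act X b x) y)).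

Lemma ktensor_act_funE b x y :
  ktensor_act_fun b (ktensor x y) = ktensor (act X b x) y.
Proof.
have [bl br] := @ktensor_bilinear K X Y.
rewrite lfunE /= ktensor_liftE //.
by split=> [y' c x1 x2|x' c y1 y2]; rewrite ?linearP ?bl ?br.
Qed.

Fact ktensor_act_linear : linear ktensor_act_fun.
Proof.
have [bl br] := @ktensor_bilinear K X Y.
move=> c a b; apply: ktensor_ext => x y; rewrite add_lfunE scale_lfunE.
by rewrite !ktensor_act_funE linearP /= add_lfunE scale_lfunE bl.
Qed.
HB.instance Definition _ := GRing.isSemilinear.Build K R _ _ ktensor_act_fun
  (GRing.semilinear_linear ktensor_act_linear).

Fact ktensor_act1 : linfun ktensor_act_fun 1 = \1%VF.
Proof.
apply: ktensor_ext => x y.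
by rewrite (lfunE ktensor_act_fun) ktensor_act_funE act1 !id_lfunE.
Qed.
Fact ktensor_actM a b :
  linfun ktensor_act_fun (a * b)
    = (linfun ktensor_act_fun a \o linfun ktensor_act_fun b)%VF.
Proof.
apply: ktensor_ext => x y; rewrite comp_lfunE !(lfunE ktensor_act_fun).
by rewrite !ktensor_act_funE actM comp_lfunE.
Qed.

Definition ktensor_mod : lmodule R := FdMod ktensor_act1 ktensor_actM.

Fact tensor_relations_stable : @stable K R *%R ktensor_mod tensor_relations.
Proof.
move=> b t; have -> : act ktensor_mod b t = ktensor_act_fun b t.
  by rewrite /= (lfunE ktensor_act_fun).
rewrite -[t \in _]/(t \in tensor_relations) => t_rel.
suffices: (ktensor_act_fun b @: tensor_relations <= tensor_relations)%VS.
  by move/subvP; apply; rewrite memv_img.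
rewrite limg_sum; apply/subv_sumP => i _.
rewrite limg_sum; apply/subv_sumP => j _.
rewrite limg_sum; apply/subv_sumP => l _ /=.
rewrite limg_line -memvE linearB /= !ktensor_act_funE act_ract.
exact: mem_tensor_relations.
Qed.

Definition tensor_mod : lmodule R := quotmod tensor_relations_stable.

Definition tensor (x : X) (y : Y) : tensor_mod :=
  vpi tensor_relations (ktensor x y).

(* The map induced by a balanced bilinear f, see [tensor_liftE]. *)
Definition tensor_lift (Z : vectType K) (f : X -> Y -> Z) (t : tensor_mod) : Z :=
  ktensor_lift f (vsval (t : vquot tensor_relations)).

Lemma tensor_lift_linear (Z : vectType K) (f : X -> Y -> Z) :
  linear (tensor_lift f).
Proof.
move=> c t u.
exact: (linearP (ktensor_lift f \o @vsval K _ (tensor_relations^C)%VS)).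
Qed.

Lemma tensor_liftE (Z : vectType K) (f : X -> Y -> Z) x y :
    bilinear_map f -> (forall x a y, f (ract X a x) y = f x (act Y a y)) ->
  tensor_lift f (tensor x y) = f x y.
Proof.
move=> f_bil f_bal; rewrite /tensor_lift /tensor -[RHS](ktensor_liftE x y f_bil).
apply/esym/eqP; rewrite -subr_eq0 -linearB /=; set d := (X in ktensor_lift f X).
have: d \in tensor_relations by apply: vpi_rep.
suffices: (tensor_relations <= lker (linfun (ktensor_lift f)))%VS.
  by move/subvP=> sub /sub; rewrite memv_ker lfunE.
apply/subv_sumP => i _; apply/subv_sumP => j _; apply/subv_sumP => l _ /=.
rewrite -memvE memv_ker lfunE linearB /= !ktensor_liftE // f_bal subrr.
by [].
Qed.

End Tensor.

Section TensorAlgebra.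
Variables (K : fieldType) (R : falgType K) (X : bimodule R).

(* The homogeneous components R, X (x) R, X (x) (X (x) R), ... of R[X]. *)
Fixpoint tpow (n : nat) : lmodule R :=
  if n is m.+1 then tensor_mod X (tpow m) else regmod R.

(* The multiplication a . t = at, (x (x) s) . t = x (x) (s . t) of R[X]. *)
Fixpoint tmul (m n : nat) : tpow m -> tpow n -> tpow (m + n) :=
  match m return tpow m -> tpow n -> tpow (m + n) with
  | 0 => fun a t => act (tpow n) a t
  | m'.+1 => fun s t =>
      tensor_lift (fun x s' => tensor x (tmul s' t) : tpow (m' + n).+1) s
  end.

Lemma tensor_bilinear (Y : lmodule R) : bilinear_map (@tensor K R X Y).
Proof.
have [bl br] := @ktensor_bilinear K X Y.
by split=> [y c x x'|x c y y']; rewrite /tensor ?bl ?br linearP.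
Qed.

Lemma tensor_balanced (Y : lmodule R) x a (y : Y) :
  tensor (ract X a x) y = tensor x (act Y a y).
Proof.
apply/eqP; rewrite -subr_eq0 -linearB -memv_ker lker_vpi.
exact: mem_tensor_relations.
Qed.

Lemma act_tensor (Y : lmodule R) b x (y : Y) :
  act (tensor_mod X Y) b (tensor x y) = tensor (act X b x) y.
Proof.
rewrite /tensor /tensor_mod act_quotmod; congr (vpi _ _).
by rewrite /= (lfunE (@ktensor_act_fun _ _ _ _)) ktensor_act_funE.
Qed.

Lemma tensor_ext (Y : lmodule R) (P : tensor_mod X Y -> Prop) :
    (forall c t u, P t -> P u -> P (c *: t + u)) -> P 0 ->
  (forall x y, P (tensor x y)) -> forall t, P t.
Proof.
move=> P_lin P0 Pxy t; rewrite -[t](@vpi_val K _ (tensor_relations X Y)).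
rewrite (ktensor_decomp (vsval _)) /ktensor_lift linear_sum /=.
have Psum (I : finType) (F : I -> tensor_mod X Y) :
    (forall i, P (F i)) -> P (\sum_i F i).
  move=> PF; elim/big_rec: _ => // i u _ Pu.
  by rewrite -[F i]scale1r; apply: P_lin.
apply: (Psum) => i; rewrite linear_sum; apply: (Psum) => j.
rewrite linearZ /= -[_ *: _]addr0; apply: P_lin => //; exact: Pxy.
Qed.

Lemma tmul_props m n :
  [/\ forall t : tpow n, linear (fun s : tpow m => tmul s t),
      forall s : tpow m, linear (fun t : tpow n => tmul s t)
    & forall b (s : tpow m) (t : tpow n),
        tmul (act (tpow m) b s) t = act (tpow (m + n)) b (tmul s t)].
Proof.
elim: m => [|m [IHl IHr IHb]].
  split=> [t c a a'|a c t t'|b a t] /=.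
  - by rewrite linearP add_lfunE scale_lfunE.
  - by rewrite linearP.
  - by rewrite -[RHS]comp_lfunE -actM regmodE.
have [bl br] := tensor_bilinear (tpow (m + n)).
have bil (t : tpow n) : bilinear_map (fun (x : X) (s : tpow m) => tensor x (tmul s t)).
  by split=> [s c x x'|x c s s']; rewrite ?IHl (bl, br).
have bal (t : tpow n) (x : X) a (s : tpow m) : tensor (ract X a x) (tmul s t)
    = tensor x (tmul (act (tpow m) a s) t) by rewrite IHb tensor_balanced.
have SE (x : X) (s : tpow m) (t : tpow n) : tmul (tensor x s : tpow m.+1) t = tensor x (tmul s t).
  exact: tensor_liftE (bil t) (bal t).
have lin (t : tpow n) : linear (fun s : tpow m.+1 => tmul s t).
  by move=> c s s'; exact: tensor_lift_linear.
split=> // [s c t t'|b s t].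
  elim/tensor_ext: s => [d s s' IHs IHs'||x s].
  - rewrite !lin IHs IHs' !scalerDr !scalerA addrACA [d * c]mulrC.
    by [].
  - have lin0 (V W : vectType K) (f : V -> W) : linear f -> f 0 = 0.
      by move=> /(_ (-1) 0 0); rewrite scaler0 addr0 scaleN1r addNr.
    by rewrite !(lin0 _ _ _ (lin _)) scaler0 addr0.
  - by rewrite !SE IHr br.
have lin0 (V W : vectType K) (f : V -> W) : linear f -> f 0 = 0.
  by move=> /(_ (-1) 0 0); rewrite scaler0 addr0 scaleN1r addNr.
elim/tensor_ext: s => [d s s' IHs IHs'||x s].
- have actP k u v v' : act (tpow k) b (u *: v + v')
      = u *: act (tpow k) b v + act (tpow k) b v' by rewrite linearP.
  by rewrite lin !actP lin IHs IHs'.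
- have act0 k : act (tpow k) b 0 = 0 by rewrite linear0.
  by rewrite (lin0 _ _ _ (lin t)) !act0 (lin0 _ _ _ (lin t)).
- by rewrite act_tensor !SE act_tensor.
Qed.

Lemma tmulS m n (x : X) (s : tpow m) (t : tpow n) :
  tmul (tensor x s : tpow m.+1) t = tensor x (tmul s t).
Proof.
have [IHl IHr IHb] := tmul_props m n.
have [bl br] := tensor_bilinear (tpow (m + n)).
apply: (@tensor_liftE K R X (tpow m) _ (fun x s => tensor x (tmul s t))).
  by split=> [s' c x1 x2|x1 c s1 s2]; rewrite ?IHl (bl, br).
by move=> x1 a s1; rewrite IHb tensor_balanced.
Qed.

End TensorAlgebra.

Section AssociatedGraded.
Variables (K : fieldType) (A : falgType K).

Record ideal := Ideal {
  ideal_space :> {vspace A};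
  ideal_mull : ({:A} * ideal_space <= ideal_space)%VS;
  ideal_mulr : (ideal_space * {:A} <= ideal_space)%VS;
  ideal_proper : 1 \notin ideal_space
}.

Variable J : ideal.

(* J^i with J^0 = A (the library's J ^+ 0 is the line spanned by 1). *)
Definition ipow (i : nat) : {vspace A} :=
  if i is 0 then fullv else (J ^+ i)%VS.

Lemma ipowSl i : ipow i.+1 = (J * ipow i)%VS.
Proof.
case: i => [|i]; last by rewrite /ipow expvSl.
apply/eqP; rewrite eqEsubv ideal_mulr andbT /ipow expv1.
by apply/subvP => x Jx; rewrite -[x]mulr1 memv_mul ?memvf.
Qed.

Lemma ipow_mull i : ({:A} * ipow i <= ipow i)%VS.
Proof.
case: i => [|i]; first exact: subvf.
by rewrite ipowSl prodvA prodvSl // ideal_mull.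
Qed.

Lemma ipowD i j : (ipow i * ipow j <= ipow (i + j))%VS.
Proof.
elim: i => [|i IHi]; first exact: ipow_mull.
by rewrite ipowSl -prodvA addSn ipowSl prodvSr.
Qed.

Lemma memv_ipowM i j x y :
  x \in ipow i -> y \in ipow j -> x * y \in ipow (i + j).
Proof. by move=> xi yj; apply: (subvP (ipowD i j)); rewrite memv_mul. Qed.

Lemma ipowS i : (ipow i.+1 <= ipow i)%VS.
Proof.
rewrite ipowSl; apply: subv_trans (ipow_mull i).
by rewrite prodvSl ?subvf.
Qed.

Lemma ipow_le i j : (i <= j)%N -> (ipow j <= ipow i)%VS.
Proof.
elim: j => [|j IHj]; first by rewrite leqn0 => /eqP->.
rewrite leq_eqVlt => /predU1P[-> // | /IHj].
exact: subv_trans (ipowS j).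
Qed.

(* J^i / J^(i+1) = 0 for i > dim A. *)
Lemma ipow_stable i : (\dim {:A} <= i)%N -> ipow i.+1 = ipow i.
Proof.
have st j : ipow j.+1 = ipow j -> forall l, (j <= l)%N -> ipow l.+1 = ipow l.
  move=> eqj; elim=> [|l IHl]; first by rewrite leqn0 => /eqP <-.
  by rewrite leq_eqVlt => /predU1P[<- // | /IHl eql]; rewrite ipowSl eql -ipowSl.
move=> le_i; apply/eqP; apply: contraTT le_i => neq; rewrite -ltnNge.
have strict j : (j <= i)%N -> (j + \dim (ipow j) <= \dim {:A})%N ->
    (j.+1 + \dim (ipow j.+1) <= \dim {:A})%N.
  move=> le_ji bnd_j; apply: leq_trans bnd_j; rewrite addSn -addnS leq_add2l.
  rewrite ltn_neqAle dimvS ?ipowS // andbT.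
  apply: contra neq => /eqP eqd.
  have: ipow j.+1 = ipow j by apply/eqP; rewrite eqEdim ipowS eqd leqnn.
  by move/st=> /(_ i le_ji) ->.
have bnd j : (j <= i.+1)%N -> (j + \dim (ipow j) <= \dim {:A})%N.
  by elim: j => // j IHj lt_ji; apply: strict => //; apply/IHj/ltnW.
by apply: leq_trans (bnd i.+1 (leqnn _)); rewrite leq_addr.
Qed.

(* J^i/J^(i+1) is represented by the complement gr_comp i of J^(i+1) in J^i;
   gr_red i sends x in J^i to the representative of its class. *)
Definition gr_comp i : {vspace A} := (ipow i :\: ipow i.+1)%VS.
Definition gr_red i : 'End(A) := addv_pi1 (ipow i) (ipow i.+1).

Lemma gr_red_mem i x : gr_red i x \in gr_comp i.
Proof. exact: memv_pi. Qed.

Lemma gr_compS i : (gr_comp i <= ipow i)%VS. Proof. exact: diffvSl. Qed.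

Lemma gr_redP i x : x \in ipow i -> x - gr_red i x \in ipow i.+1.
Proof.
move=> xi; rewrite -{1}(@addv_pi1_pi2 _ _ (ipow i) (ipow i.+1) x).
  by rewrite addrC addKr memv_pi2.
by rewrite (subvP (addvSl _ _)).
Qed.

Lemma gr_red_id i x : x \in gr_comp i -> gr_red i x = x.
Proof. by apply: daddv_pi_id; rewrite capv_diff. Qed.

Lemma gr_red_eq0 i x : x \in ipow i -> (gr_red i x == 0) = (x \in ipow i.+1).
Proof.
move=> xi; apply/eqP/idP=> [x0 | xS]; first by have := gr_redP xi; rewrite x0 subr0.
apply/eqP; rewrite -memv0 -(capv_diff (ipow i) (ipow i.+1)) memv_cap gr_red_mem.
by rewrite -memvN -(rpredDl _ xS) ?rpredN //= gr_redP.
Qed.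

Lemma gr_red_eq i x y : x \in ipow i -> y \in ipow i ->
  x - y \in ipow i.+1 -> gr_red i x = gr_red i y.
Proof.
move=> xi yi xy; apply/eqP; rewrite -subr_eq0 -linearB gr_red_eq0 //.
exact: rpredB.
Qed.

(* Components of degree > dim A vanish by [ipow_stable], so that the direct sum
   of the J^i/J^(i+1) runs over the degrees 0, ..., dim A. *)
Definition gr_bound := (\dim {:A}).+1.

Definition gr_ev_fun (i : 'I_gr_bound) (f : {ffun 'I_gr_bound -> A}) : A := f i.
Fact gr_ev_linear i : linear (gr_ev_fun i).
Proof. by move=> c f g; rewrite /gr_ev_fun !ffunE. Qed.
HB.instance Definition _ i := GRing.isSemilinear.Build K _ _ _ (gr_ev_fun i)
  (GRing.semilinear_linear (gr_ev_linear i)).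

Definition gr_ev i : 'Hom({ffun 'I_gr_bound -> A}, A) := linfun (gr_ev_fun i).

Lemma gr_evE i f : gr_ev i f = f i. Proof. exact: lfunE. Qed.

Definition gr_space : {vspace {ffun 'I_gr_bound -> A}} :=
  (\bigcap_i (gr_ev i @^-1: gr_comp i))%VS.

Lemma mem_gr_space (f : {ffun 'I_gr_bound -> A}) :
  reflect (forall i : 'I_gr_bound, f i \in gr_comp i) (f \in gr_space).
Proof.
apply: (iffP idP) => [|fP].
  rewrite memvE => /subv_bigcapP fP i.
  by rewrite -(gr_evE i f) memv_preim memvE fP.
rewrite memvE; apply/subv_bigcapP => i _.
by rewrite -memvE -memv_preim gr_evE.
Qed.

Definition gr_alg : Type := subvs_of gr_space.
HB.instance Definition _ := Vector.on gr_alg.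
Implicit Types f g h : gr_alg.

Definition gr_coef f (i : 'I_gr_bound) : A := vsval f i.

Lemma gr_coef_comp f i : gr_coef f i \in gr_comp i.
Proof. by move: i; apply/mem_gr_space/subvsP. Qed.

Lemma gr_coef_ipow f i : gr_coef f i \in ipow i.
Proof. exact: (subvP (gr_compS i)) (gr_coef_comp f i). Qed.

Lemma gr_coef_linear c f g i :
  gr_coef (c *: f + g) i = c *: gr_coef f i + gr_coef g i.
Proof. by rewrite /gr_coef !ffunE. Qed.

Lemma gr_eqP f g : (forall i, gr_coef f i = gr_coef g i) -> f = g.
Proof. by move=> fg; apply/val_inj/ffunP. Qed.

(* The element whose component of degree i is the class of a i modulo
   J^(i+1). *)
Definition gr_mk (a : 'I_gr_bound -> A) : gr_alg :=
  vsproj gr_space [ffun i : 'I_gr_bound => gr_red i (a i)].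

Lemma gr_mkE a i : gr_coef (gr_mk a) i = gr_red i (a i).
Proof.
rewrite /gr_coef vsprojK ?ffunE //.
by apply/mem_gr_space => j; rewrite ffunE gr_red_mem.
Qed.

Definition gr_conv (a b : 'I_gr_bound -> A) (i : 'I_gr_bound) : A :=
  \sum_(j < gr_bound) \sum_(l < gr_bound | (j + l)%N == i) a j * b l.

Definition gr_one : gr_alg := gr_mk (fun i => if i == 0 :> nat then 1 else 0).
Definition gr_mul f g : gr_alg := gr_mk (gr_conv (gr_coef f) (gr_coef g)).

Let homog (a : 'I_gr_bound -> A) := forall i : 'I_gr_bound, a i \in ipow i.

Lemma gr_conv_ipow a b : homog a -> homog b -> homog (gr_conv a b).
Proof.
move=> aJ bJ i; apply: memv_suml => j _; apply: memv_suml => l /eqP <-.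
exact: memv_ipowM.
Qed.

Lemma gr_conv_cong a a' b b' : homog a -> homog a' -> homog b -> homog b' ->
    (forall i : 'I_gr_bound, a i - a' i \in ipow i.+1) ->
    (forall i : 'I_gr_bound, b i - b' i \in ipow i.+1) ->
  gr_mk (gr_conv a b) = gr_mk (gr_conv a' b').
Proof.
move=> aJ a'J bJ b'J aa' bb'; apply: gr_eqP => i; rewrite !gr_mkE.
apply: gr_red_eq; try exact: gr_conv_ipow.
rewrite /gr_conv -sumrB; apply: memv_suml => j _.
rewrite -sumrB; apply: memv_suml => l /eqP <-.
have -> : a j * b l - a' j * b' l = (a j - a' j) * b l + a' j * (b l - b' l).
  by rewrite mulrBl mulrBr addrA subrK.
by apply: rpredD; [rewrite -addSn | rewrite -addnS]; apply: memv_ipowM.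
Qed.

Lemma gr_mk_id f : gr_mk (gr_coef f) = f.
Proof. by apply: gr_eqP => i; rewrite gr_mkE gr_red_id ?gr_coef_comp. Qed.

Let rep (a : 'I_gr_bound -> A) : homog a ->
  forall i : 'I_gr_bound, gr_coef (gr_mk a) i - a i \in ipow i.+1.
Proof. by move=> aJ i; rewrite gr_mkE -memvN opprB gr_redP. Qed.

Lemma gr_mulE a b : homog a -> homog b ->
  gr_mul (gr_mk a) (gr_mk b) = gr_mk (gr_conv a b).
Proof.
by move=> aJ bJ; apply: gr_conv_cong => // i; rewrite ?gr_coef_ipow ?rep.
Qed.

Let sum_deg (F : 'I_gr_bound -> 'I_gr_bound -> A) (m i : 'I_gr_bound) :
  \sum_(p < gr_bound | (p + m)%N == i)
      \sum_(j < gr_bound) \sum_(l < gr_bound | (j + l)%N == p) F j l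
    = \sum_(j < gr_bound) \sum_(l < gr_bound | (j + l + m)%N == i) F j l.
Proof.
rewrite exchange_big /=; apply: eq_bigr => j _.
rewrite (exchange_big_dep (fun l : 'I_gr_bound => (j + l + m)%N == i)) /=.
  apply: eq_bigr => l /eqP jlm.
  have lt_jl : (j + l < gr_bound)%N.
    by apply: leq_ltn_trans (ltn_ord i); rewrite -jlm leq_addr.
  rewrite (big_pred1 (Ordinal lt_jl)) // => p; rewrite /= -(inj_eq val_inj) /=.
  by rewrite -jlm eqn_add2r eq_sym andbb.
by move=> p l /eqP <- /eqP <-.
Qed.

Lemma gr_convA a b c i :
  gr_conv a (gr_conv b c) i = gr_conv (gr_conv a b) c i.
Proof.
transitivity (\sum_(j < gr_bound) \sum_(l < gr_bound)
  \sum_(m < gr_bound | (j + l + m)%N == i)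
                a j * b l * c m).
  apply: eq_bigr => j _; transitivity (\sum_(p < gr_bound | (p + j)%N == i)
      \sum_(l < gr_bound) \sum_(m < gr_bound | (l + m)%N == p) a j * b l * c m).
    apply: eq_big => [p|p _]; first by rewrite addnC.
    rewrite mulr_sumr; apply: eq_bigr => l _.
    by rewrite mulr_sumr; apply: eq_bigr => m _; rewrite mulrA.
  rewrite sum_deg; apply: eq_bigr => l _; apply: eq_bigl => m.
  by rewrite addnC addnA.
under eq_bigr => j _ do rewrite (exchange_big_dep xpredT) //=.
rewrite exchange_big /= [RHS](exchange_big_dep xpredT) //=.
apply: eq_bigr => m _; rewrite -[LHS]sum_deg; apply: eq_bigr => p _.
by rewrite mulr_suml; apply: eq_bigr => j _; rewrite mulr_suml.
Qed.

Lemma gr_mk_ext a b : a =1 b -> gr_mk a = gr_mk b.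
Proof. by move=> ab; apply: gr_eqP => i; rewrite !gr_mkE ab. Qed.

Let coefJ f : homog (gr_coef f). Proof. exact: gr_coef_ipow. Qed.

Fact gr_mulA : associative gr_mul.
Proof.
move=> f g h; rewrite -[f in LHS]gr_mk_id -[h in RHS]gr_mk_id.
rewrite !gr_mulE //; try exact: gr_conv_ipow.
exact/gr_mk_ext/gr_convA.
Qed.

Let oneJ : homog (fun i => if i == 0 :> nat then 1 else 0).
Proof. by move=> i; case: eqP => [-> | _]; rewrite ?memvf ?mem0v. Qed.

Fact gr_mul1r : left_id gr_one gr_mul.
Proof.
move=> f; rewrite -[f in LHS]gr_mk_id gr_mulE // -[RHS]gr_mk_id.
apply: gr_mk_ext => i; rewrite /gr_conv (bigD1 ord0) //= [X in _ + X]big1.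
  rewrite addr0 (big_pred1 i) ?mul1r // => l; exact: (inj_eq val_inj).
move=> j; rewrite -(inj_eq val_inj) /= => /negPf->.
by rewrite big1 // => l _; rewrite mul0r.
Qed.

Fact gr_mulr1 : right_id gr_one gr_mul.
Proof.
move=> f; rewrite -[f in LHS]gr_mk_id gr_mulE // -[RHS]gr_mk_id.
apply: gr_mk_ext => i; rewrite /gr_conv (bigD1 i) //= [X in _ + X]big1.
  rewrite addr0 (big_pred1 ord0) ?mulr1 // => l.
  by rewrite -[RHS](inj_eq val_inj) /= -{2}[val i]addn0 eqn_add2l.
move=> j ji; rewrite big1 // => l /eqP jl; case: eqP => [l0|]; last by rewrite mulr0.
by case/eqP: ji; apply: val_inj; rewrite /= -jl l0 addn0.
Qed.

Let mul_linear_l h : linear (gr_mul^~ h).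
Proof.
move=> c f g; apply: gr_eqP => i; rewrite gr_coef_linear !gr_mkE -linearP.
congr (gr_red _ _); rewrite scaler_sumr -big_split; apply: eq_bigr => j _ /=.
rewrite scaler_sumr -big_split; apply: eq_bigr => l _ /=.
by rewrite gr_coef_linear mulrDl scalerAl.
Qed.

Let mul_linear_r f : linear (gr_mul f).
Proof.
move=> c g h; apply: gr_eqP => i; rewrite gr_coef_linear !gr_mkE -linearP.
congr (gr_red _ _); rewrite scaler_sumr -big_split; apply: eq_bigr => j _ /=.
rewrite scaler_sumr -big_split; apply: eq_bigr => l _ /=.
by rewrite gr_coef_linear mulrDr scalerAr.
Qed.

Fact gr_mulDl : left_distributive gr_mul +%R.
Proof. by move=> f g h; have := mul_linear_l h 1 f g; rewrite !scale1r. Qed.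

Fact gr_mulDr : right_distributive gr_mul +%R.
Proof. by move=> f g h; have := mul_linear_r f 1 g h; rewrite !scale1r. Qed.

Fact gr_one_neq0 : gr_one != 0.
Proof.
apply: contraNneq (ideal_proper J) => one0.
have : gr_coef gr_one ord0 = 0 by rewrite one0 /gr_coef ffunE.
by rewrite gr_mkE /= => /eqP; rewrite gr_red_eq0 ?memvf // /ipow expv1.
Qed.

HB.instance Definition _ := GRing.Zmodule_isNzRing.Build gr_alg
  gr_mulA gr_mul1r gr_mulr1 gr_mulDl gr_mulDr gr_one_neq0.

Fact gr_scaleAl c (f g : gr_alg) : c *: (f * g) = (c *: f) * g.
Proof.
have mul0 : gr_mul 0 g = 0 by exact: mul0r.
by have := mul_linear_l g c f 0; rewrite addr0 mul0 addr0 => /esym.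
Qed.
HB.instance Definition _ := GRing.Lmodule_isLalgebra.Build K gr_alg gr_scaleAl.

Fact gr_scaleAr c (f g : gr_alg) : c *: (f * g) = f * (c *: g).
Proof.
have mul0 : gr_mul f 0 = 0 by exact: mulr0.
by have := mul_linear_r f c g 0; rewrite addr0 mul0 addr0 => /esym.
Qed.
HB.instance Definition _ := GRing.Lalgebra_isAlgebra.Build K gr_alg gr_scaleAr.
HB.instance Definition _ := Algebra_isFalgebra.Build K gr_alg.

(* x |-> the class of x in degree i (meaningful for x in J^i). *)
Definition gr_cls_fun (i : nat) (x : A) : gr_alg :=
  gr_mk (fun j => if j == i :> nat then x else 0).

Fact gr_cls_linear i : linear (gr_cls_fun i).
Proof.
move=> c x y; apply: gr_eqP => j; rewrite gr_coef_linear !gr_mkE -linearP.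
by case: eqP; rewrite ?scaler0 ?addr0.
Qed.
HB.instance Definition _ i := GRing.isSemilinear.Build K A gr_alg _
  (gr_cls_fun i) (GRing.semilinear_linear (gr_cls_linear i)).

Definition gr_cls (i : nat) : 'Hom(A, gr_alg) := linfun (gr_cls_fun i).

Definition gr_part (i : nat) : {vspace gr_alg} := (gr_cls i @: ipow i)%VS.

Lemma gr_clsE i x j :
  gr_coef (gr_cls i x) j = if j == i :> nat then gr_red i x else 0.
Proof. by rewrite lfunE gr_mkE; case: eqP => [->|]; rewrite ?linear0. Qed.

Lemma gr_cls_eq0 i x : x \in ipow i -> (gr_cls i x == 0) = (x \in ipow i.+1).
Proof.
move=> xi; have [lti|gei] := ltnP i gr_bound; last first.
  rewrite (ipow_stable (ltnW gei)) xi; apply/eqP/gr_eqP => j.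
  by rewrite gr_clsE ltn_eqF ?(leq_trans (ltn_ord j)) // /gr_coef ffunE.
rewrite -gr_red_eq0 //; apply/eqP/eqP => [x0|x0].
  by have := gr_clsE i x (Ordinal lti); rewrite x0 /= eqxx /gr_coef ffunE.
by apply: gr_eqP => j; rewrite gr_clsE x0 if_same /gr_coef ffunE.
Qed.

Lemma gr_one_cls : 1 = gr_cls 0 1.
Proof. by rewrite lfunE. Qed.

Lemma gr_clsM i j x y : x \in ipow i -> y \in ipow j ->
  gr_cls i x * gr_cls j y = gr_cls (i + j) (x * y).
Proof.
move=> xi yj; rewrite !lfunE.
have hJ i' x' : x' \in ipow i' ->
    homog (fun l => if l == i' :> nat then x' else 0).
  by move=> x'J l; case: eqP => [->|] //; rewrite mem0v.
rewrite -[LHS]/(gr_mul _ _) gr_mulE; try exact: hJ.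
apply: gr_mk_ext => l; rewrite /gr_conv.
case: (l =P (i + j)%N :> nat) => [lij|nij]; last first.
  apply: big1 => p _; apply: big1 => q /eqP pq.
  case: eqP => [pi|]; last by rewrite mul0r.
  by case: eqP => [qj|]; rewrite ?mulr0 //; case: nij; rewrite -pq pi qj.
have lti : (i < gr_bound)%N by apply: leq_ltn_trans (ltn_ord l); rewrite lij leq_addr.
have ltj : (j < gr_bound)%N by apply: leq_ltn_trans (ltn_ord l); rewrite lij leq_addl.
rewrite (bigD1 (Ordinal lti)) //= [X in _ + X]big1 => [|p]; last first.
  rewrite -(inj_eq val_inj) /= => /negPf->.
  by apply: big1 => q _; rewrite mul0r.
rewrite addr0 (big_pred1 (Ordinal ltj)) /= ?eqxx // => q.
by rewrite lij eqn_add2l -[RHS](inj_eq val_inj).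
Qed.

Lemma gr_decomp f : f = \sum_(i < gr_bound) gr_cls i (gr_coef f i).
Proof.
apply: gr_eqP => j; rewrite {2}/gr_coef linear_sum sum_ffunE /=.
rewrite (bigD1 j) //= [X in _ + X]big1 => [|i ij].
  by rewrite addr0 -[RHS]/(gr_coef _ _) gr_clsE eqxx gr_red_id ?gr_coef_comp.
rewrite -[LHS]/(gr_coef _ _) gr_clsE.
by rewrite eq_sym (inj_eq val_inj) (negPf ij).
Qed.

Lemma gr_partM i j u v :
  u \in gr_part i -> v \in gr_part j -> u * v \in gr_part (i + j).
Proof.
move=> /memv_imgP[x xi ->] /memv_imgP[y yj ->].
by rewrite gr_clsM // memv_img // memv_ipowM.
Qed.

End AssociatedGraded.

(* For a subalgebra D of A, the summand J^i/J^(i+1) is a (D, D)-bimodule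
   through D -> A/J. *)
Section GradedBimodule.
Variables (K : fieldType) (A : falgType K) (J : ideal A) (D : {aspace A}).
Hypothesis D1 : 1 \in D.
Variable i : nat.
Implicit Types a b : subvs_of D.

Let iota a : gr_alg J := gr_cls J 0 (vsval a).

Let iota_part a : iota a \in gr_part J 0.
Proof. by rewrite memv_img ?memvf. Qed.

Let iota1 : iota 1 = 1.
Proof. by rewrite gr_one_cls /iota /= (eqP (_ : algid D == 1)) // algid_eq1. Qed.

Let iotaM a b : iota (a * b) = iota a * iota b.
Proof. by rewrite gr_clsM ?memvf. Qed.

Let iota_linear : linear iota.
Proof. by move=> c a b; rewrite /iota !linearP. Qed.

Definition gr_lact_fun a : 'End(subvs_of (gr_part J i)) :=
  linfun (vsproj (gr_part J i) \o amull (iota a) \o vsval).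
Definition gr_ract_fun a : 'End(subvs_of (gr_part J i)) :=
  linfun (vsproj (gr_part J i) \o amulr (iota a) \o vsval).

Lemma gr_lactE a x : vsval (gr_lact_fun a x) = gr_cls J 0 (vsval a) * vsval x.
Proof.
rewrite lfunE /= lfunE /= vsprojK //.
exact: gr_partM (iota_part a) (subvsP x).
Qed.

Lemma gr_ractE a x : vsval (gr_ract_fun a x) = vsval x * gr_cls J 0 (vsval a).
Proof.
rewrite lfunE /= lfunE /= vsprojK //.
by have := gr_partM (subvsP x) (iota_part a); rewrite addn0.
Qed.

Fact gr_lact_linear : linear gr_lact_fun.
Proof.
move=> c a b; apply/lfunP => x; apply: subvs_inj.
rewrite add_lfunE scale_lfunE linearP /= !gr_lactE -!/(iota _).
by rewrite iota_linear mulrDl scalerAl.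
Qed.
HB.instance Definition _ := GRing.isSemilinear.Build K (subvs_of D) _ _
  gr_lact_fun (GRing.semilinear_linear gr_lact_linear).

Fact gr_ract_linear : linear gr_ract_fun.
Proof.
move=> c a b; apply/lfunP => x; apply: subvs_inj.
rewrite add_lfunE scale_lfunE linearP /= !gr_ractE -!/(iota _).
by rewrite iota_linear mulrDr scalerAr.
Qed.
HB.instance Definition _ := GRing.isSemilinear.Build K (subvs_of D) _ _
  gr_ract_fun (GRing.semilinear_linear gr_ract_linear).

Fact gr_lact1 : linfun gr_lact_fun 1 = \1%VF.
Proof.
apply/lfunP => x; apply: subvs_inj.
by rewrite (lfunE gr_lact_fun) gr_lactE -/(iota _) iota1 mul1r id_lfunE.
Qed.
Fact gr_lactM a b :
  linfun gr_lact_fun (a * b) = (linfun gr_lact_fun a \o linfun gr_lact_fun b)%VF.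
Proof.
apply/lfunP => x; apply: subvs_inj; rewrite comp_lfunE !(lfunE gr_lact_fun).
by rewrite !gr_lactE -!/(iota _) iotaM mulrA.
Qed.
Fact gr_ract1 : linfun gr_ract_fun 1 = \1%VF.
Proof.
apply/lfunP => x; apply: subvs_inj.
by rewrite (lfunE gr_ract_fun) gr_ractE -/(iota _) iota1 mulr1 id_lfunE.
Qed.
Fact gr_ractM a b :
  linfun gr_ract_fun (a * b) = (linfun gr_ract_fun b \o linfun gr_ract_fun a)%VF.
Proof.
apply/lfunP => x; apply: subvs_inj; rewrite comp_lfunE !(lfunE gr_ract_fun).
by rewrite !gr_ractE -!/(iota _) iotaM mulrA.
Qed.

Definition gr_lmod : lmodule (subvs_of D) := FdMod gr_lact1 gr_lactM.

Fact gr_act_ract a b (x : gr_lmod) :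
  act gr_lmod a (linfun gr_ract_fun b x) = linfun gr_ract_fun b (act gr_lmod a x).
Proof.
apply: subvs_inj; rewrite /= !(lfunE gr_ract_fun) !(lfunE gr_lact_fun).
by rewrite gr_lactE !gr_ractE gr_lactE mulrA.
Qed.

Definition gr_bimod : bimodule (subvs_of D) :=
  @Bimodule K (subvs_of D) gr_lmod _ gr_ract1 gr_ractM gr_act_ract.

End GradedBimodule.

Section Idempotents.
Variables (K : fieldType) (A : falgType K) (L : finType) (e : L -> A).

Definition primitive_idempotent (x : A) : Prop :=
  [/\ x != 0, x * x = x
    & forall f g, f * f = f -> g * g = g -> f * g = 0 -> g * f = 0 ->
        x = f + g -> f = 0 \/ g = 0].

Definition complete_primitive : Prop :=
  [/\ forall lam, primitive_idempotent (e lam),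
      forall lam mu, lam != mu -> e lam * e mu = 0
    & \sum_lam e lam = 1].

Fact proj_stable lam :
  stable (M := regmod A) ({:A} * <[e lam]> : {vspace A})%VS.
Proof.
move=> a x; rewrite regmodE => /memv_cosetP[b _ ->].
by rewrite mulrA memv_mul ?memvf ?memv_line.
Qed.

Definition proj_mod lam : lmodule A := submod (@proj_stable lam).

Definition basic : Prop :=
  forall lam mu, mod_iso (proj_mod lam) (proj_mod mu) -> lam = mu.

(* S is isomorphic to S_mu = P_mu / rad P_mu. *)
Definition is_simple mu (S : lmodule A) : Prop :=
  exists2 p : 'Hom(proj_mod mu, S), is_epi p & is_radical (lker p).

(* The composition factors of M are, with multiplicity, the S_mu, mu in s. *)
Definition composition_factors (M : lmodule A) (s : seq L) : Prop :=
  filtration is_simple M s.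

Section Order.
Variable r : rel L.

Definition linear_order : Prop :=
  [/\ reflexive r, antisymmetric r, transitive r & total r].

Definition is_standard lam (D : lmodule A) : Prop :=
  largest_quotient
    (fun Q => exists2 s, composition_factors Q s & all (r^~ lam) s)
    (proj_mod lam) D.

Definition is_proper_standard lam (D : lmodule A) : Prop :=
  largest_quotient
    (fun Q => exists s t, [/\ composition_factors Q s, perm_eq s (lam :: t)
                            & all (fun mu => (mu != lam) && r mu lam) t])
    (proj_mod lam) D.

Definition standardly_stratified : Prop :=
  exists s, filtration is_standard (regmod A) s.

Definition properly_stratified : Prop :=
  (exists s, filtration is_standard (regmod A) s) /\
  (exists s, filtration is_proper_standard (regmod A) s).
End Order.

(* Morphisms e_lam -> e_mu of the category associated with A. *)
Definition cat_hom lam mu : {vspace A} :=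
  (<[e mu]> * {:A} * <[e lam]>)%VS.

Definition directed : Prop :=
  exists r : rel L, [/\ reflexive r, antisymmetric r, transitive r
    & forall lam mu, cat_hom lam mu != 0%VS -> r lam mu].

Definition diag_space : {vspace A} := (\sum_lam cat_hom lam lam)%VS.
(* The ideal J. *)
Definition offdiag_space : {vspace A} :=
  (\sum_lam \sum_(mu | mu != lam) cat_hom lam mu)%VS.

Section Complete.
Hypothesis he : complete_primitive.

Let e_idem lam : e lam * e lam = e lam.
Proof. by have [/(_ lam)[]] := he. Qed.
Let e_orth lam mu : lam != mu -> e lam * e mu = 0.
Proof. by have [_ + _] := he; apply. Qed.
Let e_sum : \sum_lam e lam = 1. Proof. by have [] := he. Qed.

Lemma cat_homP lam mu x :
  reflect (x = e mu * x * e lam) (x \in cat_hom lam mu).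
Proof.
apply: (iffP idP) => [/memv_cosetP[y]|->]; last first.
  by rewrite !memv_mul ?memvf ?memv_line.
have sub : (<[e mu]> * {:A} <= lker (amull (e mu) - \1%VF))%VS.
  apply/prodvP => _ v /vlineP[c ->] _.
  rewrite memv_ker !lfun_simp /= subr_eq0.
  by rewrite -scalerAl -scalerAr mulrA e_idem.
move/(subvP sub); rewrite memv_ker !lfun_simp /= subr_eq0.
by move=> /eqP yE ->; rewrite mulrA yE -mulrA e_idem.
Qed.

Lemma cat_hom_mem lam mu x : e mu * x * e lam \in cat_hom lam mu.
Proof. by rewrite !memv_mul ?memvf ?memv_line. Qed.

Lemma peirce x : x = \sum_lam \sum_mu e mu * x * e lam.
Proof.
rewrite -{1}[x]mulr1 -e_sum mulr_sumr; apply: eq_bigr => lam _.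
by rewrite -{1}[x]mul1r -e_sum !mulr_suml.
Qed.

Lemma cat_homM lam mu nu x y :
  x \in cat_hom mu nu -> y \in cat_hom lam mu -> x * y \in cat_hom lam nu.
Proof.
move=> /cat_homP-> /cat_homP->; apply/cat_homP.
by rewrite !mulrA e_idem -!mulrA e_idem.
Qed.

Lemma cat_homM0 lam mu mu' nu x y : mu != mu' ->
  x \in cat_hom mu nu -> y \in cat_hom lam mu' -> x * y = 0.
Proof.
move=> ne /cat_homP-> /cat_homP->.
by rewrite -!mulrA [e mu * _]mulrA e_orth // !(mul0r, mulr0).
Qed.

Lemma cat_hom_sub lam mu : lam != mu -> (cat_hom lam mu <= offdiag_space)%VS.
Proof.
by move=> ne; rewrite (sumv_sup lam) // (sumv_sup mu) // eq_sym.
Qed.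

Fact diag_is_aspace : is_aspace diag_space.
Proof.
apply/andP; split.
  apply: has_algid1; rewrite -e_sum; apply: memv_suml => lam _.
  rewrite memvE (sumv_sup lam) // -memvE; apply/cat_homP.
  by rewrite !e_idem.
apply/prodvP => _ _ /memv_sumP[x xP ->] /memv_sumP[y yP ->].
rewrite mulr_suml; apply: memv_suml => mu _.
rewrite mulr_sumr; apply: memv_suml => lam _.
have [->|ne] := eqVneq lam mu; last first.
  by rewrite (cat_homM0 _ (xP _ _) (yP _ _)) ?mem0v // eq_sym.
by rewrite memvE (sumv_sup mu) // -memvE (cat_homM (xP _ _) (yP _ _)).
Qed.

(* A_0 = (+)_lam e_lam A e_lam *)
Definition diag_aspace : {aspace A} := ASpace diag_is_aspace.

Hypothesis hd : directed.

Let dir_mul lam mu x y : lam != mu ->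
  x \in cat_hom mu lam -> y \in cat_hom lam mu -> x * y = 0.
Proof.
case: hd => r [_ r_anti _ r_hom] ne xP yP.
have [x0|nx] := eqVneq x 0; first by rewrite x0 mul0r.
have [y0|ny] := eqVneq y 0; first by rewrite y0 mulr0.
case/eqP: ne; apply: r_anti; rewrite !r_hom //.
  by apply: contraNneq nx => h0; rewrite -memv0 -h0.
by apply: contraNneq ny => h0; rewrite -memv0 -h0.
Qed.

Fact offdiag_mull : ({:A} * offdiag_space <= offdiag_space)%VS.
Proof.
apply/prodvP => x _ _ /memv_sumP[y yP ->]; rewrite mulr_sumr.
apply: memv_suml => lam _; have /memv_sumP[z zP ->] := yP lam isT.
rewrite mulr_sumr; apply: memv_suml => mu ne.
rewrite [x]peirce mulr_suml; apply: memv_suml => mu' _.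
rewrite mulr_suml; apply: memv_suml => nu _; have zmu := zP mu ne.
have [eq|ne'] := eqVneq mu' mu; last first.
  by rewrite (cat_homM0 ne' (cat_hom_mem _ _ _) zmu) mem0v.
rewrite eq; have [eq'|ne''] := eqVneq lam nu.
  rewrite -eq' (dir_mul _ (cat_hom_mem _ _ _) zmu) ?mem0v //.
  by rewrite eq_sym.
by rewrite (subvP (cat_hom_sub ne'')) // (cat_homM (cat_hom_mem _ _ _) zmu).
Qed.

Fact offdiag_mulr : (offdiag_space * {:A} <= offdiag_space)%VS.
Proof.
apply/prodvP => _ x /memv_sumP[y yP ->] _; rewrite mulr_suml.
apply: memv_suml => lam _; have /memv_sumP[z zP ->] := yP lam isT.
rewrite mulr_suml; apply: memv_suml => mu ne.
rewrite [x]peirce mulr_sumr; apply: memv_suml => nu _.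
rewrite mulr_sumr; apply: memv_suml => lam' _; have zmu := zP mu ne.
have [eq|ne'] := eqVneq lam lam'; last first.
  by rewrite (cat_homM0 ne' zmu (cat_hom_mem _ _ _)) mem0v.
rewrite -eq; have [eq'|ne''] := eqVneq nu mu.
  rewrite eq' (dir_mul _ zmu (cat_hom_mem _ _ _)) ?mem0v //.
by rewrite (subvP (cat_hom_sub ne'')) // (cat_homM zmu (cat_hom_mem _ _ _)).
Qed.

Fact offdiag_proper : 1 \notin offdiag_space.
Proof.
apply/negP => /memv_sumP[y yP y1].
suffices e0 nu : e nu = 0.
  by have /eqP[] := oner_neq0 A; rewrite -e_sum big1.
rewrite -[e nu]e_idem -{1}[e nu]mulr1 y1 mulr_sumr mulr_suml big1 // => lam _.
have /memv_sumP[z zP ->] := yP lam isT.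
rewrite mulr_sumr mulr_suml big1 // => mu ne.
have /cat_homP-> := zP mu ne; rewrite -!mulrA.
have [<-|ne'] := eqVneq lam nu; last by rewrite e_orth ?mulr0.
by rewrite mulrA e_orth ?mul0r // eq_sym.
Qed.

Definition offdiag_ideal : ideal A :=
  Ideal offdiag_mull offdiag_mulr offdiag_proper.

Definition assoc_graded : falgType K := gr_alg offdiag_ideal.

Definition assoc_graded_idem (lam : L) : assoc_graded :=
  gr_cls offdiag_ideal 0 (e lam).

Fact diag_aspace1 : 1 \in diag_aspace.
Proof.
rewrite -e_sum; apply: memv_suml => lam _.
by rewrite memvE (sumv_sup lam) // -memvE; apply/cat_homP; rewrite !e_idem.
Qed.

Definition diag_alg : falgType K := subvs_of diag_aspace.

Definition assoc_graded1 : bimodule diag_alg :=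
  gr_bimod offdiag_ideal diag_aspace1 1.

(* The associated graded algebra is the tensor algebra R[X] with R = A_0 and
   X = J/J^2: there is an isomorphism of graded algebras phi from R[X], with
   components [tpow] and product [tmul], which is the canonical identification
   in degrees 0 and 1 (x (x) 1 being x). *)
Definition graded_is_tensor_algebra : Prop :=
  exists phi : forall n, 'Hom(tpow assoc_graded1 n, assoc_graded),
  [/\ forall a : diag_alg, phi 0%N a = gr_cls offdiag_ideal 0 (vsval a),
      forall x : assoc_graded1,
        phi 1%N (tensor (Y := regmod diag_alg) x (1 : diag_alg)) = vsval x,
      forall m n (s : tpow assoc_graded1 m) (t : tpow assoc_graded1 n),
        phi (m + n)%N (tmul s t) = phi m s * phi n t
    & forall n, lker (phi n) = 0%VS /\
                limg (phi n) = gr_part offdiag_ideal n].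

End Complete.
End Idempotents.

(* Main.v *)
Require Import Defs.
From HB Require Import structures.
From mathcomp Require Import all_boot all_order all_algebra all_field.
From mathcomp Require Import zify.

Set Implicit Arguments.
Unset Strict Implicit.
Unset Printing Implicit Defensive.

Import GRing.Theory.
Local Open Scope ring_scope.

(* Write d_i = dim e_i A e_i, alpha_j = dim A e_j, and let x_ij be the multiplicity
   of A e_i in the projective cover of J e_j.  Always alpha_j <= d_j + sum_i
   alpha_i x_ij, with equality for all j iff J is left projective; this is
   equivalent to standard stratification for all orders.  Necessity: for an order
   with minimum j which otherwise reverses the direction, the trace in A e_j of the
   other projectives is J e_j, and comparing dimensions with a standard filtration
   gives equality.  Sufficiency: if J e_j is a direct sum of projectives A e_l, then
   for any order the trace defining the standard quotient of A e_j is a direct sum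
   of A e_l and of traces in A e_l, so one can induct along the direction.  For
   proper stratification one has to add that each e_i (J / J^2) e_j is free on the
   right over e_j A e_j.  All dimensions involved coincide for A and for its graded
   algebra, whence (1) <-> (2).

   Let tau phi j = sum_i phi_i x_ij and X = J / J^2.  If X is left projective, then
   the n-th tensor power of X has dimension sum_j (tau^n d)_j, and it maps onto
   J^n / J^(n+1).  If alpha = d + tau alpha, the total dimension of the tensor powers
   is at most that of A, so that these surjections are bijective.  Conversely, if
   they are bijective then tau^n d vanishes for large n, sum_n tau^n d has the same
   total mass as alpha, and alpha <= d + tau alpha forces equality. *)

(** Almost every equality is the extreme case of an inequality valid in general. Lifting generators
    of a top bounds a dimension from above term by term; if the sums agree, then so do all terms.
    The counts need one dimension per simple factor. Over a closed field each e_i A e_i is K e_i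
    plus a nilpotent ideal, so the dimension of e_i M is the multiplicity of S_i in M.
    [local_directed] keeps only this and a height function; these data pass to the graded algebra,
    so that every result applies to both algebras. For right freeness the order has [i] at the
    bottom and [j] next. In a proper standard filtration, the trace of the projectives of index
    other than [i] exceeds that of index other than [i] and [j] by the factors of index [j]. The
    e_j-components give their number. The e_i-components then have, in every column, the largest
    dimension that the generators of e_i (J / J^2) e_j over e_j A e_j allow, and column [j] is the
    freeness. Conversely, freeness of J / J^2 on both sides converts left ranks into right ranks,
    which makes the standard modules large enough to be filtered by proper standard ones. *)

Section LinearMap.
Variables (K : fieldType) (U V : vectType K) (f : U -> V) (lin : linear f).

Definition lfun_of : 'Hom(U, V) :=
  linfun (HB.pack f (GRing.isSemilinear.Build K _ _ _ f
    (GRing.semilinear_linear lin)) : {linear U -> V}).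

Lemma lfun_ofE x : lfun_of x = f x. Proof. exact: lfunE. Qed.

End LinearMap.

(** * Dimensions of subspaces and of their images *)

Section LinearAlgebra.
Variables (K : fieldType) (V : vectType K).
Implicit Types U W Z : {vspace V}.

Lemma dim_idem_sum (I : finType) (p : I -> 'End(V)) U :
    (forall x, \sum_i p i x = x) ->
    (forall i j x, i != j -> p i (p j x) = 0) ->
    (forall i, (p i @: U <= U)%VS) ->
  \dim U = (\sum_i \dim (p i @: U))%N.
Proof.
move=> p1 p0 pU.
have pp i x : p i (p i x) = p i x.
  by rewrite -{2}[x]p1 linear_sum (bigD1 i) //= big1 ?addr0 // => j ji; rewrite p0 // eq_sym.
have dx : directv (\sum_i p i @: U).
  apply/directv_sum_independent => u uP u0 i _.
  have uE j : p i (u j) = if j == i then u i else 0.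
    have [->|ji] := eqVneq j i.
      by have /memv_imgP[x _ ->] := uP i isT; rewrite pp.
    by have /memv_imgP[x _ ->] := uP j isT; rewrite p0 // eq_sym.
  have : p i (\sum_j u j) = 0 by rewrite u0 linear0.
  rewrite linear_sum (bigD1 i) //= uE eqxx big1 ?addr0 // => j /negPf ji.
  by rewrite uE ji.
rewrite -(directvP dx) /=; congr (\dim _); apply: subv_anti; apply/andP; split; last exact/subv_sumP.
  by apply/subvP => x Ux; rewrite -(p1 x); apply: memv_sumr => i _; apply: memv_img.
Qed.

Lemma dimv_img_le (V' : vectType K) (f : 'Hom(V, V')) U :
  (\dim (f @: U) <= \dim U)%N.
Proof. by rewrite -(limg_ker_dim f U) leq_addl. Qed.

Lemma dimv_add_le U W : (\dim (U + W) <= \dim U + \dim W)%N.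
Proof. by rewrite -dimv_sum_cap leq_addr. Qed.

Lemma dim_diffv U W : (W <= U)%VS -> \dim (U :\: W) = (\dim U - \dim W)%N.
Proof. by move=> /capv_idPr WU; rewrite -(dimv_cap_compl U W) WU addKn. Qed.

Lemma diffv_addK U W : (W <= U)%VS -> (U :\: W + W)%VS = U.
Proof. by move=> WU; rewrite addv_diff; apply/addv_idPl. Qed.

End LinearAlgebra.

Section LinearAlgebra2.
Variables (K : fieldType) (V : vectType K).
Implicit Types U W Z : {vspace V}.

(** Modulo [Z] the map kills [W], so that only a complement of [W] in [U] contributes. *)
Lemma dim_img_quot (V' : vectType K) (f : 'Hom(V, V')) U W (Z : {vspace V'}) :
    (W <= U)%VS -> (f @: W <= Z)%VS ->
  (\dim (f @: U + Z) <= \dim Z + (\dim U - \dim W))%N.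
Proof.
move=> WU fWZ; rewrite -dim_diffv // -{1}(diffv_addK WU) limgD -addvA.
rewrite (addv_idPr fWZ). apply: leq_trans (dimv_add_le _ _) _; rewrite addnC.
by rewrite leq_add2l dimv_img_le.
Qed.

(** Applied with [U] containing [N W] for a nilpotent [N]: the line [W / W1] is then killed by [N],
    and [W] can be taken apart one simple layer at a time. *)
Lemma hyperplane U W : (U <= W)%VS -> U != W ->
  exists W1 b, [/\ (U <= W1)%VS, W = (<[b]> + W1)%VS & \dim W = (\dim W1).+1].
Proof.
move=> UW neUW; have dC := dim_diffv UW.
have ltd : (\dim U < \dim W)%N.
  by rewrite ltn_neqAle dimvS // andbT; apply: contra neUW => /eqP d; rewrite eqEdim UW d /=.
case eX: (vbasis (W :\: U)%VS : seq V) => [|b X].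
  by move: ltd; rewrite -subn_gt0 -dC -(size_tuple (vbasis (W :\: U)%VS)) eX.
have sX : (size X).+1 = (\dim W - \dim U)%N by rewrite -dC -(size_tuple (vbasis (W :\: U)%VS)) eX.
have WE : W = (<[b]> + (<<X>> + U))%VS.
  by rewrite addvA -span_cons -eX (span_basis (vbasisP _)) diffv_addK.
exists (<<X>> + U)%VS, b; split=> //; first exact: addvSr.
apply/eqP; rewrite eqn_leq; apply/andP; split.
  rewrite {1}WE -add1n; apply: leq_trans (dimv_add_le _ _) _.
  by rewrite leq_add2r dim_vline leq_b1.
by rewrite -[\dim W](subnK (dimvS UW)) -sX addSn ltnS (leq_trans (dimv_add_le _ _)) // leq_add2r dim_span.
Qed.

Lemma dim_sum_le (I : finType) (P : pred I) (Us : I -> {vspace V}) :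
  (\dim (\sum_(i | P i) Us i) <= \sum_(i | P i) \dim (Us i))%N.
Proof. exact: dimv_leq_sum. Qed.

End LinearAlgebra2.

(** * Nakayama's lemma and a bound for products of subspaces *)

Section Nakayama.
Variables (K : fieldType) (A : falgType K).
Implicit Types N U W Z : {vspace A}.

(** Substituting the inclusion into itself pushes the first summand to [N ^+ n * W], which vanishes;
    the corrections stay in the [N]-stable [Z]. *)
Lemma nakayama N W Z n : (N ^+ n = 0)%VS -> (N * Z <= Z)%VS ->
  (W <= N * W + Z)%VS -> (W <= Z)%VS.
Proof.
move=> Nn NZ WNZ; have: (W <= N ^+ n * W + Z)%VS.
  elim: n {Nn} => [|n IHn]; first by rewrite expv0 prod1v addvSl.
  apply: subv_trans WNZ _; rewrite subv_add addvSr andbT expvSl -prodvA.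
  apply: subv_trans (prodvSr _ IHn) _; rewrite prodvDr.
  exact: addvS (subvv _) NZ.
by rewrite Nn prod0v add0v.
Qed.

(* A filtration of W / W' with one-dimensional factors killed by N on the left
   bounds the dimension of the product as if it were a tensor product. *)
Lemma dim_prod_bound N n (V V' Kv W W' Z : {vspace A}) :
    (N ^+ n = 0)%VS -> (W' <= W)%VS -> (N * W <= W)%VS -> (N * W' <= W')%VS ->
    (V' <= V)%VS -> (V' <= Kv + V * N)%VS -> (Kv * W <= Z)%VS ->
    (V * W' <= Z)%VS ->
  (\dim (V * W + Z) <= \dim Z + (\dim V - \dim V') * (\dim W - \dim W'))%N.
Proof.
move=> Nn W'W NW NW' V'V V'K KZ VW'.
move: {2}(\dim W - \dim W')%N (leqnn (\dim W - \dim W')) => m.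
elim: m W Z W'W NW KZ VW' => [|m IHm] W Z W'W NW KZ VW' dW.
  have /eqP EW : W' == W by rewrite eqEdim W'W; move: dW; rewrite leqn0 subn_eq0.
  by rewrite EW in VW'; rewrite (addv_idPr VW') leq_addr.
have [EW|neW] := eqVneq W' W.
  by rewrite EW in VW'; rewrite (addv_idPr VW') leq_addr.
have subW : (N * W + W' <= W)%VS by rewrite subv_add NW.
have neNW : (N * W + W')%VS != W.
  apply: contra neW => /eqP E; rewrite eqEsubv W'W /=.
  by apply: (nakayama Nn) => //; rewrite E.
have [W1 [b [W1P WE dW1]]] := hyperplane subW neNW.
have W1W : (W1 <= W)%VS by rewrite WE addvSr.
have W'W1 : (W' <= W1)%VS by apply: subv_trans W1P; apply: addvSr.
have bW : b \in W by rewrite WE (subvP (addvSl _ _)) ?memv_line.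
have NW1 : (N * W <= W1)%VS by apply: subv_trans W1P; apply: addvSl.
have IH := IHm W1 Z W'W1 (subv_trans (prodvSr _ W1W) NW1)
  (subv_trans (prodvSr _ W1W) KZ) VW'.
(* The layer of [b] costs only [dim V - dim V']: [Kv b] lies in [Z], and [V N b] lies in [V W1]
   because [N b] lies in [W1]. *)
have : (amulr b @: V' <= V * W1 + Z)%VS.
  rewrite limg_amulr; apply: subv_trans (prodvSl _ V'K) _; rewrite prodvDl.
  rewrite subv_add; apply/andP; split.
    apply: subv_trans (addvSr _ _); apply: subv_trans KZ; apply: prodvSr.
    by rewrite -memvE.
  rewrite -prodvA; apply: subv_trans (addvSl _ _); apply: prodvSr.
  by apply: subv_trans NW1; apply: prodvSr; rewrite -memvE.
move=> /(dim_img_quot V'V); rewrite limg_amulr addvA -prodvDr -WE => H1.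
apply: leq_trans H1 _.
have {}IH : (\dim (V * W1 + Z) <= \dim Z + (\dim V - \dim V') * (\dim W1 - \dim W'))%N.
  by apply: IH; rewrite -ltnS -subSn ?dimvS // -dW1.
have -> : (\dim W - \dim W' = (\dim W1 - \dim W').+1)%N by rewrite dW1 subSn ?dimvS.
by rewrite mulnS addnCA [X in (_ <= X)%N]addnC leq_add2r.
Qed.

End Nakayama.

(** * Peirce decomposition *)

Section ModulesGeneral.
Variables (K : fieldType) (A : falgType K) (mul : A -> A -> A).
Implicit Types (M : fdmod mul) (a b : A).

Fact orbm_linear M (x : M) : linear (fun a => act M a x).
Proof. by move=> c a b; rewrite linearP add_lfunE scale_lfunE. Qed.

Definition orbm M (x : M) : 'Hom(A, M) := lfun_of (orbm_linear x).

Lemma orbmE M (x : M) a : orbm x a = act M a x.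
Proof. exact: lfun_ofE. Qed.

Lemma act_sum M (I : finType) (P : pred I) (F : I -> A) x :
  act M (\sum_(i | P i) F i) x = \sum_(i | P i) act M (F i) x.
Proof. by rewrite -orbmE linear_sum; apply: eq_bigr => i _; exact: orbmE. Qed.

Lemma act_one M x : act M 1 x = x.
Proof. by rewrite act1 id_lfunE. Qed.

Variable M : fdmod mul.
Implicit Types (U : {vspace A}) (Y Z : {vspace M}).

(** The module analogue of the product of subspaces: the span of the elements [a y]. *)
Definition actv U Y : {vspace M} :=
  (\sum_(j < \dim U) act M (vbasis U)`_j @: Y)%VS.

Lemma mem_actv U Y a y : a \in U -> y \in Y -> act M a y \in actv U Y.
Proof.
move=> aU yY; rewrite (coord_vbasis aU) -orbmE linear_sum; apply: memv_suml => j _.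
rewrite linearZ memvZ //= orbmE memvE (sumv_sup j) // -memvE memv_img //.
Qed.

Lemma actv_sub U Y Z :
  (forall a y, a \in U -> y \in Y -> act M a y \in Z) -> (actv U Y <= Z)%VS.
Proof.
move=> UYZ; apply/subv_sumP => j _; apply/subvP => _ /memv_imgP[y yY ->].
by apply: UYZ => //; apply/vbasis_mem/mem_nth; rewrite size_tuple.
Qed.

End ModulesGeneral.

Section Modules.
Variables (K : fieldType) (A : falgType K).
Implicit Types (M D Q : lmodule A) (a b : A).

Lemma act_mul M a b x : act M (a * b) x = act M a (act M b x).
Proof. by rewrite actM comp_lfunE. Qed.

Lemma modhom_sub M (U : {vspace M}) (stU : stable U) : is_modhom (M := submod stU) (N := M) (linfun (@vsval K M U)).
Proof. by move=> a x; rewrite [LHS]lfunE [X in act M a X]lfunE; apply: act_submod. Qed.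

Lemma lker_vsval (V : vectType K) (U : {vspace V}) : lker (linfun (@vsval K V U)) = 0%VS.
Proof. by apply/eqP/lker0P => x y; rewrite !lfunE; apply: subvs_inj. Qed.

Lemma limg_vsval (V : vectType K) (U : {vspace V}) : limg (linfun (@vsval K V U)) = U.
Proof.
apply/vspaceP => x; apply/idP/idP => [/memv_imgP[y _ ->]|Ux].
  by rewrite lfunE subvsP.
by apply/memv_imgP; exists (vsproj U x); rewrite ?memvf // lfunE /= vsprojK.
Qed.

Lemma limg_amull (a : A) (U : {vspace A}) : (amull a @: U = <[a]> * U)%VS.
Proof.
apply/vspaceP => x; apply/idP/idP => [/memv_imgP[y Uy ->]|].
  by rewrite lfunE memv_mul ?memv_line.
apply/subvP/prodvP => _ y /vlineP[c ->] Uy.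
by apply/memv_imgP; exists (c *: y); rewrite ?memvZ // lfunE /= -scalerAl scalerAr.
Qed.

End Modules.

Section Idempotents.
Variables (K : fieldType) (A : falgType K) (L : finType) (e : L -> A).

(* Hom(e_j, e_i), i.e. the Peirce component e_i A e_j. *)
Definition blk (i j : L) : {vspace A} := cat_hom e j i.

Definition pcol (j : L) : {vspace A} := ({:A} * <[e j]>)%VS.

(* The radical N i of e_i A e_i has codimension one, and h is a height function
   witnessing that the category is directed. *)
Record local_directed (N : L -> {vspace A}) (h : L -> nat) : Prop := {
  ld_idem : forall i, e i * e i = e i;
  ld_orth : forall i j, i != j -> e i * e j = 0;
  ld_sum : \sum_i e i = 1;
  ld_dir : forall i j, i != j -> blk i j != 0%VS -> (h j < h i)%N;
  ld_dec : forall i, blk i i = (<[e i]> + N i)%VS;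
  ld_notin : forall i, e i \notin N i;
  ld_mull : forall i, (blk i i * N i <= N i)%VS;
  ld_mulr : forall i, (N i * blk i i <= N i)%VS;
  ld_nil : exists n, forall i, (N i ^+ n = 0)%VS
}.

Variables (N : L -> {vspace A}) (h : L -> nat).
Hypothesis H : local_directed N h.

Let e_idem i : e i * e i = e i. Proof. exact: ld_idem H i. Qed.
Let e_orth i j : i != j -> e i * e j = 0. Proof. exact: ld_orth H i j. Qed.
Let e_sum : \sum_i e i = 1. Proof. exact: ld_sum H. Qed.

Lemma e_mul i j : e i * e j = if i == j then e i else 0.
Proof. by case: eqVneq => [<-|/e_orth]. Qed.

Lemma e_neq0 i : e i != 0.
Proof. by apply: contraNneq (ld_notin H i) => ->; rewrite mem0v. Qed.

Lemma blkP i j x : reflect (e i * x * e j = x) (x \in blk i j).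
Proof.
apply: (iffP idP) => [/memv_cosetP[y]|<-]; last first.
  by rewrite !memv_mul ?memvf ?memv_line.
have sub : (<[e i]> * {:A} <= lker (amull (e i) - \1%VF))%VS.
  apply/prodvP => _ v /vlineP[c ->] _.
  rewrite memv_ker !lfun_simp /= subr_eq0.
  by rewrite -scalerAl -scalerAr mulrA e_idem.
move/(subvP sub); rewrite memv_ker !lfun_simp /= subr_eq0.
by move=> /eqP yE ->; rewrite mulrA yE -mulrA e_idem.
Qed.

Lemma mem_blk i j x : e i * x * e j \in blk i j.
Proof. by rewrite !memv_mul ?memvf ?memv_line. Qed.

Lemma blk_l i j x : x \in blk i j -> e i * x = x.
Proof. by move/blkP <-; rewrite !mulrA e_idem. Qed.

Lemma blk_r i j x : x \in blk i j -> x * e j = x.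
Proof. by move/blkP <-; rewrite -!mulrA e_idem. Qed.

Lemma mem_blkE i j x : e i * x = x -> x * e j = x -> x \in blk i j.
Proof. by move=> xl xr; apply/blkP; rewrite xl. Qed.

Lemma blkM i j l x y : x \in blk i j -> y \in blk j l -> x * y \in blk i l.
Proof.
by move=> xP yP; apply: mem_blkE; rewrite ?mulrA ?(blk_l xP) // -mulrA (blk_r yP).
Qed.

Lemma blkM0 i j j' l x y : j != j' -> x \in blk i j -> y \in blk j' l -> x * y = 0.
Proof.
move=> jj xP yP; rewrite -(blk_r xP) -(blk_l yP) -mulrA (mulrA (e j)).
by rewrite e_orth // mul0r mulr0.
Qed.

Lemma prod_blk i j l : (blk i j * blk j l <= blk i l)%VS.
Proof. by apply/prodvP => x y; apply: blkM. Qed.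

Lemma e_blk i : e i \in blk i i.
Proof. by apply: mem_blkE; rewrite e_idem. Qed.

Lemma memv_e i : (<[e i]> <= blk i i)%VS.
Proof. by rewrite -memvE e_blk. Qed.

Lemma pcolP j x : reflect (x * e j = x) (x \in pcol j).
Proof.
apply: (iffP memv_cosetP) => [[y _ ->]|<-]; first by rewrite -mulrA e_idem.
by exists x; rewrite ?memvf.
Qed.

Lemma e_pcol j : e j \in pcol j. Proof. by apply/pcolP. Qed.

Lemma blk_pcol i j : (blk i j <= pcol j)%VS.
Proof. by apply/subvP => x /blk_r xP; apply/pcolP. Qed.

Lemma blk0 i j : ~~ (h j < h i)%N -> i != j -> blk i j = 0%VS.
Proof. by move=> hij ij; apply: contraNeq hij; apply: (ld_dir H). Qed.

(** A nonzero off-diagonal component strictly raises the height, so one of the two factors is zero.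
    Directedness enters most arguments in this form: no product of components leaves an index and
    returns to it. *)
Lemma blk_mul0 i j : i != j -> (blk i j * blk j i = 0)%VS.
Proof.
move=> ij; have [lt_ji|ge_ji] := boolP (h j < h i)%N; last first.
  by rewrite blk0 ?prod0v.
by rewrite (@blk0 j i) ?prodv0 // 1?eq_sym // -leqNgt ltnW.
Qed.

Lemma N_blk i : (N i <= blk i i)%VS.
Proof. by rewrite (ld_dec H) addvSr. Qed.

Lemma N_nil : exists n, forall i, (N i ^+ n = 0)%VS. Proof. exact: ld_nil H. Qed.

Lemma dim_N i : \dim (blk i i) = (\dim (N i)).+1.
Proof.
rewrite (ld_dec H) dimv_disjoint_sum ?dim_vline ?e_neq0 ?add1n //.
apply/eqP; rewrite -subv0; apply/subvP => x /memv_capP[/vlineP[c ->]].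
have [->|c0] := eqVneq c 0; first by move=> _; rewrite scale0r mem0v.
move=> /(memvZ c^-1); rewrite scalerA mulVf // scale1r => eN.
by case/negP: (ld_notin H i).
Qed.

Lemma peirce_sum (x : A) : x = \sum_i e i * x.
Proof. by rewrite -mulr_suml e_sum mul1r. Qed.

Lemma peirce_sumr (x : A) : x = \sum_i x * e i.
Proof. by rewrite -mulr_sumr e_sum mulr1. Qed.

Lemma dim_peircel (U : {vspace A}) :
  (forall i, (<[e i]> * U <= U)%VS) -> \dim U = (\sum_i \dim (<[e i]> * U))%N.
Proof.
move=> eU; rewrite (@dim_idem_sum _ _ _ (fun i => amull (e i)) U).
- by apply: eq_bigr => i _; rewrite limg_amull.
- by move=> x; rewrite {2}[x]peirce_sum; apply: eq_bigr => i _; rewrite lfunE.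
- by move=> i j x ij; rewrite !lfunE /= mulrA e_orth // mul0r.
- by move=> i; rewrite limg_amull.
Qed.

Lemma dim_peircer (U : {vspace A}) :
  (forall i, (U * <[e i]> <= U)%VS) -> \dim U = (\sum_i \dim (U * <[e i]>))%N.
Proof.
move=> eU; rewrite (@dim_idem_sum _ _ _ (fun i => amulr (e i)) U).
- by apply: eq_bigr => i _; rewrite limg_amulr.
- by move=> x; rewrite {2}[x]peirce_sumr; apply: eq_bigr => i _; rewrite lfunE.
- by move=> i j x ij; rewrite !lfunE /= -mulrA e_orth ?mulr0 // eq_sym.
- by move=> i; rewrite limg_amulr.
Qed.

Lemma blkE i j : blk i j = (<[e i]> * pcol j)%VS.
Proof. by rewrite /blk /cat_hom /pcol prodvA. Qed.

Lemma dim_pcol j : \dim (pcol j) = (\sum_i \dim (blk i j))%N.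
Proof.
rewrite dim_peircel; first by apply: eq_bigr => i _; rewrite blkE.
by move=> i; rewrite /pcol prodvA prodvSl ?subvf.
Qed.

Definition left_ideal (U : {vspace A}) := ({:A} * U <= U)%VS.

Lemma left_idealM U a x : left_ideal U -> x \in U -> a * x \in U.
Proof. by move=> /subvP UP Ux; apply: UP; rewrite memv_mul ?memvf. Qed.

Lemma left_ideal_line (f : A) U : left_ideal U -> (<[f]> * U <= U)%VS.
Proof. exact: subv_trans (prodvSl _ (subvf _)). Qed.

Lemma left_ideal_prod U V : left_ideal U -> left_ideal (U * V).
Proof. by rewrite /left_ideal prodvA => lU; apply: prodvSl. Qed.

Lemma left_ideal_full V : left_ideal ({:A} * V).
Proof. by apply: left_ideal_prod; apply: subvf. Qed.

Lemma left_ideal_add U V : left_ideal U -> left_ideal V -> left_ideal (U + V).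
Proof. by move=> lU lV; rewrite /left_ideal prodvDr addvS. Qed.

Lemma left_ideal_sum (I : Type) (r : seq I) (P : pred I) (F : I -> {vspace A}) :
  (forall i, P i -> left_ideal (F i)) -> left_ideal (\sum_(i <- r | P i) F i).
Proof.
move=> lF; elim/big_rec: _ => [|i U Pi lU]; first by rewrite /left_ideal prodv0.
by apply: left_ideal_add => //; apply: lF.
Qed.

Lemma left_ideal_pcol j : left_ideal (pcol j).
Proof. exact: left_ideal_full. Qed.

Lemma stable_left (U : {vspace A}) : left_ideal U -> stable (M := regmod A) U.
Proof. by move=> lU a x Ux; rewrite regmodE; apply: left_idealM. Qed.

Lemma mem_pcol_blk j x : x \in pcol j -> forall i, e i * x \in blk i j.
Proof. by move=> /pcolP <- i; rewrite mulrA mem_blk. Qed.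

Lemma e_line_left i U x : x \in (<[e i]> * U)%VS -> e i * x = x.
Proof.
rewrite -limg_amull => /memv_imgP[y _ ->]; by rewrite lfunE /= mulrA e_idem.
Qed.

End Idempotents.

(** * Filtrations and subfactors *)

Section Filtrations.
Variables (K : fieldType) (A : falgType K).
Implicit Types (M D Q P : lmodule A) (a b : A).

(** Taking the image of an idempotent is exact. *)
Lemma short_exact_dim M Q P (f : 'Hom(P, M)) (p : 'Hom(M, Q)) (a : A) :
    short_exact f p -> a * a = a ->
  \dim (act M a @: fullv) = (\dim (act P a @: fullv) + \dim (act Q a @: fullv))%N.
Proof.
case=> homf kf [homp sp] fp aa.
rewrite -(limg_ker_dim p (act M a @: fullv)); congr (_ + _)%N.
  rewrite -[RHS](@limg_dim_eq _ _ _ f); last by rewrite kf capv0.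
  congr (\dim _); apply/vspaceP => x; apply/memv_capP/idP => [[/memv_imgP[y _ ->]]|].
    rewrite -fp => /memv_imgP[z _ yz]; apply/memv_imgP; exists (act P a z).
      by rewrite memv_img ?memvf.
    by rewrite homf -yz -act_mul aa.
  move=> /memv_imgP[_ /memv_imgP[z _ ->] ->]; rewrite homf memv_img ?memvf //; split=> //.
  by rewrite -homf -fp memv_img ?memvf.
congr (\dim _); rewrite -[in RHS]sp; apply/vspaceP => x; apply/idP/idP.
  move=> /memv_imgP[_ /memv_imgP[z _ ->] ->]; rewrite homp.
  by rewrite !memv_img ?memvf.
move=> /memv_imgP[_ /memv_imgP[z _ ->] ->]; rewrite -homp.
by rewrite !memv_img ?memvf.
Qed.

Lemma filtration_dim (I : eqType) (F : I -> lmodule A -> Prop) (a : A)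
    (d : I -> nat) M s : a * a = a ->
    (forall i Q, F i Q -> \dim (act Q a @: fullv) = d i) ->
  filtration F M s -> \dim (act M a @: fullv) = (\sum_(i <- s) d i)%N.
Proof.
move=> aa Fd; elim=> {M s} [M M0|P M Q f p i s fp Fi _ IH].
  by rewrite big_nil M0 limg0 dimv0.
by rewrite big_cons (short_exact_dim fp aa) IH (Fd _ _ Fi) addnC.
Qed.

(** For [U] inside [A e] this says that [D] is isomorphic to [A e / U], with [m] the image of
    [e]. *)
Definition gen_by (e : A) (U : {vspace A}) D : Prop :=
  exists m : D, [/\ act D e m = m, limg (orbm m) = fullv
    & forall a, (act D a m == 0) = (a * e \in U)].

(* W / W' is isomorphic to A e / U. *)
Definition subfactor (e : A) (U : {vspace A}) M (W W' : {vspace M}) :=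
  exists m : M, [/\ act M e m = m, W = (limg (orbm m) + W')%VS
    & forall a, (act M a m \in W') = (a * e \in U)].

(** [filtration] links separate modules by exact sequences, while the constructions below produce
    chains of submodules of one module; this translates one step of such a chain. *)
Lemma filtration_subfactor (I : Type) (F : I -> lmodule A -> Prop) (i : I) s
    (e : A) (U : {vspace A}) M (W W' : {vspace M}) (stW : stable W)
    (stW' : stable W') :
    (forall D, gen_by e U D -> F i D) -> subfactor e U W W' ->
  filtration F (submod stW') s -> filtration F (submod stW) (i :: s).
Proof.
move=> FU [m [em WE mU]] FW'.
have W'W : (W' <= W)%VS by rewrite WE addvSr.
pose W1 : {vspace submod stW} := (linfun (@vsval K M W) @^-1: W')%VS.
have memW1 x : (x \in W1) = (vsval x \in W') by rewrite -memv_preim lfunE.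
have stW1 : stable W1.
  by move=> a x; rewrite !memW1 act_submod; apply: stW'.
have mW : m \in W.
  rewrite WE (subvP (addvSl _ _)) //; apply/memv_imgP; exists 1; rewrite ?memvf //.
  by rewrite orbmE act_one.
pose f : 'Hom(submod stW', submod stW) := linfun (vsproj W \o @vsval K M W').
have fE x : vsval (f x) = vsval x.
  by rewrite lfunE /= vsprojK //; apply: (subvP W'W); apply: subvsP.
have vpi0 (x : submod stW) : (vpi W1 x == 0) = (vsval x \in W').
  by rewrite -memv_ker lker_vpi memW1.
apply: (@FiltrationS _ _ _ _ F (submod stW') (submod stW) (quotmod stW1) f (vpi W1)) => //.
  split.
  - by move=> a x; apply: subvs_inj; rewrite fE !act_submod fE.
  - by apply/eqP/lker0P => x y xy; apply: subvs_inj; rewrite -!fE xy.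
  - by split; [move=> a x; rewrite act_quotmod | rewrite limg_vpi].
  - rewrite lker_vpi; apply/vspaceP => x; rewrite memW1; apply/idP/idP.
      by move=> /memv_imgP[y _ ->]; rewrite fE subvsP.
    move=> xW'; apply/memv_imgP; exists (vsproj W' (vsval x)); rewrite ?memvf //.
    by apply: subvs_inj; rewrite fE vsprojK.
apply: FU; exists (vpi W1 (vsproj W m)); split.
- rewrite act_quotmod; congr (vpi _ _); apply: subvs_inj.
  by rewrite act_submod vsprojK ?em.
- apply/vspaceP => q; rewrite memvf; apply/idP.
  have [_ /memv_imgP[a _ ->] [w wW' qE]] :
      exists2 u, u \in limg (orbm m) & exists2 w, w \in W' & vsval (vsval q : submod stW) = u + w.
    by apply/memv_addP; rewrite -WE; apply: subvsP.
  apply/memv_imgP; exists a; rewrite ?memvf // orbmE act_quotmod -[q]vpi_val.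
  have E : vsval (act (submod stW) a (vsproj W m)) = act M a m by rewrite act_submod vsprojK.
  apply/eqP; rewrite -subr_eq0 -linearB vpi0 linearB [X in _ - X]E.
  by rewrite [X in X - _]qE orbmE addrC addKr.
- move=> a; rewrite act_quotmod vpi0 act_submod vsprojK //; exact: mU.
Qed.

(** Only the top module is replaced, so a case analysis on the last step is enough. *)
Lemma filtration_iso (I : Type) (F : I -> lmodule A -> Prop) M M' s :
  mod_iso M M' -> filtration F M s -> filtration F M' s.
Proof.
case=> g [homg kg lg]; have bij : lker g == 0%VS by apply/eqP.
have ginj : injective g by apply/lker0P.
have gV : cancel (g^-1)%VF g by move=> x; apply: limg_lfunVK; rewrite lg memvf.
have gK : cancel g (g^-1)%VF by exact: lker0_lfunK.
have homV : is_modhom (M := M') (N := M) (g^-1)%VF.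
  by move=> a x; apply: ginj; rewrite homg !gV.
move=> FM; case: FM g homg kg lg bij ginj gV gK homV => {M s} [M M0|P M Q f p i s [homf kf [homp sp] fp] Fi FP] g homg kg lg bij ginj gV gK homV.
  by apply: Filtration0; rewrite -lg M0 limg0.
apply: (@FiltrationS _ _ _ _ F P M' Q (g \o f)%VF (p \o g^-1)%VF) Fi FP; split.
- by move=> a x; rewrite !comp_lfunE homf homg.
- apply/eqP/lker0P => x y; rewrite !comp_lfunE => /ginj.
  by move/eqP: kf => /lker0P; apply.
- split; first by move=> a x; rewrite !comp_lfunE homV homp.
  apply/vspaceP => x; rewrite memvf; apply/idP.
  have: x \in limg p by rewrite sp memvf.
  move=> /memv_imgP[y _ ->]; apply/memv_imgP; exists (g y); rewrite ?memvf //.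
  by rewrite comp_lfunE gK.
- apply/vspaceP => x; rewrite memv_ker comp_lfunE -memv_ker -fp limg_comp.
  apply/idP/idP => [/memv_imgP[y yf ->]|xf]; first by rewrite gK.
  by rewrite -(gV x) memv_img.
Qed.

Lemma submod_full M (st : stable (fullv : {vspace M})) : mod_iso (submod st) M.
Proof.
exists (linfun (@vsval K M fullv)); split; first exact: modhom_sub.
  exact: lker_vsval.
exact: limg_vsval.
Qed.

Lemma filtration_sub0 (I : Type) (F : I -> lmodule A -> Prop) M
  (st : stable (0 : {vspace M})) : filtration F (submod st) [::].
Proof.
apply: Filtration0; apply/eqP; rewrite -subv0; apply/subvP => x _.
rewrite memv0; apply/eqP/subvs_inj; apply/eqP; rewrite -[_ == _]memv0.
exact: subvsP.
Qed.

End Filtrations.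

(** * Simple modules *)

Section ProjectiveQuotients.
Variables (K : fieldType) (A : falgType K) (L : finType) (e : L -> A).
Variables (N : L -> {vspace A}) (h : L -> nat).
Hypothesis H : local_directed e N h.
Implicit Types (D Q M : lmodule A) (U V : {vspace A}) (lam mu nu : L).

Local Notation pm := (proj_mod e).
Local Notation vs lam := (linfun (@vsval K A (pcol e lam))).
Local Notation left_ideal := (@left_ideal K A).

Let pe lam : pm lam := vsproj (pcol e lam) (e lam).

Let val_pe lam : vsval (pe lam) = e lam.
Proof. by rewrite vsprojK ?(e_pcol H). Qed.

Lemma act_pm lam a (x : pm lam) : vsval (act (pm lam) a x) = a * vsval x.
Proof. by rewrite act_submod regmodE. Qed.

Let pmE lam (x : pm lam) : x = act (pm lam) (vsval x) (pe lam).
Proof.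
by apply: subvs_inj; rewrite act_pm val_pe; apply/esym/(pcolP H)/subvsP.
Qed.

Lemma mem_ker_img lam D (p : 'Hom(pm lam, D)) (x : pm lam) :
  (vsval x \in (vs lam @: lker p)%VS) = (p x == 0).
Proof.
rewrite -memv_ker; apply/idP/idP => [/memv_imgP[y yk]|xk].
  by rewrite lfunE => /subvs_inj ->.
by apply/memv_imgP; exists x; rewrite ?lfunE.
Qed.

Lemma ker_pcol lam D (p : 'Hom(pm lam, D)) : (vs lam @: lker p <= pcol e lam)%VS.
Proof. by apply/subvP => _ /memv_imgP[y _ ->]; rewrite lfunE subvsP. Qed.

Lemma ker_left lam D (p : 'Hom(pm lam, D)) :
  is_modhom p -> left_ideal (vs lam @: lker p).
Proof.
move=> homp; apply/prodvP => a _ _ /memv_imgP[y yk ->].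
rewrite lfunE -[a * _](act_pm a y) mem_ker_img homp.
by move: yk; rewrite memv_ker => /eqP ->; rewrite linear0.
Qed.

Lemma epi_gen lam D (p : 'Hom(pm lam, D)) :
  is_epi p -> gen_by (e lam) (vs lam @: lker p) D.
Proof.
case=> homp sp; exists (p (pe lam)); split.
- by rewrite -homp [in RHS](pmE (pe lam)) val_pe.
- apply/vspaceP => q; rewrite memvf; apply/idP.
  have: q \in limg p by rewrite sp memvf.
  move=> /memv_imgP[x _ ->]; apply/memv_imgP; exists (vsval x); rewrite ?memvf //.
  by rewrite orbmE -homp -pmE.
- move=> a; rewrite -homp -mem_ker_img.
  by have -> : vsval (act (pm lam) a (pe lam)) = a * e lam by rewrite act_pm val_pe.
Qed.

Lemma gen_epi lam D U : gen_by (e lam) U D ->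
  exists2 p : 'Hom(pm lam, D), is_epi p & forall x, (p x == 0) = (vsval x \in U).
Proof.
case=> m [em sm Um]; pose p : 'Hom(pm lam, D) := linfun (orbm m \o @vsval K A (pcol e lam)).
have pE x : p x = act D (vsval x) m by rewrite lfunE /= orbmE.
exists p.
  split; first by move=> a x; rewrite !pE -act_mul -act_pm.
  apply/vspaceP => q; rewrite memvf; apply/idP.
  have: q \in limg (orbm m) by rewrite sm memvf.
  move=> /memv_imgP[a _ ->]; apply/memv_imgP.
  exists (act (pm lam) a (pe lam)); rewrite ?memvf // pE.
  by rewrite act_pm val_pe orbmE act_mul em.
move=> x; rewrite pE Um.
by rewrite (pcolP H _ _ (subvsP x)).
Qed.

Lemma gen_by_eq (f : A) U V D : (forall a, (a * f \in U) = (a * f \in V)) ->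
  gen_by f U D -> gen_by f V D.
Proof. by move=> UV [m [em sm Um]]; exists m; split=> // a; rewrite Um UV. Qed.

Lemma gen_quot lam U : left_ideal U -> exists Q, exists q : 'Hom(pm lam, Q),
  [/\ is_epi q, forall x, (q x == 0) = (vsval x \in U) & gen_by (e lam) U Q].
Proof.
move=> lU; pose W : {vspace pm lam} := (vs lam @^-1: U)%VS.
have memW x : (x \in W) = (vsval x \in U) by rewrite -memv_preim lfunE.
have stW : stable W.
  move=> a x; rewrite !memW => xU; rewrite [vsval _]act_pm.
  exact: left_idealM lU xU.
have qepi : is_epi (M := pm lam) (N := quotmod stW) (vpi W).
  by split; [move=> a x; rewrite act_quotmod | rewrite limg_vpi].
have qU x : (vpi W x == 0) = (vsval x \in U) by rewrite -memv_ker lker_vpi memW.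
exists (quotmod stW), (vpi W); split=> //.
apply: gen_by_eq (epi_gen qepi) => a.
have <- : vsval (act (pm lam) a (pe lam)) = a * e lam by rewrite act_pm val_pe.
by rewrite mem_ker_img qU.
Qed.

Lemma hom_factor lam D Q (p : 'Hom(pm lam, D)) (q : 'Hom(pm lam, Q)) :
    is_epi p -> is_modhom q -> (lker p <= lker q)%VS ->
  exists2 g : 'Hom(D, Q), is_modhom g & q = (g \o p)%VF.
Proof.
case=> homp sp homq pq.
have gE x : (q \o p^-1)%VF (p x) = q x.
  rewrite comp_lfunE; apply/eqP; rewrite -subr_eq0 -linearB -memv_ker.
  by rewrite (subvP pq) // memv_ker linearB /= limg_lfunVK ?subrr // memv_img ?memvf.
exists (q \o p^-1)%VF; last by apply/lfunP => x; rewrite [RHS]comp_lfunE gE.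
move=> a y; have /memv_imgP[x _ ->] : y \in limg p by rewrite sp memvf.
by rewrite -homp !gE homq.
Qed.

(** The largest quotient belongs to the least admissible kernel. Testing the universality of [D] on
    the quotient by [U] itself shows that the kernel of [D] lies in [U]. *)
Lemma largest_gen lam (C : lmodule A -> Prop) U D :
    left_ideal U -> (forall Q, gen_by (e lam) U Q -> C Q) ->
    (forall Q U', left_ideal U' -> (U' <= pcol e lam)%VS ->
      gen_by (e lam) U' Q -> C Q -> (U <= U')%VS) ->
  largest_quotient C (pm lam) D <-> gen_by (e lam) U D.
Proof.
move=> lU UC CU; split.
  case=> CD [p pepi puniv].
  have UV := CU _ _ (ker_left pepi.1) (ker_pcol p) (epi_gen pepi) CD.
  have [Q [q [qepi qU Qgen]]] := gen_quot lam lU.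
  have [g _ qE] := puniv Q q (UC _ Qgen) qepi.
  apply: gen_by_eq (epi_gen pepi) => a.
  have <- : vsval (act (pm lam) a (pe lam)) = a * e lam by rewrite act_pm val_pe.
  apply/idP/idP => [|/(subvP UV)//]; rewrite mem_ker_img -qU qE comp_lfunE.
  by move/eqP->; rewrite linear0.
move=> Dgen; split; first exact: UC.
have [p pepi pU] := gen_epi Dgen; exists p => // Q q CQ qepi.
apply: hom_factor qepi.1 _ => //.
apply/subvP => x; rewrite !memv_ker pU -mem_ker_img.
exact/subvP/(CU _ _ (ker_left qepi.1) (ker_pcol q) (epi_gen qepi) CQ).
Qed.

Lemma gen_dim lam U D i : left_ideal U -> (U <= pcol e lam)%VS ->
    gen_by (e lam) U D ->
  (\dim (act D (e i) @: fullv) + \dim (<[e i]> * U))%N = \dim (blk e i lam).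
Proof.
move=> lU Ucol [m [em sm Um]].
rewrite -(limg_ker_dim (orbm m) (blk e i lam)) addnC; congr (_ + _)%N; congr (\dim _).
  apply/vspaceP => x; apply/idP/memv_capP => [|[xb]].
    move=> xU; have xU' : x \in U by apply: (subvP (left_ideal_line (e i) lU)).
    have xr := pcolP H _ _ (subvP Ucol _ xU').
    split; last by rewrite memv_ker orbmE Um xr.
    by apply: (mem_blkE H) => //; apply: (e_line_left H) xU.
  rewrite memv_ker orbmE Um (blk_r H xb) => xU.
  by rewrite -(blk_l H xb) memv_mul ?memv_line.
apply/vspaceP => x; apply/idP/idP => [/memv_imgP[y _ ->]|/memv_imgP[a ab ->]].
  have: y \in limg (orbm m) by rewrite sm memvf.
  move=> /memv_imgP[a _ ->]; rewrite orbmE -{1}em -!act_mul -orbmE memv_img //.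
  by rewrite mulrA mem_blk.
by rewrite orbmE -(blk_l H ab) act_mul memv_img ?memvf.
Qed.

(** The unique maximal submodule of [A e_mu]. *)
Definition maxp mu : {vspace A} := (N mu + \sum_(i | i != mu) blk e i mu)%VS.

Lemma maxp_pcol mu : (maxp mu <= pcol e mu)%VS.
Proof.
rewrite subv_add (subv_trans (N_blk H mu) (blk_pcol H _ _)) /=.
by apply/subv_sumP => i _; apply: (blk_pcol H).
Qed.

Lemma mem_maxp mu x : x \in pcol e mu -> (x \in maxp mu) = (e mu * x \in N mu).
Proof.
move=> xc; apply/idP/idP => [/memv_addP[n nN [y /memv_sumP[z zP ->] ->]]|exN].
  rewrite mulrDr (blk_l H (subvP (N_blk H mu) _ nN)) mulr_sumr big1 ?addr0 // => i ni.
  by rewrite -(blk_l H (zP i ni)) mulrA (ld_orth H) ?mul0r // eq_sym.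
rewrite [x](peirce_sum H) (bigD1 mu) //=; apply: memv_add => //.
by apply: memv_sumr => i _; apply: (mem_pcol_blk H).
Qed.

Lemma maxp_left mu : left_ideal (maxp mu).
Proof.
apply/prodvP => a x _ xm; have xc := subvP (maxp_pcol mu) _ xm.
rewrite mem_maxp; last by apply: left_idealM xc; apply: left_ideal_pcol.
rewrite [x](peirce_sum H) !mulr_sumr; apply: memv_suml => i _.
have [->|im] := eqVneq i mu.
  apply: (subvP (ld_mull H mu)); rewrite !mulrA -[X in X * x](mulrA _ _ (e mu)).
  rewrite -(ld_idem H mu) !mulrA -[_ * x]mulrA memv_mul //.
    by rewrite (ld_idem H) mem_blk.
  by rewrite -mem_maxp.
(* A contribution through [i != mu] would leave [mu] and return to it, hence vanishes. *)
have : e mu * a * e i * (e i * x) \in (blk e mu i * blk e i mu)%VS.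
  by rewrite memv_mul ?mem_blk ?(mem_pcol_blk H).
rewrite (blk_mul0 H) 1?eq_sym // memv0 -!mulrA [e i * (_ * _)]mulrA (ld_idem H).
by rewrite !mulrA => /eqP ->; rewrite mem0v.
Qed.

Lemma e_maxp mu : e mu \notin maxp mu.
Proof. by rewrite mem_maxp ?(e_pcol H) // (ld_idem H) (ld_notin H). Qed.

(** The [e mu]-component of an element outside [maxp mu] is a nonzero multiple of [e mu] plus a
    nilpotent element, hence a unit of the local algebra e_mu A e_mu; it would put [e mu] into
    [V]. *)
Lemma sub_maxp mu V : left_ideal V -> (V <= pcol e mu)%VS -> e mu \notin V ->
  (V <= maxp mu)%VS.
Proof.
move=> lV Vc; apply: contraR => /subvPn[x Vx xN].
have xc := subvP Vc _ Vx; move: xN; rewrite mem_maxp // => xN.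
have := mem_pcol_blk H xc mu; rewrite (ld_dec H).
move=> /memv_addP[_ /vlineP[c ->] [n nN xE]].
have c0 : c != 0.
  by apply: contraNneq xN => c0; rewrite xE c0 scale0r add0r.
pose n' := c^-1 *: n.
have VE : e mu + n' \in V.
  have -> : e mu + n' = c^-1 *: (e mu * x).
    by rewrite xE scalerDr scalerA mulVf // scale1r.
  by rewrite memvZ // left_idealM.
have n'N : n' \in N mu by rewrite memvZ.
have [b Nb] := N_nil H.
(* This divides by the unit [e mu + n'] without its inverse: [n' ^+ k * (e mu + n')] lies in [V], so
   membership passes from [n' ^+ k.+1 * e mu] down to [n' ^+ k * e mu], starting at a vanishing
   power. *)
have Vk k : n' ^+ k * e mu \in V -> forall j, (j <= k)%N -> n' ^+ j * e mu \in V.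
  elim: k => [|k IHk] Vk j; first by rewrite leqn0 => /eqP->.
  rewrite leq_eqVlt => /predU1P[-> //|]; rewrite ltnS; apply: IHk.
  have : n' ^+ k * (e mu + n') \in V by apply: left_idealM.
  have E : n' ^+ k.+1 * e mu = n' ^+ k * n'.
    by rewrite exprSr -mulrA (blk_r H (subvP (N_blk H mu) _ n'N)).
  by rewrite mulrDr -E rpredDr.
have n'0 : n' ^+ b = 0.
  apply/eqP; rewrite -memv0 -(Nb mu).
  elim: {Nb} b => [|b IHb]; first by rewrite expv0 expr0 memv_line.
  by rewrite exprS expvSl memv_mul.
by have := Vk b; rewrite n'0 mul0r mem0v => /(_ isT 0%N isT); rewrite expr0 mul1r.
Qed.

End ProjectiveQuotients.

(** * Composition factors counted by dimensions *)

Section CompositionFactors.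
Variables (K : fieldType) (A : falgType K) (L : finType) (e : L -> A).
Variables (N : L -> {vspace A}) (h : L -> nat).
Hypothesis H : local_directed e N h.
Implicit Types (D Q M S : lmodule A) (U V : {vspace A}) (lam mu nu : L).

Local Notation pm := (proj_mod e).
Local Notation vs lam := (linfun (@vsval K A (pcol e lam))).
Local Notation left_ideal := (@left_ideal K A).
Local Notation maxp := (maxp e N).

Let preim lam U : {vspace pm lam} := (vs lam @^-1: U)%VS.

Let mem_preim lam U (x : pm lam) : (x \in preim lam U) = (vsval x \in U).
Proof. by rewrite -memv_preim lfunE. Qed.

Let pm_full lam (V : {vspace pm lam}) :
  left_ideal (vs lam @: V) -> e lam \in (vs lam @: V)%VS -> V = fullv.
Proof.
move=> lV eV; apply/vspaceP => x; rewrite memvf.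
have : vsval x \in (vs lam @: V)%VS.
  have <- : vsval x * e lam = vsval x by apply/(pcolP H); apply: subvsP.
  exact: left_idealM.
by move=> /memv_imgP[y yV]; rewrite lfunE => /subvs_inj ->.
Qed.

Let img_left lam (V : {vspace pm lam}) : stable V -> left_ideal (vs lam @: V).
Proof.
move=> stV; apply/prodvP => a _ _ /memv_imgP[y yV ->].
apply/memv_imgP; exists (act (pm lam) a y); first exact: stV.
by rewrite lfunE [RHS]lfunE [RHS]act_pm.
Qed.

Let preim_stable lam U : left_ideal U -> stable (preim lam U).
Proof.
move=> lU a x; rewrite !mem_preim => xU.
by rewrite act_pm left_idealM.
Qed.

Let preim_max lam : maximal_submodule (preim lam (maxp lam)).
Proof.
split; first exact/preim_stable/maxp_left/H.
  apply/negP => /eqP fE; have /negP := e_maxp H lam; apply.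
  have := memvf (vsproj (pcol e lam) (e lam) : pm lam).
  by rewrite -fE mem_preim vsprojK // (e_pcol H).
move=> V stV sub; have [eV|eV] := boolP (e lam \in (vs lam @: V)%VS).
  by right; apply: pm_full eV; apply: img_left.
left; apply/eqP; rewrite eqEsubv sub andbT; apply/subvP => x Vx.
rewrite mem_preim; apply: subvP (sub_maxp H (img_left stV) _ eV) _ _.
  by apply/subvP => _ /memv_imgP[y _ ->]; rewrite lfunE subvsP.
by apply/memv_imgP; exists x; rewrite ?lfunE.
Qed.

Let max_unique lam (V : {vspace pm lam}) :
  maximal_submodule V -> V = preim lam (maxp lam).
Proof.
case=> stV nV maxV; have [stM nM _] := preim_max lam.
have eV : e lam \notin (vs lam @: V)%VS.
  by apply: contra nV => eV; apply/eqP/(pm_full (img_left stV)).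
suff sub : (V <= preim lam (maxp lam))%VS.
  by have [->//|E] := maxV _ stM sub; rewrite E eqxx in nM.
apply/subvP => x Vx.
rewrite mem_preim; apply: subvP (sub_maxp H (img_left stV) _ eV) _ _.
  by apply/subvP => _ /memv_imgP[y _ ->]; rewrite lfunE subvsP.
by apply/memv_imgP; exists x; rewrite ?lfunE.
Qed.

(** [maxp mu] is the only maximal submodule of P_mu, hence its radical. *)
Lemma is_simple_gen mu S : is_simple e mu S <-> gen_by (e mu) (maxp mu) S.
Proof.
split=> [[p pepi rad]|Sgen].
  apply: gen_by_eq (epi_gen H pepi) => a.
  have <- : vsval (vsproj (pcol e mu) (a * e mu)) = a * e mu.
    by rewrite vsprojK // memv_mul ?memvf ?memv_line.
  move: (vsproj _ _ : pm mu) => x.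
  rewrite mem_ker_img -memv_ker; apply/idP/idP => [/rad /(_ _ (preim_max mu))|xm].
    by rewrite mem_preim.
  by apply/rad => V /max_unique ->; rewrite mem_preim.
have [p pepi pU] := gen_epi H Sgen; exists p => // x.
rewrite memv_ker pU; split=> [xm V /max_unique ->|/(_ _ (preim_max mu))]; by rewrite mem_preim.
Qed.

Lemma maxp_e mu i : (<[e i]> * maxp mu = if i == mu then N mu else blk e i mu)%VS.
Proof.
apply/vspaceP => x; apply/idP/idP => [xm|].
  have exE := e_line_left H xm.
  have {}xm : x \in maxp mu by apply: (subvP (left_ideal_line (e i) (maxp_left H mu))).
  have xc := subvP (maxp_pcol H mu) _ xm.
  rewrite -exE; case: eqVneq => [->|_]; first by rewrite -(mem_maxp H).
  exact: (mem_pcol_blk H).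
case: eqVneq => [->|im] xP.
  rewrite -(blk_l H (subvP (N_blk H mu) _ xP)) memv_mul ?memv_line //.
  by rewrite (subvP (addvSl _ _)).
rewrite -(blk_l H xP) memv_mul ?memv_line // (subvP (addvSr _ _)) //.
by rewrite memvE (sumv_sup i) -?memvE.
Qed.

Lemma is_simple_dim mu S i : is_simple e mu S ->
  \dim (act S (e i) @: fullv) = (mu == i).
Proof.
move=> /is_simple_gen Sgen; have := gen_dim H i (maxp_left H mu) (maxp_pcol H mu) Sgen.
rewrite maxp_e [mu == i]eq_sym; case: eqVneq => [->|_] /eqP.
  by rewrite (dim_N H) -add1n eqn_add2r => /eqP.
by rewrite -[X in _ == X]add0n eqn_add2r => /eqP.
Qed.

(** Since [N i] has codimension one in e_i A e_i, the space e_i S_mu has dimension one for [mu = i]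
    and zero otherwise. *)
Lemma composition_factors_count M s i : composition_factors e M s ->
  \dim (act M (e i) @: fullv) = count_mem i s.
Proof.
move=> /(filtration_dim (ld_idem H i) (fun mu S => @is_simple_dim mu S i)) ->.
rewrite -sum1_count [RHS]big_mkcond; apply: eq_bigr => j _ /=; by case: eqP.
Qed.

Section Action.
Variable M : lmodule A.
Lemma actv_nil U (Y : {vspace M}) n : (U ^+ n = 0)%VS -> (Y <= actv U Y)%VS -> Y = 0%VS.
Proof.
move=> Un YU; have: (Y <= actv (U ^+ n) Y)%VS.
  elim: n {Un} => [|n IHn].
    by apply/subvP => y yY; rewrite -(act_one y) mem_actv // expv0 memv_line.
  apply: subv_trans YU _; apply: actv_sub => a y aU /(subvP IHn) yn.
  suff: (actv (U ^+ n) Y <= act M a @^-1: actv (U ^+ n.+1) Y)%VS.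
    by move/subvP/(_ _ yn); rewrite -memv_preim.
  apply: actv_sub => b z bU zY; rewrite -memv_preim -act_mul mem_actv //.
  by rewrite expvSl memv_mul.
move=> sub; apply/eqP; rewrite -subv0; apply: subv_trans sub _.
rewrite Un; apply: actv_sub => a y; rewrite memv0 => /eqP -> _.
by rewrite linear0 zero_lfunE mem0v.
Qed.

End Action.

(** If [mu] has least height among the indices with e_mu M nonzero, then e_mu M receives nothing
    from the other components: e_mu A e_i is zero unless [i] is lower than [mu], and then e_i M is
    zero. So a hyperplane of e_mu M containing N_mu e_mu M, together with all other components, is a
    submodule with quotient S_mu. *)
Lemma composition_factors_exist M : exists s, composition_factors e M s.
Proof.
move: {2}(\dim (fullv : {vspace M})) (leqnn (\dim (fullv : {vspace M}))) => n.
elim: n M => [|n IHn] M dM.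
  by exists [::]; apply: Filtration0; apply/eqP; rewrite -dimv_eq0 -leqn0.
have [M0|nM0] := eqVneq (fullv : {vspace M}) 0%VS.
  by exists [::]; apply: Filtration0.
pose Mi i := (act M (e i) @: fullv)%VS.
have MiE i x : x \in Mi i -> act M (e i) x = x.
  by move=> /memv_imgP[y _ ->]; rewrite -act_mul (ld_idem H).
have [mu0 mu0P] : exists mu, Mi mu != 0%VS.
  apply/existsP; apply: contraNT nM0 => /existsPn Mi0.
  rewrite -subv0; apply/subvP => x _; rewrite memv0 -(act_one x) -(ld_sum H) act_sum.
  rewrite big1 // => i _; apply/eqP; rewrite -memv0.
  by have /negPn/eqP <- := Mi0 i; rewrite memv_img ?memvf.
case: (arg_minnP (P := fun i => Mi i != 0%VS) h mu0P) => mu muP mu_min {mu0 mu0P}.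
have subN : (actv (N mu) (Mi mu) <= Mi mu)%VS.
  apply: actv_sub => a y aN _; rewrite -(blk_l H (subvP (N_blk H mu) _ aN)) act_mul.
  by rewrite memv_img ?memvf.
have neN : actv (N mu) (Mi mu) != Mi mu.
  apply: contra muP => /eqP E; have [b Nb] := N_nil H.
  by apply/eqP/(actv_nil (Nb mu)); rewrite E.
have [W1 [m [W1P MiW dW1]]] := hyperplane subN neN.
have W1Mi : (W1 <= Mi mu)%VS by rewrite MiW addvSr.
have mMi : m \in Mi mu by rewrite MiW (subvP (addvSl _ _)) ?memv_line.
pose W := (W1 + \sum_(i | i != mu) Mi i)%VS.
have MiWi i : i != mu -> (Mi i <= W)%VS.
  by move=> im; apply: subv_trans (addvSr _ _); rewrite (sumv_sup i).
have memW x : (x \in W) = (act M (e mu) x \in W1).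
  apply/idP/idP => [/memv_addP[w wW1 [y /memv_sumP[z zP ->] ->]]|].
    rewrite linearD /= (MiE mu) ?(subvP W1Mi) // linear_sum big1 ?addr0 // => i im.
    by rewrite /= -(MiE i (z i) (zP i im)) -act_mul (ld_orth H) 1?eq_sym // linear0 zero_lfunE.
  move=> eW; rewrite -(act_one x) -(ld_sum H) act_sum (bigD1 mu) //=.
  rewrite memv_add //; apply: memv_sumr => i _; by rewrite memv_img ?memvf.
have mW1 : m \notin W1.
  apply/negP => mW1; move: dW1; rewrite MiW.
  by rewrite (addv_idPr _) -?memvE // => /eqP; rewrite eq_sym eqn_leq ltnn.
have stW : stable W.
  move=> a x; rewrite !memW => xW.
  rewrite -act_mul [a](peirce_sumr H) mulr_sumr act_sum; apply: memv_suml => i _.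
  have [->|im] := eqVneq i mu.
    have -> : e mu * (a * e mu) = e mu * a * e mu * e mu by rewrite -[RHS]mulrA (ld_idem H) mulrA.
    rewrite act_mul.
    have := mem_blk e mu mu a; rewrite (ld_dec H).
    move=> /memv_addP[_ /vlineP[c ->] [b bN ->]].
    rewrite -orbmE linearD linearZ /= !orbmE (MiE mu) ?(subvP W1Mi) //.
    rewrite memvD ?memvZ // (subvP W1P) // mem_actv // (subvP W1Mi) //.
  rewrite mulrA -[e i](ld_idem H) mulrA act_mul.
  have [hlt|hge] := boolP (h i < h mu)%N; last first.
    have := mem_blk e mu i a; rewrite (blk0 H hge) 1?eq_sym // memv0 => /eqP ->.
    by rewrite linear0 zero_lfunE mem0v.
  have Mi0 : Mi i = 0%VS.
    by apply/eqP; apply: contraTT hlt => /mu_min; rewrite -leqNgt.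
  have : act M (e i) x \in Mi i by rewrite memv_img ?memvf.
  by rewrite Mi0 memv0 => /eqP ->; rewrite linear0 mem0v.
have stF : stable (fullv : {vspace M}) by move=> a x _; rewrite memvf.
have fE : fullv = (limg (orbm m) + W)%VS.
  apply/vspaceP => x; rewrite memvf; apply/esym.
  rewrite -(act_one x) -(ld_sum H) act_sum; apply: memv_suml => i _.
  have : act M (e i) x \in Mi i by rewrite memv_img ?memvf.
  have [->|im] := eqVneq i mu; last first.
    by move/(subvP (MiWi i im)); apply: (subvP (addvSr _ _)).
  rewrite MiW => /memv_addP[_ /vlineP[c ->] [w wW1 ->]]; rewrite memv_add //.
    by rewrite memvZ // -{1}(act_one m) -orbmE memv_img ?memvf.
  by rewrite (subvP (addvSl _ _)).
have sub : subfactor (e mu) (maxp mu) fullv W.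
  exists m; split; [exact: MiE | exact: fE |] => a.
  have ac : a * e mu \in pcol e mu by rewrite memv_mul ?memvf ?memv_line.
  rewrite -(MiE mu m mMi) -act_mul (mem_maxp H) // memW -act_mul.
  have := mem_pcol_blk H ac mu; rewrite (ld_dec H).
  move=> /memv_addP[_ /vlineP[c ->] [b bN ->]].
  rewrite -orbmE linearD linearZ /= !orbmE (MiE mu) //.
  have bm : act M b m \in W1 by rewrite (subvP W1P) // mem_actv.
  rewrite !rpredDr //.
  have [->|c0] := eqVneq c 0; first by rewrite !scale0r !mem0v.
  by rewrite !rpredZeq !(negPf c0) /= (negPf mW1) (negPf (ld_notin H mu)).
have [|s Ws] := IHn (submod stW).
  rewrite -(limg_dim_eq (f := linfun (@vsval K M W))); last by rewrite lker_vsval capv0.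
  rewrite limg_vsval -ltnS; apply: leq_trans dM.
  rewrite ltn_neqAle dimvS ?subvf // andbT; apply/negP => /eqP dE.
  have WF : W = fullv by (apply/eqP; rewrite eqEdim subvf dE leqnn).
  have := memvf m; rewrite -WF memW MiE //. by rewrite (negPf mW1).
exists (mu :: s); apply: filtration_iso (submod_full stF) _.
by apply: filtration_subfactor sub Ws => D Dgen; apply/is_simple_gen.
Qed.

End CompositionFactors.

(** * Traces in standard and proper standard filtrations *)

Section StandardModules.
Variables (K : fieldType) (A : falgType K) (L : finType) (e : L -> A).
Variables (N : L -> {vspace A}) (h : L -> nat).
Hypothesis H : local_directed e N h.
Implicit Types (D Q M S P : lmodule A) (V : {vspace A}) (lam mu nu : L) (U : pred L).

Local Notation blk := (blk e).
Local Notation pcol := (pcol e).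
Local Notation left_ideal := (@left_ideal K A).

(* The trace in A e_j of the projectives A e_i with i in U. *)
Definition tr U j : {vspace A} := (\sum_(i | U i) pcol i * blk i j)%VS.

Lemma tr_left U j : left_ideal (tr U j).
Proof. by apply: left_ideal_sum => i _; apply/left_ideal_prod/left_ideal_pcol. Qed.

Lemma prod_pcol_blk i j : (pcol i * blk i j <= pcol j)%VS.
Proof.
apply/prodvP => x y _ yP; apply/(pcolP H); by rewrite -mulrA (blk_r H yP).
Qed.

Lemma tr_pcol U j : (tr U j <= pcol j)%VS.
Proof. by apply/subv_sumP => i _; apply: prod_pcol_blk. Qed.

Lemma blk_tr U i j : U i -> (blk i j <= tr U j)%VS.
Proof.
move=> Ui; apply/subvP => x xP; rewrite -(blk_l H xP).
by rewrite memvE (sumv_sup i) // -memvE memv_mul ?(e_pcol H).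
Qed.

Lemma tr_sub U j V : left_ideal V -> (forall i, U i -> (blk i j <= V)%VS) ->
  (tr U j <= V)%VS.
Proof.
move=> lV UV; apply/subv_sumP => i Ui; apply: subv_trans lV.
by apply: prodvS (subvf _) (UV i Ui).
Qed.

Lemma e_pcolE i j : (<[e i]> * pcol j)%VS = blk i j.
Proof. by rewrite blkE. Qed.

Lemma e_tr i U j : (<[e i]> * tr U j)%VS = (\sum_(l | U l) blk i l * blk l j)%VS.
Proof. by rewrite /tr big_distrr /=; apply: eq_bigr => l _; rewrite prodvA e_pcolE. Qed.

Lemma e_tr_blk i U j : (<[e i]> * tr U j <= blk i j)%VS.
Proof. by rewrite e_tr; apply/subv_sumP => l _; apply: (prod_blk H). Qed.

Lemma e_tr_full i U j : U i -> (<[e i]> * tr U j)%VS = blk i j.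
Proof.
move=> Ui; apply/eqP; rewrite eqEsubv e_tr_blk /=; apply/subvP => x xP.
by rewrite -(blk_l H xP) memv_mul ?memv_line // (subvP (blk_tr _ Ui)).
Qed.

Lemma tr_full U j : U j -> tr U j = pcol j.
Proof.
move=> Uj; apply/eqP; rewrite eqEsubv tr_pcol /=; apply/subvP => x /(pcolP H) <-.
by apply: left_idealM (tr_left U j) _; rewrite (subvP (blk_tr _ Uj)) ?(e_blk H).
Qed.

(** Only products from [j] to itself through an index other than [j] occur. *)
Lemma e_tr0 U j : ~~ U j -> (<[e j]> * tr U j = 0)%VS.
Proof.
move=> Uj; rewrite e_tr; apply/eqP; rewrite -subv0; apply/subv_sumP => i Ui.
by rewrite (blk_mul0 H) //; apply: contraNneq Uj => ->.
Qed.

Section Order.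
Variable r : rel L.

Definition above lam : pred L := [pred nu | ~~ r nu lam].
Definition std_ker lam : {vspace A} := tr (above lam) lam.
(** The kernel of the map from P_lam onto the proper standard module: adding [A e_lam N_lam] kills
    all copies of S_lam but the top one. *)
Definition pstd_ker lam : {vspace A} := (std_ker lam + pcol lam * N lam)%VS.

Lemma std_ker_left lam : left_ideal (std_ker lam). Proof. exact: tr_left. Qed.
Lemma std_ker_pcol lam : (std_ker lam <= pcol lam)%VS. Proof. exact: tr_pcol. Qed.

Lemma pcol_N lam : (pcol lam * N lam <= pcol lam)%VS.
Proof. exact: subv_trans (prodvSr _ (N_blk H lam)) (prod_pcol_blk lam lam). Qed.

Lemma pstd_ker_left lam : left_ideal (pstd_ker lam).
Proof.
by apply: left_ideal_add (std_ker_left lam) _; apply/left_ideal_prod/left_ideal_pcol.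
Qed.
Lemma pstd_ker_pcol lam : (pstd_ker lam <= pcol lam)%VS.
Proof. by rewrite subv_add std_ker_pcol pcol_N. Qed.

Lemma e_pstd_ker i lam :
  (<[e i]> * pstd_ker lam = <[e i]> * std_ker lam + blk i lam * N lam)%VS.
Proof. by rewrite /pstd_ker prodvDr prodvA e_pcolE. Qed.

Lemma e_pstd_ker_diag lam : reflexive r -> (<[e lam]> * pstd_ker lam = N lam)%VS.
Proof.
move=> rr; have std0 : (<[e lam]> * std_ker lam = 0)%VS by apply: e_tr0; rewrite /above /= rr.
rewrite e_pstd_ker std0 add0v; apply/eqP; rewrite eqEsubv (ld_mull H).
apply/subvP => x xN; rewrite -(blk_l H (subvP (N_blk H lam) _ xN)).
by rewrite memv_mul ?(e_blk H).
Qed.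

Lemma blk_gen0 lam Q V i : left_ideal V -> (V <= pcol lam)%VS ->
  gen_by (e lam) V Q -> (\dim (act Q (e i) @: fullv) == 0%N) = (blk i lam <= V)%VS.
Proof.
move=> lV Vc /(gen_dim H i lV Vc) dE.
have eVb : (<[e i]> * V <= blk i lam)%VS by rewrite -e_pcolE prodvSr.
have -> : (blk i lam <= V)%VS = (blk i lam <= <[e i]> * V)%VS.
  apply/idP/idP => bV; last exact: subv_trans bV (left_ideal_line _ lV).
  apply/subvP => x xb; rewrite -(blk_l H xb) memv_mul ?memv_line //.
  exact: (subvP bV).
rewrite -(geq_leqif (dimv_leqif_sup eVb)) -dE.
by rewrite -[X in (_ <= X)%N]add0n leq_add2r leqn0.
Qed.

(** By the count of composition factors, a quotient of [A e_lam] by [V] is admissible exactly if [V]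
    contains e_nu A e_lam for all [nu] above [lam]. The least such left ideal is the trace. *)
Lemma is_standard_gen lam D :
  is_standard e r lam D <-> gen_by (e lam) (std_ker lam) D.
Proof.
have CE Q : (exists2 s, composition_factors e Q s & all (r^~ lam) s) <->
    forall nu, ~~ r nu lam -> \dim (act Q (e nu) @: fullv) == 0%N.
  split=> [[s Qs rs] nu nr|Q0].
    rewrite (composition_factors_count H nu Qs) -leqn0 leqNgt -has_count has_pred1.
    by apply: contra nr => /(allP rs).
  have [s Qs] := composition_factors_exist H Q; exists s => //.
  apply/allP => nu nus; apply: contraTT nus => /Q0.
  by rewrite (composition_factors_count H nu Qs) -leqn0 leqNgt -has_count has_pred1.
apply: (largest_gen H) => [|Q Qgen|Q V lV Vc Qgen /CE Q0].
- exact: std_ker_left.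
- apply/CE => nu nr; rewrite (blk_gen0 _ _ _ Qgen) ?blk_tr //.
    exact: std_ker_left.
  exact: std_ker_pcol.
- apply: tr_sub => // nu nr; rewrite -(blk_gen0 _ lV Vc Qgen); exact: Q0.
Qed.

Lemma is_proper_standard_gen lam D : reflexive r ->
  is_proper_standard e r lam D <-> gen_by (e lam) (pstd_ker lam) D.
Proof.
move=> rr.
have CE Q : (exists s t, [/\ composition_factors e Q s, perm_eq s (lam :: t)
                            & all (fun mu => (mu != lam) && r mu lam) t]) <->
    (\dim (act Q (e lam) @: fullv) == 1%N /\
    forall nu, ~~ r nu lam -> \dim (act Q (e nu) @: fullv) == 0%N).
  split=> [[s [t [Qs st rt]]]|[Q1 Q0]].
    split=> [|nu nr]; rewrite (composition_factors_count H _ Qs) (permP st) /=.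
      rewrite eqxx add1n eqSS -leqn0 leqNgt -has_count has_pred1.
      by apply/negP => /(allP rt); rewrite eqxx.
    have /negPf -> : lam != nu by apply: contraNneq nr => <-.
    rewrite add0n -leqn0 leqNgt -has_count has_pred1.
    by apply: contra nr => /(allP rt) /andP[].
  have [s Qs] := composition_factors_exist H Q; exists s, (rem lam s).
  have ls : lam \in s.
    by rewrite -has_pred1 has_count -(composition_factors_count H _ Qs) (eqP Q1).
  have st := perm_to_rem ls; split=> //.
  apply/allP => nu nus; have c1 := eqP Q1.
  have c i : \dim (act Q (e i) @: fullv) = ((lam == i) + count_mem i (rem lam s))%N.
    by rewrite (composition_factors_count H i Qs) (permP st).
  have ne : nu != lam.
    apply: contraTneq nus => ->; rewrite -has_pred1 has_count -leqNgt.
    by move: (c lam); rewrite c1 eqxx add1n => /eqP; rewrite eqSS eq_sym => /eqP ->.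
  rewrite ne /=; apply: contraTT nus => /Q0; rewrite c [lam == nu]eq_sym (negPf ne) add0n.
  by rewrite -has_pred1 has_count lt0n negbK.
apply: (largest_gen H) => [|Q Qgen|Q V lV Vc Qgen /CE[Q1 Q0]].
- exact: pstd_ker_left.
- apply/CE; split=> [|nu nr].
    have := gen_dim H lam (pstd_ker_left lam) (pstd_ker_pcol lam) Qgen.
    by rewrite e_pstd_ker_diag // (dim_N H) -add1n => /eqP; rewrite eqn_add2r.
  rewrite (blk_gen0 _ (pstd_ker_left lam) (pstd_ker_pcol lam) Qgen).
  by apply: subv_trans (addvSl _ _); apply: blk_tr.
- have dE := gen_dim H lam lV Vc Qgen; rewrite (eqP Q1) (dim_N H) add1n in dE.
  have eV : e lam \notin V.
    apply/negP => eV.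
    have : (blk lam lam <= V)%VS.
      by apply/subvP => x xb; rewrite -(blk_r H xb); apply: left_idealM.
    by rewrite -(blk_gen0 _ lV Vc Qgen) (eqP Q1).
  (* A single copy of S_lam in the quotient means that e_lam V has codimension one in e_lam A e_lam.
     Lying in [N lam], it is equal to it, which brings [A e_lam N_lam] into [V]. *)
  have Vm := sub_maxp H lV Vc eV.
  have sub : (<[e lam]> * V <= N lam)%VS.
    by have := prodvSr <[e lam]> Vm; rewrite (maxp_e H) eqxx.
  have NE : (<[e lam]> * V = N lam)%VS.
    by apply/eqP; rewrite eqEdim sub; case: dE => ->; rewrite leqnn.
  rewrite subv_add; apply/andP; split.
    apply: tr_sub => // nu nr; rewrite -(blk_gen0 _ lV Vc Qgen); exact: Q0.
  rewrite -NE; apply: (subv_trans _ lV); apply: prodvS; first exact: subvf.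
  exact: left_ideal_line lV.
Qed.

End Order.

Section Trace.
Variable U : pred L.

Definition mod_trace M : {vspace M} :=
  actv {:A} (\sum_(i | U i) act M (e i) @: fullv)%VS.

Lemma mem_mod_trace M a i (y : M) : U i -> act M a (act M (e i) y) \in mod_trace M.
Proof.
move=> Ui; apply: mem_actv; rewrite ?memvf // memvE (sumv_sup i) // -memvE.
by rewrite memv_img ?memvf.
Qed.

Lemma mod_trace_sub M (Z : {vspace M}) :
  (forall a i y, U i -> act M a (act M (e i) y) \in Z) -> (mod_trace M <= Z)%VS.
Proof.
move=> UZ; apply: actv_sub => a _ _ /memv_sumP[z zP ->].
rewrite linear_sum; apply: memv_suml => i Ui.
by have /memv_imgP[y _ ->] := zP i Ui; apply: UZ.
Qed.

Lemma modhom_img M P (f : 'Hom(P, M)) a (Y : {vspace P}) : is_modhom f ->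
  (act M a @: (f @: Y) = f @: (act P a @: Y))%VS.
Proof.
move=> homf; apply/vspaceP => x; apply/idP/idP.
  by move=> /memv_imgP[_ /memv_imgP[y yY ->] ->]; rewrite -homf !memv_img.
by move=> /memv_imgP[_ /memv_imgP[y yY ->] ->]; rewrite homf !memv_img.
Qed.

Lemma img_orbm M P (f : 'Hom(P, M)) x : is_modhom f ->
  limg (orbm (f x)) = (f @: limg (orbm x))%VS.
Proof.
move=> homf; apply/vspaceP => y; apply/idP/idP.
  by move=> /memv_imgP[a _ ->]; rewrite orbmE -homf -orbmE !memv_img ?memvf.
by move=> /memv_imgP[_ /memv_imgP[a _ ->] ->]; rewrite orbmE homf -orbmE memv_img ?memvf.
Qed.

Lemma trace_img M P (f : 'Hom(P, M)) : is_modhom f ->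
  (f @: mod_trace P <= mod_trace M)%VS.
Proof.
move=> homf; apply/subvP => _ /memv_imgP[x xP ->].
suff : (mod_trace P <= f @^-1: mod_trace M)%VS by move/subvP/(_ _ xP); rewrite -memv_preim.
by apply: mod_trace_sub => a i y Ui; rewrite -memv_preim !homf mem_mod_trace.
Qed.

Variables (F : L -> lmodule A -> Prop) (Kl : L -> {vspace A}).
Hypothesis F_gen : forall lam D, F lam D -> gen_by (e lam) (Kl lam) D.
Hypothesis Kl_left : forall lam, left_ideal (Kl lam).
Hypothesis Kl_pcol : forall lam, (Kl lam <= pcol lam)%VS.
Hypothesis Kl_U : forall lam, U lam ->
  (Kl lam <= \sum_(i | U i) pcol i * (<[e i]> * Kl lam))%VS.
Hypothesis Kl_notU : forall lam i, ~~ U lam -> U i -> (blk i lam <= Kl lam)%VS.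

(* Filtrations with factors A e_lam / K_lam are compatible with traces, because
   K_lam is generated by its components of index in U whenever lam is in U. *)
Lemma filtration_trace M s : filtration F M s ->
  exists g : seq (L * M), [/\ map fst g = s,
    forall p, p \in g -> act M (e p.1) p.2 = p.2,
    mod_trace M = (\sum_(p <- g | U p.1) limg (orbm p.2))%VS
    & forall i, \dim (act M (e i) @: mod_trace M) =
        (\sum_(l <- s | U l) (\dim (blk i l) - \dim (<[e i]> * Kl l)))%N].
Proof.
elim=> {M s} [M M0|P M Q f p lam s [homf kf [homp sp] fp] Flam _ [g [gs ge gT gd]]].
  have T0 : mod_trace M = 0%VS by apply/eqP; rewrite -subv0 -M0 subvf.
  by exists [::]; split=> // [|i]; rewrite !big_nil ?T0 // limg0 dimv0.
have finj : injective f by apply/lker0P; rewrite kf.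
have dimf (Y : {vspace P}) : \dim (f @: Y) = \dim Y.
  by apply: limg_dim_eq; rewrite kf capv0.
have [m0 [em0 sm0 Um0]] := F_gen Flam.
have [m1 _ m1E] : exists2 m1, m1 \in fullv & m0 = p m1 by apply/memv_imgP; rewrite sp memvf.
have [m [em pm]] : exists m, act M (e lam) m = m /\ p m = m0.
  by exists (act M (e lam) m1); rewrite -act_mul (ld_idem H) homp -m1E.
pose g' := [seq (q.1, f q.2) | q <- g].
have TE : (f @: mod_trace P)%VS = (\sum_(q <- g' | U q.1) limg (orbm q.2))%VS.
  by rewrite big_map gT limg_sum; apply: eq_bigr => q _; rewrite img_orbm.
exists ((lam, m) :: g'); rewrite /= -map_comp; split.
- by rewrite -gs.
- move=> q; rewrite inE => /predU1P[->//|/mapP[q' q'g ->]] /=.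
  by rewrite -homf ge.
- rewrite big_cons /= -TE; case: ifP => Ul.
    apply: subv_anti; apply/andP; split; last first.
      rewrite subv_add trace_img // andbT; apply/subvP => _ /memv_imgP[a _ ->].
      by rewrite orbmE -em mem_mod_trace.
    apply: mod_trace_sub => a i y Ui.
    have : p y \in limg (orbm m0) by rewrite sm0 memvf.
    move=> /memv_imgP[b _]; rewrite orbmE -pm -homp => /eqP.
    rewrite -subr_eq0 -linearB -memv_ker -fp => /memv_imgP[n _ yE].
    have -> : y = act M b m + f n by rewrite -yE addrC subrK.
    rewrite !linearD /= -!act_mul -[act M _ m]orbmE memv_add //.
      by rewrite memv_img ?memvf.
    by rewrite act_mul -!homf memv_img // mem_mod_trace.
  (* For [lam] outside [U] the factor [Q] has no components of index in [U], so the trace of [M]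
     already lies in [P]. *)
  apply: subv_anti; rewrite trace_img // andbT.
  apply: mod_trace_sub => a i y Ui.
  have : act Q (e i) (p y) \in 0%VS.
    have : p y \in limg (orbm m0) by rewrite sm0 memvf.
    move=> /memv_imgP[b _ ->]; rewrite orbmE -em0 -!act_mul memv0 Um0.
    have bP := mem_blk e i lam b.
    by rewrite (blk_r H bP) (subvP (Kl_notU (negbT Ul) Ui)).
  rewrite memv0 -homp -memv_ker -fp => /memv_imgP[n _ yE].
  have -> : act M a (act M (e i) y) = f (act P a (act P (e i) n)).
    by rewrite !homf -yE -[X in _ = act M a X]act_mul (ld_idem H).
  by rewrite memv_img // mem_mod_trace.
move=> i; rewrite big_cons; case: ifP => Ul; last first.
  rewrite -gd -[RHS]dimf -modhom_img //; congr (\dim (_ @: _)).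
  apply: subv_anti; rewrite trace_img // andbT.
  apply: mod_trace_sub => a j y Uj.
  have : act Q (e j) (p y) \in 0%VS.
    have : p y \in limg (orbm m0) by rewrite sm0 memvf.
    move=> /memv_imgP[b _ ->]; rewrite orbmE -em0 -!act_mul memv0 Um0.
    have bP := mem_blk e j lam b.
    by rewrite (blk_r H bP) (subvP (Kl_notU (negbT Ul) Uj)).
  rewrite memv0 -homp -memv_ker -fp => /memv_imgP[n _ yE].
  have -> : act M a (act M (e j) y) = f (act P a (act P (e j) n)).
    by rewrite !homf -yE -[X in _ = act M a X]act_mul (ld_idem H).
  by rewrite memv_img // mem_mod_trace.
have eKb : (<[e i]> * Kl lam <= blk i lam)%VS by rewrite -e_pcolE prodvSr.
have -> : (\dim (blk i lam) - \dim (<[e i]> * Kl lam) = \dim (act Q (e i) @: fullv))%N.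
  by rewrite -(gen_dim H i (Kl_left lam) (Kl_pcol lam) (F_gen Flam)) addnK.
rewrite -gd -(limg_ker_dim p (act M (e i) @: mod_trace M)) addnC.
congr (_ + _)%N.
  rewrite -modhom_img //; congr (\dim (_ @: _)); apply/eqP; rewrite eqEsubv subvf.
  rewrite -sm0; apply/subvP => _ /memv_imgP[a _ ->].
  by rewrite orbmE -pm -homp memv_img // -em mem_mod_trace.
rewrite -[RHS]dimf -modhom_img //.
(* An element of the trace killed by [p] is [a m] plus an element of the trace of [P], with
   [a e_lam] in [Kl lam]. The components of [Kl lam] of index in [U] send [m] into the corresponding
   components of [P], and they generate [Kl lam]. *)
have capE : (mod_trace M :&: lker p <= f @: mod_trace P)%VS.
  apply/subvP => x /memv_capP[xT]; rewrite memv_ker => /eqP px.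
  have TME : (mod_trace M <= limg (orbm m) + f @: mod_trace P)%VS.
    apply: mod_trace_sub => a j y Uj.
    have : p y \in limg (orbm m0) by rewrite sm0 memvf.
    move=> /memv_imgP[b _]; rewrite orbmE -pm -homp => /eqP.
    rewrite -subr_eq0 -linearB -memv_ker -fp => /memv_imgP[n _ yE].
    have -> : y = act M b m + f n by rewrite -yE addrC subrK.
    rewrite !linearD /= -!act_mul -[act M _ m]orbmE memv_add //.
      by rewrite memv_img ?memvf.
    by rewrite act_mul -!homf memv_img // mem_mod_trace.
  have [_ /memv_imgP[a _ ->] [y yT xE]] := memv_addP (subvP TME _ xT).
  rewrite xE memvD //; move: px; rewrite xE linearD /= orbmE homp pm => px.
  have py : p y = 0.
    by have /memv_imgP[n _ ->] := yT; apply/eqP; rewrite -memv_ker -fp memv_img ?memvf.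
  have : a * e lam \in Kl lam by rewrite -Um0 -px py addr0.
  move/(subvP (Kl_U Ul)) => aK; rewrite -em -act_mul -[act M _ m]orbmE.
  suff /subvP/(_ _ aK) : ((\sum_(i | U i) pcol i * (<[e i]> * Kl lam)) <= orbm m @^-1: (f @: mod_trace P))%VS.
    by rewrite -memv_preim.
  apply/subv_sumP => j Uj; apply/prodvP => b k _ kK; rewrite -memv_preim orbmE act_mul.
  have ek := e_line_left H kK.
  have kK' : k * e lam = k.
    by apply: (pcolP H _ _ (subvP (Kl_pcol lam) _ _)); apply: subvP (left_ideal_line (e j) (Kl_left lam)) _ kK.
  have : act M k m \in lker p.
    rewrite memv_ker homp pm Um0 kK'; exact: subvP (left_ideal_line (e j) (Kl_left lam)) _ kK.
  rewrite -fp => /memv_imgP[n _ nE].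
  have -> : act M b (act M k m) = f (act P b (act P (e j) n)).
    by rewrite !homf -nE -[X in _ = act M b X]act_mul ek.
  by rewrite memv_img // mem_mod_trace.
congr (\dim _); apply/vspaceP => x; apply/memv_capP/idP.
  move=> [/memv_imgP[y yT xE] kx].
  have -> : x = act M (e i) x by rewrite xE -act_mul (ld_idem H).
  rewrite memv_img //; apply: (subvP capE); rewrite memv_cap kx andbT xE.
  suff : (mod_trace M <= act M (e i) @^-1: mod_trace M)%VS.
    by move/subvP/(_ _ yT); rewrite -memv_preim.
  by apply: mod_trace_sub => a j z Uj; rewrite -memv_preim -[act M (e i) _]act_mul mem_mod_trace.
move=> /memv_imgP[_ /memv_imgP[y yT ->] ->]; rewrite memv_img ?(subvP (trace_img homf)) ?memv_img //.
by split=> //; rewrite -homf -fp memv_img ?memvf.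
Qed.

End Trace.

End StandardModules.

(** * Stratification implies the numerical conditions *)

Lemma key_order (L : finType) (k : L -> nat) : injective k ->
  linear_order (fun x y => k x <= k y)%N.
Proof.
move=> kinj; split=> [x|x y /anti_leq/kinj //|y x z|x y].
- exact: leqnn.
- exact: leq_trans.
- exact: leq_total.
Qed.

Lemma sum_count (L : finType) (s : seq L) (P : pred L) (F : L -> nat) :
  (\sum_(l <- s | P l) F l = \sum_(l | P l) count_mem l s * F l)%N.
Proof.
elim: s => [|x s IHs]; first by rewrite big_nil big1.
have -> : (\sum_(l | P l) count_mem l (x :: s) * F l =
    \sum_(l | P l) (x == l) * F l + \sum_(l | P l) count_mem l s * F l)%N.
  by rewrite -big_split; apply: eq_bigr => l _; rewrite /= mulnDl.
rewrite -IHs big_cons; case: ifP => Px; last first.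
  by rewrite [X in _ = (X + _)%N]big1 // => l Pl; case: eqP => // xl; rewrite xl Pl in Px.
rewrite [X in _ = (X + _)%N](bigD1 x) //= eqxx mul1n [X in (_ + X + _)%N]big1 ?addn0 // => l /andP[_ /negPf lx].
by rewrite eq_sym lx.
Qed.

Section Necessity.
Variables (K : fieldType) (A : falgType K) (L : finType) (e : L -> A).
Variables (N : L -> {vspace A}) (h : L -> nat).
Hypothesis H : local_directed e N h.
Implicit Types (i j l : L) (U : pred L).

Local Notation blk := (blk e).
Local Notation pcol := (pcol e).
Local Notation tr := (tr e).

(** For [i != j] this is e_i J^2 e_j, as [jpow2] shows. *)
Definition sq i j : {vspace A} := (\sum_(m | (m != i) && (m != j)) blk i m * blk m j)%VS.
(** For [i != j], e_i J e_j modulo [rad_l i j] is the top of e_i (J / J^2) e_j over e_i A e_i on the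
    left, and modulo [rad_r i j] the top over e_j A e_j on the right. *)
Definition rad_l i j : {vspace A} := (sq i j + N i * blk i j)%VS.
Definition rad_r i j : {vspace A} := (sq i j + blk i j * N j)%VS.

(* mult i j is the multiplicity of A e_i in the projective cover of J e_j. *)
Definition mult i j : nat :=
  if i == j then 0%N else (\dim (blk i j) - \dim (rad_l i j))%N.

Lemma mult_diag j : mult j j = 0%N.
Proof. by rewrite /mult eqxx. Qed.

Lemma multE i j : i != j -> mult i j = (\dim (blk i j) - \dim (rad_l i j))%N.
Proof. by move=> /negPf ij; rewrite /mult ij. Qed.

(** One inequality is enough: the other holds in every case, because lifts of a basis of the top of
    J e_j generate J e_j; see [offdiag_projective_eq]. *)
Definition offdiag_projective : Prop := forall j,
  (\sum_l \dim (pcol l) * mult l j <= \sum_(i | i != j) \dim (blk i j))%N.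

(* e_i (J / J^2) e_j is free over e_j A e_j. *)
Definition arrows_right_free : Prop := forall i j, i != j ->
  (\dim (blk i j) - \dim (sq i j))%N =
  (\dim (blk j j) * (\dim (blk i j) - \dim (rad_r i j)))%N.

Lemma sq_blk i j : (sq i j <= blk i j)%VS.
Proof. by apply/subv_sumP => m _; apply: (prod_blk H). Qed.

Lemma rad_l_blk i j : (rad_l i j <= blk i j)%VS.
Proof.
rewrite subv_add sq_blk; apply: subv_trans (prod_blk H i i j).
exact: prodvSl (N_blk H i).
Qed.

Lemma rad_r_blk i j : (rad_r i j <= blk i j)%VS.
Proof.
rewrite subv_add sq_blk; apply: subv_trans (prod_blk H i j j).
exact: prodvSr (N_blk H j).
Qed.

Lemma mod_trace_reg U : mod_trace e U (regmod A) = (\sum_q tr U q)%VS.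
Proof.
apply: subv_anti; apply/andP; split.
  apply: mod_trace_sub => a i y Ui; rewrite !regmodE [y](peirce_sumr H) !mulr_sumr.
  apply: memv_sumr => q _; rewrite mulrA; apply: (subvP (tr_left e U q)).
  rewrite -mulrA; apply: memv_mul; rewrite ?memvf //.
  by apply: (subvP (blk_tr H _ Ui)); rewrite mulrA mem_blk.
apply/subv_sumP => q _; apply/subv_sumP => i Ui; apply/prodvP => x y _ yP.
have -> : x * y = act (regmod A) x (act (regmod A) (e i) y).
  by rewrite !regmodE (blk_l H yP).
exact: (mem_mod_trace e (M := regmod A) x y Ui).
Qed.

Lemma act_reg (a : A) (Y : {vspace A}) :
  (act (regmod A) a @: (Y : {vspace regmod A}))%VS = (<[a]> * Y)%VS.
Proof. by rewrite -limg_amull; apply: eq_in_limg => y _; rewrite regmodE lfunE. Qed.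

Lemma limg_orbm_reg (x : regmod A) : limg (orbm x) = ({:A} * <[x : A]>)%VS.
Proof.
rewrite -limg_amulr; apply: eq_in_limg => a _.
by rewrite [LHS](orbmE (M := regmod A)) regmodE lfunE.
Qed.

Lemma tr_col i U q q' : (<[e i]> * tr U q * <[e q']>)%VS =
  if q == q' then (<[e i]> * tr U q)%VS else 0%VS.
Proof.
case: eqVneq => [<-|qq].
  apply/vspaceP => x; apply/idP/idP => [/memv_cosetP[y yP ->]|xP].
    by rewrite (blk_r H (subvP (e_tr_blk H i U q) _ yP)).
  rewrite -(blk_r H (subvP (e_tr_blk H i U q) _ xP)) memv_mul ?memv_line //.
apply/eqP; rewrite -subv0; apply/prodvP => x y xP /vlineP[c ->].
rewrite -(blk_r H (subvP (e_tr_blk H i U q) _ xP)) -scalerAr -mulrA (ld_orth H) //.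
by rewrite mulr0 scaler0 mem0v.
Qed.

Lemma dim_e_trace i U :
  \dim (act (regmod A) (e i) @: mod_trace e U (regmod A)) =
  (\sum_q \dim (<[e i]> * tr U q))%N.
Proof.
rewrite act_reg mod_trace_reg big_distrr /=.
rewrite (dim_peircer H) => [|q]; last first.
  rewrite big_distrl /=; apply/subv_sumP => q' _; rewrite tr_col.
  by case: eqP => [->|_]; rewrite ?sub0v // (sumv_sup q).
apply: eq_bigr => q _; congr (\dim _); rewrite big_distrl /= (bigD1 q) //= tr_col eqxx.
rewrite big1 ?addv0 // => q' /negPf q'q; by rewrite tr_col q'q.
Qed.

(** An injective refinement of the height: ties are broken by the rank, which is smaller than
    [#|L|]. *)
Let key l := (h l * #|L| + enum_rank l)%N.
Let key_inj : injective key.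
Proof.
move=> a b; rewrite /key => E; apply: enum_rank_inj; apply: val_inj => /=.
have := congr1 (fun n => n %% #|L|)%N E.
by rewrite !modnMDl !modn_small.
Qed.
Let key_lt a b : (h a < h b)%N -> (key a < key b)%N.
Proof.
move=> hab; apply: (@leq_trans (h b * #|L|)); last exact: leq_addr.
apply: (@leq_trans ((h a).+1 * #|L|)); last by rewrite leq_mul2r hab orbT.
by rewrite /key mulSnr ltn_add2l.
Qed.
Let bound := (\max_l key l).+1.
Let key_bound l : (key l < bound)%N.
Proof. by rewrite ltnS; apply: leq_bigmax. Qed.

Section BottomOrder.
Variable j : L.
(** Every key is smaller than [bound], so the value 0 is left to [j]. *)
Let k l := if l == j then 0%N else (bound - key l)%N.
Let k_inj : injective k.
Proof.
have kpos l : (bound - key l)%N != 0%N by rewrite subn_eq0 -ltnNge.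
move=> a b; rewrite /k; case: (eqVneq a j) => [->|_]; case: (eqVneq b j) => [->|_] //.
- by move/eqP; rewrite eq_sym (negPf (kpos b)).
- by move/eqP; rewrite (negPf (kpos a)).
move=> E; apply: key_inj; have := key_bound a; have := key_bound b; lia.
Qed.

Let r : rel L := fun x y => (k x <= k y)%N.
Let U : pred L := [pred l | l != j].

(** For this order the standard modules of index other than [j] are therefore the projectives
    themselves. *)
Let above_blk lam nu : lam != j -> above r lam nu -> blk nu lam = 0%VS.
Proof.
move=> lj; rewrite /above /= /r -ltnNge /k (negPf lj).
case: eqVneq => // nj kk; have ne : nu != lam by apply: contraTneq kk => ->; rewrite ltnn.
apply: (blk0 H) => //; apply/negP => /key_lt; have := key_bound lam; have := key_bound nu; lia.
Qed.

(** The elements of [g] generate the trace of the projectives of index other than [j]. Those of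
    index [l] span its [e l]-component modulo the radical, so they are at least as many as the
    copies of S_l in its top. Column [l], which is all of A e_l, has one copy, and column [j], which
    is J e_j, has [mult l j]. *)
Lemma trace_bottom_bound (g : seq (L * A)) l :
    (forall p, p \in g -> e p.1 * p.2 = p.2) ->
    (\sum_q tr U q)%VS = (\sum_(p <- g | U p.1) {:A} * <[p.2]>)%VS ->
    l != j ->
  (1 + mult l j <= count_mem l (map fst g))%N.
Proof.
move=> ge gT lj.
pose I : {vspace A} := (\sum_q tr U q)%VS.
have IE : I = (\sum_(p <- g | U p.1) {:A} * <[p.2]>)%VS by [].
(* [S q] is the [e l]-component of the radical of column [q] of the trace; the radical of [A] is the
   sum of the [N i] and [J]. *)
pose S q : {vspace A} := (N l * (<[e l]> * tr U q) + \sum_(m | m != l) blk l m * (<[e m]> * tr U q))%VS.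
have eI : (<[e l]> * I <= \sum_(p <- g | p.1 == l) <[p.2]> + \sum_q S q)%VS.
  have SE : (\sum_q S q)%VS = (N l * (<[e l]> * I) + \sum_(m | m != l) blk l m * (<[e m]> * I))%VS.
    rewrite /S /I big_split /=; congr (_ + _)%VS; first by rewrite !big_distrr.
    rewrite exchange_big /=; apply: eq_bigr => m _; by rewrite !big_distrr.
  rewrite SE.
  have pI p : p \in g -> U p.1 -> p.2 \in I.
    move=> pg Up; rewrite IE (big_rem p) //= Up (subvP (addvSl _ _)) //.
    by rewrite -{1}[p.2]mul1r memv_mul ?memvf ?memv_line.
  rewrite {1}IE big_distrr /= big_seq_cond.
  apply: (big_ind (fun V => (V <= _)%VS)); first exact: sub0v.
    by move=> V W VP WP; rewrite subv_add VP.
  move=> p /andP[pg Up]; apply/prodvP => _ _ /vlineP[c ->] /memv_cosetP[a _ ->].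
  rewrite -scalerAl memvZ //.
  have aP := mem_blk e l p.1 a; have pE := ge p pg; have {}pI := pI p pg Up.
  have -> : e l * (a * p.2) = e l * a * e p.1 * (e p.1 * p.2).
    by rewrite pE -!mulrA pE.
  have [E|ne] := eqVneq p.1 l; last first.
    rewrite (subvP (addvSr _ _)) // (subvP (addvSr _ _)) //.
    by rewrite memvE (sumv_sup p.1) // -memvE memv_mul // memv_mul ?memv_line.
  rewrite E in aP pE *; rewrite (ld_dec H) in aP.
  have [_ /vlineP[d ->] [n nN ->]] := memv_addP aP.
  rewrite mulrDl -scalerAl !pE memv_add //.
    by rewrite memvZ // (big_rem p) //= E eqxx (subvP (addvSl _ _)) ?memv_line.
  by rewrite (subvP (addvSl _ _)) // -{1}pE memv_mul // memv_mul ?memv_line.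
have Ue : U l by [].
have Sb q : (\dim (S q) + (q == l) + (q == j) * mult l j <= \dim (blk l q))%N.
  have [->|ql] := eqVneq q l.
    rewrite (negPf lj) mul0n addn0 (dim_N H) addn1 ltnS dimvS // subv_add.
    rewrite (e_tr_full H) // (ld_mulr H) /=; apply/subv_sumP => m ml.
    apply: subv_trans (prodvSr _ (e_tr_blk H m U l)) _.
    by rewrite (blk_mul0 H) ?sub0v // eq_sym.
  rewrite addn0; have [->|qj] := eqVneq q j; last first.
    rewrite mul0n addn0 dimvS // subv_add; apply/andP; split.
      apply: subv_trans (prod_blk H l l q); apply: prodvS (N_blk H l) _.
      exact: (e_tr_blk H).
    apply/subv_sumP => m _; apply: subv_trans (prod_blk H l m q).
    exact: prodvSr (e_tr_blk H _ _ _).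
  rewrite mul1n /mult (negPf lj); have sub : (S j <= rad_l l j)%VS.
    rewrite subv_add; apply/andP; split.
      by rewrite (e_tr_full H) //; apply: addvSr.
    apply/subv_sumP => m ml; have [->|mj] := eqVneq m j.
      by rewrite (e_tr0 H) ?prodv0 ?sub0v //= negbK.
    apply: subv_trans (prodvSr _ (e_tr_blk H _ _ _)) _; apply: subv_trans (addvSl _ _).
    by rewrite (sumv_sup m) // ml.
  apply: leq_trans (leq_add (dimvS sub) (leqnn _)) _.
  by rewrite subnKC // dimvS // rad_l_blk.
have dI : \dim (<[e l]> * I) = (\sum_q \dim (blk l q))%N.
  rewrite /I -act_reg -mod_trace_reg dim_e_trace; apply: eq_bigr => q _.
  by rewrite (e_tr_full H).
have := leq_sum (P := xpredT) (index_enum L) (fun q _ => Sb q).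
rewrite !big_split /= -dI => sumS.
have s1 : (\sum_q (q == l) = 1)%N by rewrite (bigD1 l) //= eqxx big1 // => q /negPf ->.
have s2 : (\sum_q (q == j) * mult l j = mult l j)%N.
  by rewrite (bigD1 j) //= eqxx mul1n big1 ?addn0 // => q /negPf ->.
have d1 := dimvS eI; have d2 := dimv_add_le (\sum_(p <- g | p.1 == l) <[p.2]>)%VS (\sum_q S q)%VS.
have d3 := dim_sum_le xpredT S.
have d4 : (\dim (\sum_(p <- g | p.1 == l) <[p.2]>)%VS <= count_mem l (map fst g))%N.
  rewrite -sum1_count big_map /=; elim: (g) => [|p g' IHg]; first by rewrite !big_nil dimv0.
  rewrite !big_cons /= eq_sym; case: eqP => // _.
  by apply: leq_trans (dimv_add_le _ _) _; rewrite leq_add // dim_vline leq_b1.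
move: sumS d1 d2 d3 d4; rewrite s1 s2; move: (\dim _) (\dim _) (\dim _) (count_mem _ _) (mult _ _) (\sum_q _)%N => *; lia.
Qed.

(** All factors of index other than [j] are projective, so the dimension of the trace is the sum of
    their multiplicities times [\dim (pcol l)], and the multiplicities are at least [1 + mult l j].
    On the other hand column [q != j] of the trace is at most A e_q, and column [j] lacks its
    diagonal component. Cancelling the columns [q != j] leaves the claim. *)
Lemma strat_bottom : (forall r', linear_order r' -> standardly_stratified e r') ->
  (\sum_l \dim (pcol l) * mult l j <= \sum_(i | i != j) \dim (blk i j))%N.
Proof.
move=> /(_ r (key_order k_inj))[s Fs]; pose Kl := std_ker e r.
have Kl0 lam : U lam -> Kl lam = 0%VS.
  by move=> Ul; apply: big1 => nu /(above_blk Ul) ->; rewrite prodv0.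
have kj : k j = 0%N by rewrite /k eqxx.
have kn0 l : l != j -> (0 < k l)%N.
  by move=> /negPf lj; rewrite /k lj subn_gt0.
have [] := @filtration_trace _ _ _ e N h H U (is_standard e r) Kl _ _ _ _ _ _ s Fs.
- by move=> lam D /(is_standard_gen H).
- exact: std_ker_left.
- exact: (std_ker_pcol H).
- by move=> lam /Kl0 ->; apply: sub0v.
- move=> lam i; rewrite /= negbK => /eqP -> ij; apply: (blk_tr H).
  by rewrite /above /= /r kj leqn0 -lt0n kn0.
move=> g [gs ge gT gd].
have gT' : (\sum_q tr U q)%VS = (\sum_(p <- (g : seq (L * A)) | U p.1) {:A} * <[p.2]>)%VS.
  by rewrite -mod_trace_reg gT; apply: eq_bigr => p _; rewrite limg_orbm_reg.
have ge' (p : L * A) : p \in g -> e p.1 * p.2 = p.2 by move=> /ge; rewrite regmodE.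
have cnt l : l != j -> (1 + mult l j <= count_mem l s)%N.
  by move=> lj; rewrite -gs; apply: (trace_bottom_bound ge' gT' lj).
have E1 : (\sum_i \sum_q \dim (<[e i]> * tr U q) = \sum_(l | l != j) count_mem l s * \dim (pcol l))%N.
  rewrite -(sum_count s (fun l => l != j)).
  transitivity (\sum_i \sum_(l <- s | U l) \dim (blk i l))%N.
    apply: eq_bigr => i _; rewrite -dim_e_trace gd; apply: eq_bigr => l Ul.
    by rewrite Kl0 // prodv0 dimv0 subn0.
  by rewrite exchange_big; apply: eq_bigr => l _; rewrite (dim_pcol H).
have E2 : (\sum_i \sum_q \dim (<[e i]> * tr U q) <=
    \sum_(q | q != j) \dim (pcol q) + \sum_(i | i != j) \dim (blk i j))%N.
  rewrite exchange_big (bigD1 j) //= addnC leq_add //.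
    apply: leq_sum => q qj; rewrite (dim_pcol H); apply: leq_sum => i _.
    exact/dimvS/(e_tr_blk H).
  have Uj : ~~ U j by rewrite /U /= eqxx.
  rewrite (bigD1 j) //= (e_tr0 H Uj) dimv0 add0n.
  by apply: leq_sum => i _; apply/dimvS/(e_tr_blk H).
have E3 : (\sum_(l | l != j) (1 + mult l j) * \dim (pcol l) <= \sum_(l | l != j) count_mem l s * \dim (pcol l))%N.
  by apply: leq_sum => l lj; rewrite leq_mul2r cnt ?orbT.
rewrite (bigD1 j) //= {1}/mult eqxx muln0 add0n.
rewrite -(leq_add2l (\sum_(q | q != j) \dim (pcol q))).
apply: leq_trans E2; rewrite E1; apply: leq_trans E3.
rewrite -big_split /=; apply: leq_sum => l _.
by rewrite mulnDl mul1n mulnC.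
Qed.

End BottomOrder.

Section UpperSet.
Variables (r : rel L) (U : pred L).
Hypothesis rr : reflexive r.
Hypothesis U_up : forall lam nu, U lam -> above r lam nu -> U nu.
Hypothesis U_above : forall lam nu, ~~ U lam -> U nu -> above r lam nu.

(** [U] is closed upwards. For [lam] in [U] the kernel of the proper standard module is generated by
    components of index in [U]: those above [lam], and [N lam], which sits at [lam] itself. *)
Lemma proper_trace_dim s i : filtration (is_proper_standard e r) (regmod A) s ->
  (\sum_q \dim (<[e i]> * tr U q) =
   \sum_(l <- s | U l) (\dim (blk i l) - \dim (<[e i]> * pstd_ker e N r l)))%N.
Proof.
move=> Fs.
have [] := @filtration_trace _ _ _ e N h H U (is_proper_standard e r) (pstd_ker e N r) _ _ _ _ _ _ s Fs.
- by move=> lam D /(is_proper_standard_gen H lam D rr).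
- exact: pstd_ker_left.
- exact: (pstd_ker_pcol H).
- move=> lam Ul; rewrite subv_add; apply/andP; split.
    apply/subv_sumP => nu lamnu; rewrite (sumv_sup nu) ?(U_up Ul) //.
    apply: prodvSr; apply/subvP => x xP; rewrite -(blk_l H xP) memv_mul ?memv_line //.
    by rewrite (subvP (addvSl _ _)) // (subvP (blk_tr H _ lamnu)).
  rewrite (sumv_sup lam) //; apply: prodvSr; rewrite (e_pstd_ker_diag H) //.
- move=> lam nu Ul Un; apply: subv_trans (addvSl _ _); apply: (blk_tr H).
  exact: U_above.
by move=> g [_ _ _ gd]; rewrite -gd dim_e_trace.
Qed.

End UpperSet.

Section PairOrder.
Variables i j : L.
Hypothesis ij : i != j.
(** Only the two smallest elements matter, [i] and then [j]; the others just need distinct values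
    from 2 on. *)
Let k l := if l == i then 0%N else if l == j then 1%N else (key l + 2)%N.
Let k_inj : injective k.
Proof.
have k_cases l : [\/ l = i /\ k l = 0%N, l = j /\ k l = 1%N | k l = (key l).+2].
  rewrite /k; case: eqVneq => [->|_]; first by constructor 1.
  case: eqVneq => [->|_]; first by constructor 2.
  by constructor 3; rewrite addn2.
move=> a b; case: (k_cases a) => [[->->]|[->->]|->];
  case: (k_cases b) => [[->->]|[->->]|->] //.
by case=> /key_inj.
Qed.

Let r : rel L := fun x y => (k x <= k y)%N.
Let U : pred L := [pred l | l != i].
Let U' : pred L := [pred l | (l != i) && (l != j)].

Let kj : k j = 1%N. Proof. by rewrite /k eq_sym (negPf ij) eqxx. Qed.
Let k_pos l : U l = (0 < k l)%N.
Proof. by rewrite /U /k /=; case: eqVneq => //= _; case: eqVneq => // _; rewrite addn2. Qed.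
Let k_gt1 l : U' l = (1 < k l)%N.
Proof. by rewrite /U' /k /=; case: eqVneq => //= _; case: eqVneq => // _; rewrite addn2. Qed.

(** Passing from [U'] to [U] adds to the trace the factors of index [j] of a proper standard
    filtration. In the [e j]-component each counts 1, which determines their number; in the
    [e i]-component each counts [del i j]. In each column, [dim_prod_bound] limits the growth of the
    [e i]-component to [del i j] times that of the [e j]-component. After summation both sides
    agree, hence they agree in every column, and column [j] is the claim. *)
Lemma strat_pair : (forall r', linear_order r' -> properly_stratified e r') ->
  (\dim (blk i j) - \dim (sq i j))%N =
  (\dim (blk j j) * (\dim (blk i j) - \dim (rad_r i j)))%N.
Proof.
move=> /(_ r (key_order k_inj))[_ [s Fs]].
have rr : reflexive r by move=> x; rewrite /r.
have Uj : U j by rewrite /U /= eq_sym.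
have [del delE] : exists del, forall l m,
    del l m = (\dim (blk l m) - \dim (<[e l]> * pstd_ker e N r m))%N.
  by exists (fun l m => (\dim (blk l m) - \dim (<[e l]> * pstd_ker e N r m))%N).
have UE l : (\sum_(m <- s | U m) del l m = \sum_(m <- s | U' m) del l m + count_mem j s * del l j)%N.
  by rewrite (sum_count s U) (sum_count s U') (bigD1 j) //= addnC.
have dU l : (\sum_q \dim (<[e l]> * tr U q) = \sum_(m <- s | U m) del l m)%N.
  under [RHS]eq_bigr => m _ do rewrite delE.
  apply: (proper_trace_dim rr _ _ l Fs) => lam nu; rewrite !k_pos /above /= /r.
    by rewrite -ltnNge; apply: ltn_trans.
  by rewrite -!ltnNge ltnS; apply: leq_ltn_trans.
have dU' l : (\sum_q \dim (<[e l]> * tr U' q) = \sum_(m <- s | U' m) del l m)%N.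
  under [RHS]eq_bigr => m _ do rewrite delE.
  apply: (proper_trace_dim rr _ _ l Fs) => lam nu; rewrite !k_gt1 /above /= /r.
    by rewrite -ltnNge; apply: ltn_trans.
  by rewrite -!ltnNge ltnS; apply: leq_ltn_trans.
have delj : del j j = 1%N.
  by rewrite delE (e_pstd_ker_diag H) // (dim_N H) subSnn.
have abj l : above r j l = U' l by rewrite k_gt1 /above /= /r kj -ltnNge.
have sqE : (<[e i]> * tr U' j)%VS = sq i j.
  by rewrite e_tr; apply: eq_bigl => l.
have deli : del i j = (\dim (blk i j) - \dim (rad_r i j))%N.
  rewrite delE e_pstd_ker /rad_r -sqE; congr (_ - \dim (_ * _ + _))%N.
  by apply: eq_bigl => l; rewrite abj.
have cnt : (count_mem j s = \sum_q (\dim (blk j q) - \dim (<[e j]> * tr U' q)))%N.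
  have := UE j; rewrite -dU -dU' delj muln1 => E.
  apply: (@addnI (\sum_q \dim (<[e j]> * tr U' q))%N); rewrite -E -big_split /=.
  apply: eq_bigr => q _; rewrite (e_tr_full H) // subnKC //.
  exact/dimvS/(e_tr_blk H).
pose Z q := (<[e i]> * tr U' q)%VS.
have bnd q : (\dim (<[e i]> * tr U q) <= \dim (Z q) +
    del i j * (\dim (blk j q) - \dim (<[e j]> * tr U' q)))%N.
  have -> : (<[e i]> * tr U q = blk i j * blk j q + Z q)%VS.
    rewrite /Z !e_tr (bigD1 j) //=.
  rewrite deli; have [b Nb] := N_nil H.
  apply: (dim_prod_bound (N := N j) (n := b) (Kv := sq i j)) => //.
  - exact: (e_tr_blk H).
  - by apply: subv_trans (prodvSl _ (N_blk H j)) (prod_blk H _ _ _).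
  - rewrite e_tr big_distrr /=; apply/subv_sumP => m Um.
    rewrite (sumv_sup m) // prodvA prodvSl //.
    by apply: subv_trans (prodvSl _ (N_blk H j)) (prod_blk H _ _ _).
  - exact: rad_r_blk.
  - rewrite /Z e_tr /sq big_distrl /=; apply/subv_sumP => m Um.
    rewrite (sumv_sup m) //; rewrite -prodvA prodvSr //; exact: (prod_blk H).
  - rewrite /Z !e_tr big_distrr /=; apply/subv_sumP => m Um.
    rewrite (sumv_sup m) // prodvA prodvSl //; exact: (prod_blk H).
have sumE : (\sum_q \dim (<[e i]> * tr U q) = \sum_q (\dim (Z q) +
    del i j * (\dim (blk j q) - \dim (<[e j]> * tr U' q))))%N.
  by rewrite big_split /= -big_distrr /= -cnt dU UE dU' mulnC.
have eqj : (\dim (<[e i]> * tr U j) = \dim (Z j) +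
    del i j * (\dim (blk j j) - \dim (<[e j]> * tr U' j)))%N.
  have := leqif_sum (P := xpredT) (fun q _ => leqif_eq (bnd q)).
  by move=> [_]; rewrite sumE eqxx => /esym/forallP/(_ j)/implyP/(_ isT)/eqP.
have U'j : ~~ U' j by rewrite /U' /= eqxx andbF.
move: eqj; rewrite (tr_full H Uj) e_pcolE (e_tr0 H U'j) dimv0 subn0.
by rewrite /Z sqE deli => E; rewrite {1}E addKn mulnC.
Qed.

End PairOrder.

Lemma strat_offdiag_projective :
  (forall r, linear_order r -> standardly_stratified e r) -> offdiag_projective.
Proof. by move=> strat j; apply: strat_bottom. Qed.

Lemma strat_arrows_right_free :
  (forall r, linear_order r -> properly_stratified e r) -> arrows_right_free.
Proof. by move=> strat i j ij; apply: strat_pair. Qed.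

End Necessity.

(** * The numerical conditions imply stratification *)

Section BigSums.
Variables (K : fieldType) (V : vectType K).

Lemma memv_big_seq (I : eqType) (r : seq I) (F : I -> {vspace V}) (i : I) (v : V) :
  i \in r -> v \in F i -> v \in (\sum_(i <- r) F i)%VS.
Proof. by move=> ir vF; rewrite (big_rem i) //= (subvP (addvSl _ _)). Qed.

Lemma subv_big_seq (I : eqType) (r : seq I) (F : I -> {vspace V})
  (W : {vspace V}) : (forall i : I, i \in r -> (F i <= W)%VS) -> (\sum_(i <- r) F i <= W)%VS.
Proof.
move=> FW; rewrite big_seq; apply: (big_ind (fun V => (V <= W)%VS)) => //.
  exact: sub0v.
by move=> V1 V2 V1W V2W; rewrite subv_add V1W.
Qed.

End BigSums.

Section Sufficiency.
Variables (K : fieldType) (A : falgType K) (L : finType) (e : L -> A).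
Variables (N : L -> {vspace A}) (h : L -> nat).
Hypothesis H : local_directed e N h.
Implicit Types (i j l : L) (U V W Z : {vspace A}).

Local Notation blk := (blk e).
Local Notation pcol := (pcol e).
Local Notation tr := (tr e).
Local Notation mult := (mult e N).
Local Notation rad_l := (rad_l e N).
Local Notation rad_r := (rad_r e N).
Local Notation sq := (sq e).
Local Notation left_ideal := (@left_ideal K A).

Definition gen_space i j : {vspace A} :=
  if i == j then 0%VS else (blk i j :\: rad_l i j)%VS.

(* Lifts of a basis of the top of J e_j. *)
Definition gens j : seq (L * A) :=
  [seq (l, a) | l <- enum L, a <- (vbasis (gen_space l j) : seq A)].

Lemma dim_gen_space l j : \dim (gen_space l j) = mult l j.
Proof.
have [->|lj] := eqVneq l j; first by rewrite /gen_space eqxx mult_diag dimv0.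
by rewrite multE // /gen_space (negPf lj) dim_diffv // (rad_l_blk H).
Qed.

Lemma sum_gens j (F : L -> nat) :
  (\sum_(p <- gens j) F p.1 = \sum_l mult l j * F l)%N.
Proof.
rewrite big_allpairs_dep big_enum; apply: eq_bigr => l _ /=.
by rewrite big_const_seq count_predT size_tuple dim_gen_space iter_addn_0 mulnC.
Qed.

Lemma gensP j p : p \in gens j -> [/\ p.1 != j, p.2 \in blk p.1 j & p.2 != 0].
Proof.
move=> /allpairsPdep[l [a [_ al ->]]] /=.
have a0 : a != 0 by apply: (free_not0 (basis_free (vbasisP _)) al).
have := vbasis_mem al; rewrite /gen_space; case: eqVneq => [_|lj].
  by rewrite memv0 (negPf a0).
by move/(subvP (diffvSl _ _)).
Qed.

Lemma gens_lt j p : p \in gens j -> (h j < h p.1)%N.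
Proof.
move=> /gensP[pj pb p0]; apply: (ld_dir H) => //.
by apply: contraNneq p0 => b0; rewrite -memv0 -b0.
Qed.

Lemma mult_lt l j : mult l j != 0%N -> (h j < h l)%N.
Proof.
have [->|lj] := eqVneq l j; first by rewrite mult_diag.
rewrite multE // => m0.
apply: (ld_dir H) => //; apply: contraNneq m0 => ->; by rewrite dimv0 sub0n.
Qed.

(** Nakayama for the nilpotent [N i], inside an induction on the height of [i]: besides the chosen
    generators and [N i * blk i j], only products through some [m] lower than [i] occur. *)
Lemma blk_gens i j : i != j -> blk i j = (\sum_(p <- gens j) blk i p.1 * <[p.2]>)%VS.
Proof.
move=> ij; apply: subv_anti; apply/andP; split; last first.
  apply: subv_big_seq => p /gensP[_ pb _]; apply: subv_trans (prod_blk H i p.1 j).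
  exact: prodvSr.
have [n] := ubnP (h i); elim: n i ij => // n IHn i ij; rewrite ltnS => hin.
have [b Nb] := N_nil H.
set Y := (\sum_(p <- gens j) _)%VS.
have multY m : (blk i m * (\sum_(p <- gens j) blk m p.1 * <[p.2]>) <= Y)%VS.
  rewrite big_distrr /=; apply: subv_big_seq => p pg; rewrite prodvA.
  apply: subv_trans (prodvSl _ (prod_blk H i m p.1)) _.
  by apply/subvP => x; apply: memv_big_seq pg.
apply: (nakayama (Nb i)).
  by apply: subv_trans (multY i); apply: prodvSl (N_blk H i).
have gE : (blk i j <= gen_space i j + rad_l i j)%VS.
  by rewrite /gen_space (negPf ij) diffv_addK ?(rad_l_blk H).
apply: subv_trans gE _.
rewrite subv_add; apply/andP; split.
  apply: subv_trans (addvSr _ _); apply/subvP => x.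
  rewrite -{1}(span_basis (vbasisP (gen_space i j))); apply/subvP/span_subvP => a aP.
  have pg : (i, a) \in gens j by apply/allpairsPdep; exists i, a; rewrite mem_enum.
  apply: (memv_big_seq pg) => /=; have [_ /= ab _] := gensP pg.
  by rewrite -{1}(blk_l H ab) memv_mul ?(e_blk H) ?memv_line.
rewrite subv_add addvSl andbT; apply: subv_trans (addvSr _ _).
apply/subv_sumP => m /andP[mi mj].
have [hmi|hmi] := boolP (h m < h i)%N; last first.
  by rewrite (blk0 H hmi) 1?eq_sym // prod0v sub0v.
apply: subv_trans (prodvSr _ _) (multY m); apply: IHn => //.
exact: leq_trans hmi hin.
Qed.

(** The sum of the [pcol q.1 * <[q.2]>] is direct and each summand is a copy of [pcol q.1]; the
    recursive form suits inductions on the list. *)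
Fixpoint independent (g : seq (L * A)) : Prop :=
  if g is p :: g' then
    (forall x, x \in pcol p.1 -> x * p.2 \in (\sum_(q <- g') pcol q.1 * <[q.2]>)%VS -> x = 0)
    /\ independent g'
  else True.

Lemma dim_pcol_line V (a : A) : (\dim (V * <[a]>) <= \dim V)%N.
Proof. by rewrite -limg_amulr dimv_img_le. Qed.

Lemma dim_sum_pcol (g : seq (L * A)) :
  (\dim (\sum_(q <- g) pcol q.1 * <[q.2]>)%VS <= \sum_(q <- g) \dim (pcol q.1))%N.
Proof.
elim: g => [|p g IHg]; first by rewrite !big_nil dimv0.
rewrite !big_cons; apply: leq_trans (dimv_add_le _ _) _.
by rewrite leq_add // dim_pcol_line.
Qed.

(** The left side is the largest dimension that such a sum can have. When it is attained, no stage
    loses dimension. *)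
Lemma independent_dim (g : seq (L * A)) :
    (\sum_(q <- g) \dim (pcol q.1) <=
     \dim (\sum_(q <- g) pcol q.1 * <[q.2]>)%VS)%N ->
  independent g.
Proof.
elim: g => [//|p g IHg]; rewrite !big_cons.
set S := (\sum_(q <- g) pcol q.1 * <[q.2]>)%VS => dS.
pose W := (pcol p.1 :&: amulr p.2 @^-1: S)%VS.
have fW : (amulr p.2 @: W <= S)%VS.
  apply/subvP => _ /memv_imgP[x /memv_capP[_ xS] ->]; by rewrite memv_preim.
have := dim_img_quot (capvSl _ _ : (W <= pcol p.1)%VS) fW; rewrite limg_amulr => dW.
have dg := dim_sum_pcol g; rewrite -/S in dg.
have lW : (\dim W <= \dim (pcol p.1))%N by rewrite dimvS ?capvSl.
have {dS dW dg lW} [dW0 dg] : \dim W = 0%N /\ (\sum_(q <- g) \dim (pcol q.1) <= \dim S)%N.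
  by move: dS dW dg lW; move: (\dim W) (\dim S) (\dim _) (\sum_(q <- g) _)%N (\dim _) => *; lia.
split=> /= [x xp xS|]; last exact: IHg.
have /eqP := dW0; rewrite dimv_eq0 => /eqP W0; apply/eqP; rewrite -memv0 -W0 memv_cap xp.
by rewrite -memv_preim lfunE.
Qed.

Lemma sum_lines_sub (g : seq (L * A)) (V W : L -> {vspace A}) :
  (forall l, (V l <= W l)%VS) ->
  (\sum_(q <- g) V q.1 * <[q.2]> <= \sum_(q <- g) W q.1 * <[q.2]>)%VS.
Proof.
move=> VW; elim: g => [|p g IHg]; first by rewrite !big_nil.
by rewrite !big_cons addvS ?prodvSl.
Qed.

Lemma dim_independent (g : seq (L * A)) (V : L -> {vspace A}) :
    independent g -> (forall l, (V l <= pcol l)%VS) ->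
  \dim (\sum_(q <- g) V q.1 * <[q.2]>)%VS = (\sum_(q <- g) \dim (V q.1))%N.
Proof.
move=> + Vp; elim: g => [|p g IHg] /=; first by rewrite !big_nil dimv0.
case=> ip ig; rewrite !big_cons -IHg //.
have sub : (\sum_(q <- g) V q.1 * <[q.2]> <= \sum_(q <- g) pcol q.1 * <[q.2]>)%VS.
  exact: sum_lines_sub.
rewrite dimv_disjoint_sum; last first.
  apply/eqP; rewrite -subv0; apply/subvP => _ /memv_capP[/memv_cosetP[x xV ->]].
  by move/(subvP sub)/(ip _ (subvP (Vp _) _ xV)) ->; rewrite mul0r mem0v.
congr (_ + _)%N; rewrite -limg_amulr; apply: limg_dim_eq.
apply/eqP; rewrite -subv0; apply/subvP => x /memv_capP[xV].
rewrite memv_ker lfunE /= => /eqP x0; rewrite memv0; apply/eqP.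
by apply: ip (subvP (Vp _) _ xV) _; rewrite x0 mem0v.
Qed.

Section LeftFiltrations.
Variable Kl : L -> {vspace A}.

Definition left_factor l U W := exists u : A, [/\ e l * u = u,
  U = ({:A} * <[u]> + W)%VS & forall a, (a * u \in W) = (a * e l \in Kl l)].

(** Filtrations of [U / V] by left ideals with factors [A e_l / Kl l]. The free lower end [V] lets
    them be concatenated and carried along right multiplications. *)
Inductive left_filtered : {vspace A} -> {vspace A} -> Prop :=
| LeftFiltered0 V : left_filtered V V
| LeftFilteredS l U W V : left_ideal W -> left_factor l U W -> left_filtered W V -> left_filtered U V.

Lemma left_filtered_trans U V W :
  left_filtered U V -> left_filtered V W -> left_filtered U W.
Proof.
elim=> {U V} // l U W' V lW' f _ IH /IH; exact: LeftFilteredS f.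
Qed.

Lemma left_filtered_shift l (a : A) U V Z : left_filtered U V ->
    (U <= pcol l)%VS -> left_ideal Z ->
    (forall x, x \in pcol l -> x * a \in Z -> x = 0) ->
  left_filtered (U * <[a]> + Z) (V * <[a]> + Z).
Proof.
move=> UV + lZ inj; elim: UV => {U V} [V _|l' U W V lW [u [eu UE uK]] _ IH Up].
  exact: LeftFiltered0.
have Wp : (W <= pcol l)%VS by apply: subv_trans Up; rewrite UE addvSr.
have up : u \in pcol l.
  rewrite (subvP Up) // UE (subvP (addvSl _ _)) //.
  by rewrite -{1}[u]mul1r memv_mul ?memvf ?memv_line.
apply: (LeftFilteredS (l := l')) (IH Wp); first exact/left_ideal_add/lZ/left_ideal_prod.
exists (u * a); split; first by rewrite mulrA eu.
  by rewrite UE prodvDl -prodvA prodv_line addvA.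
move=> b; rewrite -uK mulrA; apply/idP/idP => [|bW]; last first.
  by rewrite (subvP (addvSl _ _)) // memv_mul ?memv_line.
move=> /memv_addP[_ /memv_cosetP[w wW ->] [z zZ E]].
have bu : b * u \in pcol l by apply: left_idealM up; apply: left_ideal_pcol.
suff -> : b * u = w by [].
apply/eqP; rewrite -subr_eq0; apply/eqP/inj.
  by rewrite memvB // (subvP Wp).
by rewrite mulrBl E addrC addKr.
Qed.

Lemma left_filtered_sum (g : seq (L * A)) (V : L -> {vspace A}) :
    independent g -> (forall l, left_ideal (V l)) -> (forall l, (V l <= pcol l)%VS) ->
    (forall p, p \in g -> left_filtered (V p.1) 0) ->
  left_filtered (\sum_(p <- g) V p.1 * <[p.2]>)%VS 0.
Proof.
move=> + lV Vp; elim: g => [|p g IHg] /= ig fg; first by rewrite big_nil; constructor.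
case: ig => ip ig; rewrite big_cons.
have sub : (\sum_(q <- g) V q.1 * <[q.2]> <= \sum_(q <- g) pcol q.1 * <[q.2]>)%VS.
  exact: sum_lines_sub.
have {}IHg := IHg ig (fun q qg => fg q (mem_behead (s := p :: g) qg)).
apply: left_filtered_trans IHg.
have lS : left_ideal (\sum_(q <- g) V q.1 * <[q.2]>).
  by apply: left_ideal_sum => q _; apply: left_ideal_prod.
have inj x : x \in pcol p.1 -> x * p.2 \in (\sum_(q <- g) V q.1 * <[q.2]>)%VS -> x = 0.
  by move=> xp /(subvP sub); apply: ip.
have := left_filtered_shift (fg p (mem_head _ _)) (Vp _) lS inj.
by rewrite prod0v add0v.
Qed.

Lemma left_filtered_filtration (F : L -> lmodule A -> Prop) U (lU : left_ideal U) :
    (forall l D, gen_by (e l) (Kl l) D -> F l D) -> left_filtered U 0 ->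
  exists s, filtration F (submod (stable_left lU)) s.
Proof.
move=> FK; move: lU; move E : {1}(0%VS) => V + UV.
elim: UV E => {U V} [V <- lU|l U W V lW [u [eu UE uK]] _ IH E lU].
  by exists [::]; apply: filtration_sub0.
have [s Ws] := IH E lW; exists (l :: s).
apply: filtration_subfactor Ws; first exact: FK.
exists (u : regmod A); split; first by rewrite regmodE.
  by rewrite limg_orbm_reg.
by move=> a; rewrite regmodE.
Qed.

End LeftFiltrations.
End Sufficiency.

(** * Traces and filtrations when J is left projective *)

Section Projective.
Variables (K : fieldType) (A : falgType K) (L : finType) (e : L -> A).
Variables (N : L -> {vspace A}) (h : L -> nat).
Hypothesis H : local_directed e N h.
Implicit Types (i j l : L) (V W Z : {vspace A}) (U : pred L).

Local Notation blk := (blk e).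
Local Notation pcol := (pcol e).
Local Notation tr := (tr e).
Local Notation mult := (mult e N).
Local Notation rad_l := (rad_l e N).
Local Notation rad_r := (rad_r e N).
Local Notation sq := (sq e).
Local Notation gens := (gens e N).
Local Notation left_ideal := (@left_ideal K A).

Definition jcol j : {vspace A} := (\sum_(i | i != j) blk i j)%VS.

Lemma e_blk_line i i' j : (<[e i]> * blk i' j = if i == i' then blk i' j else 0)%VS.
Proof.
case: eqVneq => [->|ii].
  apply/eqP; rewrite eqEsubv; apply/andP; split.
    exact: subv_trans (prodvSl _ (memv_e H i')) (prod_blk H _ _ _).
  by apply/subvP => x xP; rewrite -(blk_l H xP) memv_mul ?memv_line.
apply/eqP; rewrite -subv0; apply/prodvP => _ x /vlineP[c ->] xP.
by rewrite -(blk_l H xP) -scalerAl mulrA (ld_orth H) // mul0r scaler0 mem0v.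
Qed.

Lemma dim_jcol j : \dim (jcol j) = (\sum_(i | i != j) \dim (blk i j))%N.
Proof.
have eJ i : (<[e i]> * jcol j = if i == j then 0 else blk i j)%VS.
  rewrite big_distrr /=; case: eqVneq => [->|ij].
    by apply: big1 => l lj; rewrite e_blk_line eq_sym (negPf lj).
  rewrite (bigD1 i) //= e_blk_line eqxx big1 ?addv0 // => l /andP[_ li].
  by rewrite e_blk_line eq_sym (negPf li).
rewrite (dim_peircel H) => [|i]; last first.
  by rewrite eJ; case: eqVneq => [_|ij]; rewrite ?sub0v // (sumv_sup i).
rewrite [RHS]big_mkcond; apply: eq_bigr => i _; rewrite eJ.
by case: eqP; rewrite ?dimv0.
Qed.

Lemma jcol_gens j : jcol j = (\sum_(p <- gens j) pcol p.1 * <[p.2]>)%VS.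
Proof.
apply: subv_anti; apply/andP; split.
  apply/subv_sumP => i ij; rewrite (blk_gens H ij).
  apply: sum_lines_sub => l; exact: (blk_pcol H).
apply: subv_big_seq => p /[dup] pg /gensP[pj pb _].
apply/prodvP => x y _ /vlineP[c ->]; rewrite -scalerAr memvZ //.
rewrite [x * _](peirce_sum H); apply: memv_suml => i _.
have xE : e i * (x * p.2) = e i * x * e p.1 * p.2.
  by rewrite -[RHS]mulrA (blk_l H pb) mulrA.
have [E|ij] := eqVneq i j; last first.
  by rewrite memvE (sumv_sup i) // -memvE xE (blkM H (mem_blk _ _ _ _) pb).
suff -> : e i * (x * p.2) = 0 by rewrite mem0v.
apply/eqP; rewrite -memv0 -(blk_mul0 H (i := j) (j := p.1)) 1?eq_sym // xE -E.
by rewrite memv_mul ?mem_blk // E.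
Qed.

Lemma dim_jcol_le j : (\dim (jcol j) <= \sum_l mult l j * \dim (pcol l))%N.
Proof. by rewrite jcol_gens -(sum_gens H j (fun l => \dim (pcol l))) dim_sum_pcol. Qed.

Lemma offdiag_projective_eq :
  offdiag_projective e N <-> forall j,
    \dim (pcol j) = (\dim (blk j j) + \sum_l mult l j * \dim (pcol l))%N.
Proof.
have dp j : \dim (pcol j) = (\dim (blk j j) + \dim (jcol j))%N.
  by rewrite (dim_pcol H) (bigD1 j) //= dim_jcol.
have cE j : (\sum_l \dim (pcol l) * mult l j = \sum_l mult l j * \dim (pcol l))%N.
  by apply: eq_bigr => l _; rewrite mulnC.
split=> PP j.
  rewrite dp; congr (_ + _)%N; apply/eqP; rewrite eqn_leq dim_jcol_le /=.
  by rewrite -cE dim_jcol PP.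
have := PP j; rewrite dp => /addnI; rewrite dim_jcol -cE => ->; exact: leqnn.
Qed.

Hypothesis PP : offdiag_projective e N.

Lemma gens_independent j : independent e (gens j).
Proof.
apply: independent_dim; rewrite -jcol_gens (sum_gens H j (fun l => \dim (pcol l))) dim_jcol.
by apply: leq_trans (PP j); apply: leq_sum => l _; rewrite mulnC.
Qed.

Lemma dim_gens_sum j (V : L -> {vspace A}) : (forall l, (V l <= pcol l)%VS) ->
  \dim (\sum_(p <- gens j) V p.1 * <[p.2]>)%VS = (\sum_l mult l j * \dim (V l))%N.
Proof.
move=> Vp; rewrite (dim_independent (gens_independent j) Vp).
exact: (sum_gens H j (fun l => \dim (V l))).
Qed.

(** As [j] is not in [U], the trace lies in J e_j and is computed in each of the copies of A e_l
    that make up J e_j. *)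
Lemma tr_gens U j : ~~ U j -> tr U j = (\sum_(p <- gens j) tr U p.1 * <[p.2]>)%VS.
Proof.
move=> Uj; apply: subv_anti; apply/andP; split.
  apply: tr_sub => [|i Ui].
    by apply: left_ideal_sum => p _; apply/left_ideal_prod/tr_left.
  have ij : i != j by apply: contraNneq Uj => <-.
  rewrite (blk_gens H ij); apply: sum_lines_sub => l; exact: (blk_tr H).
apply: subv_big_seq => p /gensP[pj pb _].
rewrite big_distrl /=; apply/subv_sumP => i Ui; rewrite (sumv_sup i) // -prodvA.
apply: prodvSr; apply: subv_trans (prodvSr _ _) (prod_blk H i p.1 j).
by rewrite -memvE.
Qed.

Lemma e_tr_gens i U j : ~~ U j ->
  (<[e i]> * tr U j)%VS = (\sum_(p <- gens j) (<[e i]> * tr U p.1) * <[p.2]>)%VS.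
Proof.
by move=> Uj; rewrite tr_gens // big_distrr /=; apply: eq_bigr => p _; rewrite prodvA.
Qed.

(** The members of [gens j] are higher than [j], so the induction is on the distance to the maximal
    height. For [j] in [U] the trace is all of A e_j; the given filtration leads down to the trace
    of the indices above [j], an upward closed set that no longer contains [j]. *)
Lemma tr_filtered (Kl : L -> {vspace A}) (r : rel L) : linear_order r ->
    (forall j, left_filtered e Kl (pcol j) (tr (above r j) j)) ->
  forall U j, (forall lam nu, U lam -> above r lam nu -> U nu) ->
    left_filtered e Kl (tr U j) 0.
Proof.
case=> rr ra rt rtot Kj.
suff main n j : (\max_l h l - h j < n)%N -> forall U,
    (forall lam nu, U lam -> above r lam nu -> U nu) -> left_filtered e Kl (tr U j) 0.
  by move=> U j; apply: (main (\max_l h l - h j).+1).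
elim: n j => // n IHn j hj.
have notin U : (forall lam nu, U lam -> above r lam nu -> U nu) -> ~~ U j ->
    left_filtered e Kl (tr U j) 0.
  move=> Uup Uj; rewrite tr_gens //; apply: (left_filtered_sum).
  - exact: gens_independent.
  - by move=> l; apply: tr_left.
  - by move=> l; apply: (tr_pcol H).
  move=> p /(gens_lt H) hp; apply: IHn => //; rewrite ltnS in hj.
  apply: leq_trans hj; apply: ltn_sub2l => //.
  by apply: leq_trans hp _; apply: leq_bigmax.
move=> U Uup; have [Uj|] := boolP (U j); last exact: notin.
rewrite (tr_full H Uj); apply: left_filtered_trans (Kj j) _; apply: notin.
  move=> lam nu; rewrite /above /= => lj nl; apply: contra nl => nj.
  by have := rtot lam j; rewrite (negPf lj) /=; apply: rt nj.
by rewrite /above /= rr.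
Qed.

Lemma filtration_reg (F : L -> lmodule A -> Prop) (Kl : L -> {vspace A}) (r : rel L) :
    linear_order r -> (forall l D, gen_by (e l) (Kl l) D -> F l D) ->
    (forall j, left_filtered e Kl (pcol j) (tr (above r j) j)) ->
  exists s, filtration F (regmod A) s.
Proof.
move=> lr FK Kj.
have full : (\sum_(p <- [seq (j, e j) | j <- enum L]) pcol p.1 * <[p.2]>)%VS = fullv.
  apply/eqP; rewrite eqEsubv subvf /=; apply/subvP => x _.
  rewrite [x](peirce_sumr H); apply: memv_suml => j _.
  apply: (memv_big_seq (i := (j, e j))); first by rewrite map_f // mem_enum.
  have xj : x * e j \in pcol j by rewrite memv_mul ?memvf ?memv_line.
  by rewrite -(pcolP H _ _ xj) memv_mul ?memv_line.
have lF : left_ideal fullv by apply: subvf.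
have ff : left_filtered e Kl fullv 0.
  rewrite -full; apply: (left_filtered_sum) => [|l|l|p _].
  - apply: (independent_dim); rewrite full.
    rewrite big_map big_enum /= (dim_peircer H) => [|q]; last exact: subvf.
    exact: leqnn.
  - exact: left_ideal_pcol.
  - exact: subvv.
  have {1}<- : tr predT p.1 = pcol p.1 by rewrite (tr_full H).
  exact: (tr_filtered lr Kj).
have [s Fs] := left_filtered_filtration lF FK ff; exists s.
exact: filtration_iso (submod_full (M := regmod A) _) Fs.
Qed.

Lemma standardly_stratified_all r : linear_order r -> standardly_stratified e r.
Proof.
move=> lr; apply: (filtration_reg lr (Kl := std_ker e r)).
  by move=> l D /(is_standard_gen H).
move=> j; apply: (LeftFilteredS (l := j)) (LeftFiltered0 _ _ _).
  exact: tr_left.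
exists (e j); split; first exact: (ld_idem H).
  by apply/esym/addv_idPl/(tr_pcol H).
by [].
Qed.

Hypothesis XR : arrows_right_free e N.

(** Along the generators of J e_j, [sq l j] is exactly the part carried by those of index different
    from [l]; the generators of index [l] account for the rest. *)
Lemma arrows_left_free l j : l != j ->
  (\dim (blk l j) - \dim (sq l j) = \dim (blk l l) * mult l j)%N.
Proof.
move=> lj; pose V m := if m == l then 0%VS else blk l m.
have sqE : sq l j = (\sum_(p <- gens j) V p.1 * <[p.2]>)%VS.
  apply: subv_anti; apply/andP; split.
    apply/subv_sumP => m /andP[ml mj]; rewrite (blk_gens H mj) big_distrr /=.
    apply: subv_big_seq => p pg; rewrite prodvA.
    apply/subvP => x xP; apply: (memv_big_seq pg); apply: subvP xP.
    apply: prodvSl; rewrite /V; case: eqVneq => [->|_]; last exact: (prod_blk H).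
    by rewrite (blk_mul0 H) // eq_sym.
  apply: subv_big_seq => p /gensP[pj pb _].
  rewrite /V; case: eqVneq => [_|pl]; first by rewrite prod0v sub0v.
  by rewrite (sumv_sup p.1) ?pl // prodvSr // -memvE.
have Vp m : (V m <= pcol m)%VS.
  by rewrite /V; case: eqP => _; rewrite ?sub0v // (blk_pcol H).
rewrite sqE dim_gens_sum // (blk_gens H lj) dim_gens_sum => [|m]; last exact: (blk_pcol H).
have Vl : V l = 0%VS by rewrite /V eqxx.
rewrite (bigD1 l) //= [X in (_ - X)%N](bigD1 l) //= Vl dimv0 muln0 add0n.
have -> : (\sum_(m | m != l) mult m j * \dim (V m) = \sum_(m | m != l) mult m j * \dim (blk l m))%N.
  by apply: eq_bigr => m /negPf ml; rewrite /V ml.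
by rewrite addnK mulnC.
Qed.

Lemma rad_right_mul l j m : m != l -> m != j ->
  (N l * (blk l m * blk m j) <= blk l m * blk m j)%VS.
Proof.
move=> _ _; rewrite prodvA; apply: prodvSl.
exact: subv_trans (prodvSl _ (N_blk H l)) (prod_blk H l l m).
Qed.

(** The quotient of e_i A e_j by e_i (tr U j) has the dimension of the free right module over e_j A
    e_j on its top. Decomposed along [gens j], it is a sum of the same quotients at higher indices,
    to which the induction applies. *)
Lemma tr_right_free U i j :
  (\dim (blk i j) - \dim (<[e i]> * tr U j))%N =
  (\dim (blk j j) * (\dim (blk i j) - \dim (<[e i]> * tr U j + blk i j * N j)%VS))%N.
Proof.
have [n] := ubnP (\max_l h l - h j); elim: n i j => // n IHn i j; rewrite ltnS => hjn.
have BN : (blk i j * N j <= blk i j)%VS.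
  exact: subv_trans (prodvSr _ (N_blk H j)) (prod_blk H _ _ _).
have [Uj|Uj] := boolP (U j).
  by rewrite (tr_full H Uj) e_pcolE (addv_idPl BN) subnn muln0.
have [E|ij] := eqVneq i j.
  subst j; rewrite (e_tr0 H Uj) dimv0 subn0 add0v.
  have -> : (blk i i * N i = N i)%VS.
    apply/eqP; rewrite eqEsubv (ld_mull H) /=; apply/subvP => x xN.
    by rewrite -(blk_l H (subvP (N_blk H i) _ xN)) memv_mul ?(e_blk H).
  by rewrite (dim_N H) subSnn muln1.
set T := (<[e i]> * tr U j + blk i j * N j)%VS.
pose w l := (\dim (blk l j) - \dim (rad_r l j))%N.
pose del l := (\dim (blk i l) - \dim (<[e i]> * tr U l + blk i l * N l)%VS)%N.
(* By induction the generators of index [l] contribute [mult l j * dim (blk l l) * del l]. Left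
   freeness of e_l (J / J^2) e_j turns the first two factors into its dimension, and right freeness
   turns this into [dim (blk j j) * w l]. *)
have lhs : (\dim (blk i j) - \dim (<[e i]> * tr U j) =
    \dim (blk j j) * \sum_(l | l != j) w l * del l)%N.
  rewrite e_tr_gens // (dim_gens_sum j (V := fun l => (<[e i]> * tr U l)%VS)) => [|l]; last first.
    exact: subv_trans (e_tr_blk H _ _ _) (blk_pcol H _ _).
  rewrite {1}(blk_gens H ij) dim_gens_sum => [|l]; last exact: (blk_pcol H).
  rewrite -sumnB => [|l _]; last by rewrite leq_mul2l dimvS ?orbT // (e_tr_blk H).
  rewrite (bigD1 j) //= !mult_diag !mul0n subnn add0n big_distrr /=.
  apply: eq_bigr => l lj; rewrite -mulnBr mulnA -XR // arrows_left_free //.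
  have [m0|m0] := eqVneq (mult l j) 0%N; first by rewrite m0 muln0 mul0n.
  rewrite IHn; first by rewrite mulnA; congr (_ * _)%N; rewrite mulnC.
  have hl := mult_lt H m0; apply: leq_trans hjn; apply: ltn_sub2l => //.
  by apply: leq_trans hl _; apply: leq_bigmax.
have [b Nb] := N_nil H.
have eT : (T <= blk i j)%VS by rewrite subv_add (e_tr_blk H).
apply/eqP; rewrite eqn_leq; apply/andP; split; last first.
  rewrite lhs leq_mul2l; apply/orP; right; rewrite leq_subLR.
  (* Larger heights come first: [blk i l * sq l j] runs through lower indices, which stand later in
     the list and are already in [S] when [l] is added. *)
  pose s := sort (fun a b => h b <= h a)%N (enum L).
  pose S (t : seq L) : {vspace A} := (T + \sum_(l <- t | l != j) blk i l * blk l j)%VS.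
  have sS : sorted (fun a b => h b <= h a)%N s.
    by apply: sort_sorted => x y; apply: leq_total.
  have sQ l m : l \in s -> (h m < h l)%N -> m \in s by rewrite !mem_sort !mem_enum.
  have -> : (\sum_(l | l != j) w l * del l = \sum_(l <- s | l != j) w l * del l)%N.
    by rewrite [RHS](perm_big (enum L)) ?perm_sort //= [RHS]big_enum_cond.
  have sub : (blk i j <= S s)%VS.
    rewrite /S (big_rem i) ?mem_sort ?mem_enum //= ij.
    apply: subv_trans (addvSr _ _); apply: subv_trans (addvSl _ _).
    by apply/subvP => x xP; rewrite -(blk_l H xP) memv_mul ?(e_blk H).
  apply: leq_trans (dimvS sub) _; clear sub lhs.
  elim: s sS sQ => [|l s IHs] /=; first by rewrite /S !big_nil addv0 addn0.
  move=> ls sQ.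
  have tr_h : transitive (fun a b : L => h b <= h a)%N.
    by move=> x y z xy yz; apply: leq_trans yz xy.
  have ls' : {in s, forall m, (h m <= h l)%N} by apply/allP; apply: order_path_min ls.
  have {}IHs : (\dim (S s) <= \dim T + \sum_(l <- s | l != j) w l * del l)%N.
    apply: IHs; first exact: path_sorted ls.
    move=> l' m l's hm; have := sQ l' m; rewrite inE l's orbT => /(_ isT hm).
    by rewrite inE => /predU1P[ml|//]; have := ls' _ l's; rewrite -ml leqNgt hm.
  rewrite /S !big_cons; case: eqVneq => //= lj.
  have -> : (T + (blk i l * blk l j + \sum_(l <- s | l != j) blk i l * blk l j) =
     blk i l * blk l j + S s)%VS by rewrite /S addvA [(T + _)%VS]addvC -addvA.
  rewrite addnCA addnC; apply: leq_trans (leq_add IHs (leqnn _)); rewrite [X in (_ + X)%N]mulnC.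
  apply: (dim_prod_bound (N := N l) (n := b) (Kv := (<[e i]> * tr U l)%VS)) => //.
  - exact: (rad_r_blk H).
  - exact: subv_trans (prodvSl _ (N_blk H l)) (prod_blk H _ _ _).
  - rewrite prodvDr; apply: addvS.
      rewrite big_distrr /=; apply/subv_sumP => m /andP[ml mj].
      by rewrite (sumv_sup m) ?ml // rad_right_mul.
    rewrite prodvA; apply: prodvSl.
    exact: subv_trans (prodvSl _ (N_blk H l)) (prod_blk H _ _ _).
  - rewrite subv_add (e_tr_blk H); exact: subv_trans (prodvSr _ (N_blk H l)) (prod_blk H _ _ _).
  - apply: subv_trans (addvSl _ _); apply: subv_trans (addvSl _ _).
    rewrite !e_tr big_distrl /=; apply/subv_sumP => m Um; rewrite (sumv_sup m) //.
    by rewrite -prodvA prodvSr // (prod_blk H).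
  rewrite prodvDr subv_add; apply/andP; split.
    rewrite big_distrr /=; apply/subv_sumP => m /andP[ml mj].
    have [hml|hml] := boolP (h m < h l)%N; last first.
      by rewrite (blk0 H hml) 1?eq_sym // prod0v prodv0 sub0v.
    have ms : m \in s.
      by have := sQ l m; rewrite mem_head => /(_ isT hml); rewrite inE (negPf ml).
    apply: subv_trans (addvSr _ _); rewrite (big_rem m) //= mj.
    apply: subv_trans (addvSl _ _); rewrite prodvA prodvSl //; exact: (prod_blk H).
  apply: subv_trans (addvSl _ _); apply: subv_trans (addvSr _ _).
  rewrite prodvA prodvSl //; exact: (prod_blk H).
have BB : (blk i j * blk j j + <[e i]> * tr U j = blk i j)%VS.
  apply/eqP; rewrite eqEsubv subv_add (prod_blk H) (e_tr_blk H) /=.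
  apply: subv_trans (addvSl _ _); apply/subvP => x xP.
  by rewrite -(blk_r H xP) memv_mul ?(e_blk H).
(* The other inequality is general: the quotient is generated over e_j A e_j by lifts of its top. *)
have := @dim_prod_bound _ _ (N j) b (blk i j) T (<[e i]> * tr U j) (blk j j) 0 (<[e i]> * tr U j).
rewrite BB dimv0 subn0 leq_subLR mulnC; apply=> //.
- exact: sub0v.
- exact: subv_trans (prodvSl _ (N_blk H j)) (prod_blk H _ _ _).
- by rewrite prodv0 subvv.
- rewrite !e_tr big_distrl /=; apply/subv_sumP => m Um; rewrite (sumv_sup m) //.
  by rewrite -prodvA prodvSr // (prod_blk H).
- by rewrite prodv0 sub0v.
Qed.

Lemma dim_left_ideal_pcol j V : left_ideal V -> (V <= pcol j)%VS ->
  (\dim (pcol j) - \dim V = \sum_i (\dim (blk i j) - \dim (<[e i]> * V)))%N.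
Proof.
move=> lV Vp; rewrite (dim_pcol H) (dim_peircel H (U := V)) => [|i]; last first.
  exact: left_ideal_line.
by rewrite sumnB // => i _; apply: dimvS; rewrite -e_pcolE prodvSr.
Qed.

Let flag_arith k z w p q t m :
    (t <= z + (p - w) -> z <= k + m -> q <= w -> w <= p -> k + (p - q + m) <= t ->
  (k + m <= z /\ p - q <= p - w))%N.
Proof. lia. Qed.

(** * Proper standard filtrations of standard modules *)

Section ProperStandard.
Variables (r : rel L) (j : L).
Hypothesis rr : reflexive r.

Let Kj := std_ker e r j.
Let Pj := pstd_ker e N r j.
Let del := (\dim (pcol j) - \dim Pj)%N.

Let Kj_left : left_ideal Kj. Proof. exact: std_ker_left. Qed.
Let Kj_pcol : (Kj <= pcol j)%VS. Proof. exact: (std_ker_pcol H). Qed.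
Let Pj_pcol : (Pj <= pcol j)%VS. Proof. exact: (pstd_ker_pcol H). Qed.

(** Summed over the components, [tr_right_free] gives the standard module the dimension of
    [\dim (blk j j)] copies of the proper standard one. *)
Let dim_std : (\dim (pcol j) - \dim Kj = \dim (blk j j) * del)%N.
Proof.
rewrite /del !dim_left_ideal_pcol ?pstd_ker_left // big_distrr /=.
apply: eq_bigr => i _; by rewrite tr_right_free e_pstd_ker.
Qed.

Let Kj_mul W : (W <= blk j j)%VS -> (Kj * W <= Kj)%VS.
Proof.
move=> Wb; apply: subv_trans (prodvSr _ Wb) _; rewrite big_distrl /=.
apply/subv_sumP => i ai; rewrite -prodvA (sumv_sup i) // prodvSr //.
exact: (prod_blk H).
Qed.

Let flag_bound W : (W <= blk j j)%VS -> (N j * W <= W)%VS ->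
  (\dim (pcol j * W + Kj) <= \dim Kj + \dim W * del)%N.
Proof.
move=> Wb NW; have [b Nb] := N_nil H.
have := @dim_prod_bound _ _ (N j) b (pcol j) Pj Kj W 0 Kj.
rewrite dimv0 subn0 mulnC; apply=> //; rewrite ?sub0v ?prodv0 ?sub0v //.
exact: Kj_mul.
Qed.

(** An [N j]-stable flag in e_j A e_j with one-dimensional steps induces a flag in [A e_j / Kj]
    whose factors are quotients of the proper standard module, so of dimension at most [del]. The
    total dimension leaves no loss, so each factor is the proper standard module. *)
Let flag W : (W <= blk j j)%VS -> (N j * W <= W)%VS ->
  (\dim Kj + \dim W * del <= \dim (pcol j * W + Kj))%N ->
  left_filtered e (pstd_ker e N r) (pcol j * W + Kj) Kj.
Proof.
have [n] := ubnP (\dim W); elim: n W => // n IHn W; rewrite ltnS => dW Wb NW dE.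
have [->|W0] := eqVneq W 0%VS; first by rewrite prodv0 add0v; constructor.
have neNW : (N j * W)%VS != W.
  apply: contra W0 => /eqP NWE; have [b Nb] := N_nil H; rewrite -subv0.
  by apply: (nakayama (Nb j)); rewrite ?prodv0 ?subvv // addv0 NWE.
have [W1 [b [NW1 WE dW1]]] := hyperplane NW neNW.
have W1W : (W1 <= W)%VS by rewrite WE addvSr.
have W1b := subv_trans W1W Wb; have N1 := subv_trans (prodvSr (N j) W1W) NW1.
have bW : b \in W by rewrite WE (subvP (addvSl _ _)) ?memv_line.
have bb := subvP Wb _ bW.
pose Z := (pcol j * W1 + Kj)%VS.
have lZ : left_ideal Z by apply/left_ideal_add/Kj_left/left_ideal_prod/left_ideal_pcol.
have ZE : (pcol j * W + Kj = pcol j * <[b]> + Z)%VS by rewrite WE prodvDr addvA.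
pose W' := (pcol j :&: amulr b @^-1: Z)%VS.
have PW' : (Pj <= W')%VS.
  rewrite subv_cap Pj_pcol /=; apply/subvP => x xP; rewrite -memv_preim lfunE /=.
  have : x * b \in (Pj * <[b]>)%VS by rewrite memv_mul ?memv_line.
  apply/subvP; rewrite /Pj /pstd_ker prodvDl subv_add; apply/andP; split.
    by apply: subv_trans (addvSr _ _); apply: Kj_mul; rewrite -memvE.
  rewrite -prodvA; apply: subv_trans (addvSl _ _); apply: prodvSr.
  by apply: subv_trans NW1; apply: prodvSr; rewrite -memvE.
have fW : (amulr b @: W' <= Z)%VS.
  apply/subvP => _ /memv_imgP[x /memv_capP[_ xS] ->]; by rewrite memv_preim.
have W'p : (W' <= pcol j)%VS by apply: capvSl.
have := dim_img_quot W'p fW; rewrite limg_amulr -ZE => d1.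
have d2 := flag_bound W1b N1; rewrite -/Z in d2.
have d3 := dimvS PW'; have d4 := dimvS W'p.
have [E1 E2] : (\dim Kj + \dim W1 * del <= \dim Z)%N /\ (del <= \dim (pcol j) - \dim W')%N.
  by rewrite dW1 mulSn in dE; apply: flag_arith d1 d2 d3 d4 dE.
have WP : W' = Pj.
  apply/eqP; rewrite eq_sym eqEdim PW' /=.
  by rewrite -(leq_sub2lE _ d4).
apply: (LeftFilteredS (l := j) (W := Z)) => //; last first.
  by apply: IHn; rewrite // -ltnS -dW1.
exists b; split; first exact: (blk_l H bb).
  rewrite ZE; congr (_ + _)%VS; rewrite -[pcol j]/({:A} * <[e j]>)%VS -prodvA prodv_line.
  by rewrite (blk_l H bb).
move=> a; have -> : a * b = (a * e j) * b by rewrite -mulrA (blk_l H bb).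
by rewrite -/Pj -WP memv_cap -memv_preim lfunE /= memv_mul ?memvf ?memv_line.
Qed.

Lemma std_left_filtered :
  left_filtered e (pstd_ker e N r) (pcol j) (tr (above r j) j).
Proof.
have pE : (pcol j * blk j j + Kj = pcol j)%VS.
  apply/eqP; rewrite eqEsubv subv_add (prod_pcol_blk H) Kj_pcol /=.
  apply: subv_trans (addvSl _ _); apply/subvP => x xp.
  by rewrite -(pcolP H _ _ xp) memv_mul ?(e_blk H).
rewrite -[X in left_filtered _ _ X _]pE; apply: flag => //.
  exact: subv_trans (prodvSl _ (N_blk H j)) (prod_blk H _ _ _).
by rewrite pE -dim_std subnKC // dimvS.
Qed.

End ProperStandard.

Lemma properly_stratified_all r : linear_order r -> properly_stratified e r.
Proof.
move=> lr; have rr : reflexive r by case: lr.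
split; first exact: standardly_stratified_all.
apply: (filtration_reg lr (Kl := pstd_ker e N r)).
  by move=> l D /(is_proper_standard_gen H l D rr).
by move=> j; apply: std_left_filtered.
Qed.

End Projective.

(** * Stratification for all orders as a numerical condition *)

Section Characterisation.
Variables (K : fieldType) (A : falgType K) (L : finType) (e : L -> A).
Variables (N : L -> {vspace A}) (h : L -> nat).
Hypothesis H : local_directed e N h.

Lemma standardly_stratified_iff :
  (forall r, linear_order r -> standardly_stratified e r) <-> offdiag_projective e N.
Proof.
split; first exact: strat_offdiag_projective H.
by move=> P r; apply: standardly_stratified_all H P r.
Qed.

Lemma properly_stratified_iff :
  (forall r, linear_order r -> properly_stratified e r) <->
  offdiag_projective e N /\ arrows_right_free e N.
Proof.
split=> [strat|[P XR] r lr]; last exact: (properly_stratified_all H P XR).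
split; last exact: strat_arrows_right_free H _.
by apply/standardly_stratified_iff => r /strat [].
Qed.

End Characterisation.

(** * Primitive idempotents over a closed field *)

Section LocalAlgebra.
Variables (K : closedFieldType) (B : falgType K).

Let nil (x : B) := exists n, x ^+ n = 0.

Let nil_fix (t v : B) : nil t -> v = t * v -> v = 0.
Proof.
case=> n tn vE; suff -> : v = t ^+ n * v by rewrite tn mul0r.
by elim: n {tn} => [|n IHn]; rewrite ?expr0 ?mul1r // exprS -mulrA -IHn.
Qed.

Let nil_fixr (t v : B) : nil t -> v = v * t -> v = 0.
Proof.
case=> n tn vE; suff -> : v = v * t ^+ n by rewrite tn mulr0.
by elim: n {tn} => [|n IHn]; rewrite ?expr0 ?mulr1 // exprSr mulrA -IHn.
Qed.

Let nil_min (x : B) : nil x -> exists2 v, v != 0 & x * v = 0 /\ v * x = 0.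
Proof.
case=> n; elim: n => [|n IHn]; first by rewrite expr0 => /eqP; rewrite oner_eq0.
have [/IHn //|n0 xn] := eqVneq (x ^+ n) 0.
by exists (x ^+ n) => //; rewrite -exprS -exprSr.
Qed.

Let nilZ c (x : B) : nil x -> nil (c *: x).
Proof. by case=> n xn; exists n; rewrite exprZn xn scaler0. Qed.

Hypothesis prim : forall f g : B, f * f = f -> g * g = g -> f * g = 0 -> g * f = 0 ->
  1 = f + g -> f = 0 \/ g = 0.

(** A Bezout relation turns a coprime factorisation of a polynomial killing [x] into two orthogonal
    idempotents with sum 1; primitivity makes one of them vanish. *)
Let horner_split (x : B) (q s : {poly K}) : coprimep q s -> horner_alg x (q * s) = 0 ->
  horner_alg x q = 0 \/ horner_alg x s = 0.
Proof.
move=> /Bezout_eq1_coprimepP[[u v] /= uv] qs0.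
have [ev [evE evM evD ev1]] : exists ev : {poly K} -> B, [/\ ev =1 horner_alg x,
    forall a b, ev (a * b) = ev a * ev b, forall a b, ev (a + b) = ev a + ev b & ev 1 = 1].
  by exists (horner_alg x); split=> // [a b|a b|]; rewrite ?rmorphM ?rmorphD ?rmorph1.
rewrite -!evE in qs0 *.
have q0 : ev (u * q) * ev (v * s) = 0 by rewrite -evM mulrACA evM qs0 mulr0.
have q0' : ev (v * s) * ev (u * q) = 0 by rewrite -evM mulrC evM.
have fg : 1 = ev (u * q) + ev (v * s) by rewrite -evD uv ev1.
have ff : ev (u * q) * ev (u * q) = ev (u * q).
  by rewrite -[RHS]mulr1 fg mulrDr q0 addr0.
have gg : ev (v * s) * ev (v * s) = ev (v * s).
  by rewrite -[RHS]mulr1 fg mulrDr q0' add0r.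
case: (prim ff gg q0 q0' fg) => [f0|g0]; [left | right].
  by rewrite -[LHS]mulr1 fg f0 add0r -evM mulrCA evM qs0 mulr0.
by rewrite -[LHS]mulr1 fg g0 addr0 -evM mulrCA [s * q]mulrC evM qs0 mulr0.
Qed.

(** For reasons of dimension a nonzero polynomial kills [x]. With the full power of [X - c] split
    off for a root [c], either this power kills [x], or the cofactor does and has smaller degree. *)
Let nil_root (x : B) : exists c, nil (x - c%:A).
Proof.
have [p p0 px] : exists2 p : {poly K}, p != 0 & horner_alg x p = 0.
  pose g (v : 'rV[K]_(\dim {:B}).+1) : B := horner_alg x (rVpoly v).
  have g_lin : linear g.
    move=> c u v; rewrite /g linearP /= rmorphD -mul_polyC rmorphM /= horner_algC.
    by rewrite mulr_algl.
  pose f : 'Hom('rV[K]_(\dim {:B}).+1, B) := lfun_of g_lin.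
  have : lker f != 0%VS.
    apply/eqP => f0; have := limg_ker_dim f fullv; rewrite capfv f0 dimv0 add0n.
    have d2 : \dim (fullv : {vspace 'rV[K]_(\dim {:B}).+1}) = (\dim {:B}).+1.
      by rewrite [LHS]dimvf [LHS]dim_matrix; apply: mul1n.
    by rewrite d2 => E; have := dimvS (subvf (limg f)); rewrite E ltnn.
  rewrite -vpick0 => v0; exists (rVpoly (vpick (lker f))).
    by apply: contraNneq v0 => r0; rewrite -[vpick _]rVpolyK r0 linear0.
  by have := memv_pick (lker f); rewrite memv_ker lfun_ofE => /eqP.
have [n] := ubnP (size p); elim: n p p0 px => // n IHn p p0 px; rewrite ltnS => sp.
have sp1 : size p != 1%N.
  apply: contraNneq p0 => /eqP/size_poly1P[c c0 pE].
  by move: px; rewrite pE horner_algC; move/eqP; rewrite scaler_eq0 oner_eq0 orbF (negPf c0).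
have /closed_rootP[c rc] := sp1.
have [m [q nq pE]] := multiplicity_XsubC p c.
rewrite p0 /= in nq; rewrite pE mulrC in px.
have cop : coprimep (('X - c%:P) ^+ m) q.
  by apply: coprimep_expl; rewrite coprimep_sym coprimep_XsubC.
have evc : horner_alg x (('X - c%:P) ^+ m) = (x - c%:A) ^+ m.
  by rewrite rmorphXn rmorphB /= horner_algX horner_algC.
have [|qx] := horner_split cop px; first by rewrite evc => xm; exists c, m.
have q0 : q != 0 by apply: contraNneq p0 => q0; rewrite pE q0 mul0r.
apply: (IHn q) => //; apply: leq_trans sp.
have m0 : (0 < m)%N.
  by rewrite lt0n; apply: contraNneq nq => m0; rewrite pE m0 expr0 mulr1 in rc.
by rewrite pE size_Mmonic ?monicXn ?monic_exp ?monicXsubC // size_exp_XsubC addnS /= -[X in (X < _)%N]addn0 ltn_add2l.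
Qed.

(** Some [z * y - c] with scalar [c] is nilpotent. A nonzero [v] with [y * v = 0] is killed by
    [z * y], so a nonzero [c] would make [v] a fixed vector of a nilpotent multiplication. *)
Let nil_mull (z y : B) : nil y -> nil (z * y).
Proof.
move=> ny; have [c [m cm]] := nil_root (z * y).
have [c0|c0] := eqVneq c 0; first by exists m; rewrite c0 scale0r subr0 in cm.
have [v v0 [yv _]] := nil_min ny.
case/eqP: v0; apply: (@nil_fix (- c^-1 *: (z * y - c%:A))).
  by apply: nilZ; exists m.
rewrite -scalerAl mulrBl -mulrA yv mulr0 sub0r scalerN scaleNr opprK.
by rewrite -scalerAl mul1r scalerA mulVf // scale1r.
Qed.

Let nil_mulr (y z : B) : nil y -> nil (y * z).
Proof.
move=> ny; have [c [m cm]] := nil_root (y * z).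
have [c0|c0] := eqVneq c 0; first by exists m; rewrite c0 scale0r subr0 in cm.
have [v v0 [_ vy]] := nil_min ny.
case/eqP: v0; apply: (@nil_fixr (- c^-1 *: (y * z - c%:A))).
  by apply: nilZ; exists m.
rewrite -scalerAr mulrBr mulrA vy mul0r sub0r scalerN scaleNr opprK.
by rewrite -scalerAr mulr1 scalerA mulVf // scale1r.
Qed.

Let nil_not_unit (c : K) : c != 0 -> ~ nil c%:A.
Proof.
move=> c0 [n /eqP]; rewrite exprZn expr1n scaler_eq0 oner_eq0 orbF.
by rewrite expf_eq0 (negPf c0) andbF.
Qed.

(** If the eigenvalue of [x + y] were nonzero, multiplication by [x + y] would be bijective and
    [1 = x * w + y * w] for some [w]. A nonzero [v] with [v * (y * w) = 0] would satisfy
    [v = v * (x * w)], although [x * w] is nilpotent. *)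
Let nilD (x y : B) : nil x -> nil y -> nil (x + y).
Proof.
move=> nx ny; have [c [m cm]] := nil_root (x + y).
have [c0|c0] := eqVneq c 0; first by exists m; rewrite c0 scale0r subr0 in cm.
have ker0 : lker (amull (x + y)) == 0%VS.
  rewrite -subv0; apply/subvP => v; rewrite memv_ker lfunE /= => /eqP sv.
  rewrite memv0; apply/eqP; apply: (@nil_fix (- c^-1 *: (x + y - c%:A))).
    by apply: nilZ; exists m.
  rewrite -scalerAl mulrBl sv sub0r scalerN scaleNr opprK.
  by rewrite -scalerAl mul1r scalerA mulVf // scale1r.
have : 1 \in limg (amull (x + y)) by rewrite (lker0_limgf ker0) memvf.
move=> /memv_imgP[w _]; rewrite lfunE /= mulrDl => E.
have [v v0 [_ vy]] := nil_min (nil_mulr w ny).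
case/eqP: v0; apply: (nil_fixr (nil_mulr w nx)).
by rewrite -{1}[v]mulr1 E mulrDr vy addr0.
Qed.

(** The nilpotent elements form an ideal complementary to the scalars, spanned by the basis vectors
    minus their eigenvalues. It is nilpotent because its stable power is an idempotent ideal that
    annihilates every left ideal. *)
Lemma local_algebra : exists N : {vspace B},
  [/\ fullv = (<[1%R]> + N)%VS, 1 \notin N, ({:B} * N <= N)%VS, (N * {:B} <= N)%VS
    & exists n, (N ^+ n = 0)%VS].
Proof.
have /fin_all_exists[c cP] (j : 'I_(\dim {:B})) : exists d, nil ((vbasis {:B})`_j - d%:A).
  exact: nil_root.
pose N : {vspace B} := (\sum_(j < \dim {:B}) <[(vbasis {:B})`_j - (c j)%:A]>)%VS.
have N_nil x : x \in N -> nil x.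
  move=> /memv_sumP[v vP ->]; elim/big_rec: _ => [|j y _ ny].
    by exists 1%N; rewrite expr1.
  by apply: nilD => //; have /vlineP[d ->] := vP j isT; apply: nilZ.
have NE : fullv = (<[1%R]> + N)%VS.
  apply/esym/eqP; rewrite eqEsubv subvf /=; apply/subvP => x xf.
  rewrite (coord_vbasis xf); apply: memv_suml => j _; apply: memvZ.
  rewrite -[_`_j](subrK (c j)%:A) addrC memv_add ?memvZ ?memv_line //.
  by rewrite memvE (sumv_sup j).
have nil_N x : nil x -> x \in N.
  move=> nx; have : x \in (<[1%R]> + N)%VS by rewrite -NE memvf.
  move=> /memv_addP[_ /vlineP[d ->] [n nN xE]].
  have [d0|d0] := eqVneq d 0; first by rewrite xE d0 scale0r add0r.
  case: (nil_not_unit d0); have -> : d%:A = x + -1 *: n by rewrite xE scaleN1r addrK.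
  by apply: nilD => //; apply: nilZ; apply: N_nil.
have one_N : 1 \notin N.
  by apply/negP => /N_nil; rewrite -[1]scale1r; apply/nil_not_unit/oner_neq0.
have lN : ({:B} * N <= N)%VS.
  by apply/prodvP => x y _ yN; apply/nil_N/nil_mull/N_nil.
have rN : (N * {:B} <= N)%VS.
  by apply/prodvP => x y xN _; apply/nil_N/nil_mulr/N_nil.
exists N; split=> //.
have [m mE] : exists m, (N ^+ m.+1 = N ^+ m.+2)%VS.
  have dec m : (N ^+ m.+2 <= N ^+ m.+1)%VS.
    by rewrite expvSr; apply: subv_trans (prodvSr _ (subvf _)) _; rewrite expvSr -prodvA prodvSr.
  have [d] := ubnP (\dim (N ^+ 1)%VS); move: (0%N) => m.
  elim: d m => // d IHd m; rewrite ltnS => dm.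
  have [E|ne] := eqVneq (N ^+ m.+1)%VS (N ^+ m.+2)%VS; first by exists m.
  apply: (IHd m.+1); apply: leq_trans dm; rewrite ltn_neqAle dimvS // andbT.
  by apply: contra ne => /eqP E; rewrite eq_sym eqEdim dec E leqnn.
pose I := (N ^+ m.+1)%VS.
have IN : (N * I = I)%VS by rewrite /I -expvSl -mE.
have II : (I * I = I)%VS.
  have NkI k : (N ^+ k * I = I)%VS.
    by elim: k => [|k IHk]; rewrite ?expv0 ?prod1v // expvSl -prodvA IHk.
  exact: NkI.
have IsN : (I <= N)%VS.
  by rewrite /I expvSl; apply: subv_trans (prodvSr _ (subvf _)) rN.
have lI Y : ({:B} * (I * Y) <= I * Y)%VS.
  rewrite prodvA prodvSl // /I expvSl prodvA prodvSl //.
(* For [y] in [Y] there are two cases. If [y] lies in [I y], then [y = t y] with [t] nilpotent, so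
   [y = 0]. Otherwise [I y] is a smaller left ideal, killed by [I] by induction, and
   [I y = I I y = 0]. *)
have kill Y : ({:B} * Y <= Y)%VS -> (I * Y = 0)%VS.
  have [d] := ubnP (\dim Y); elim: d Y => // d IHd Y; rewrite ltnS => dY lY.
  apply/eqP; rewrite -subv0; apply/prodvP => z y zI yY.
  have IyY : (I * <[y]> <= Y)%VS.
    by apply: subv_trans lY; apply: prodvS (subvf _) _; rewrite -memvE.
  have [yI|yI] := boolP (y \in (I * <[y]>)%VS).
    have /memv_cosetP[t tI yE] := yI.
    by rewrite (nil_fix (N_nil _ (subvP IsN _ tI)) yE) mulr0 mem0v.
  have <- : (I * (I * <[y]>) = 0)%VS.
    apply: IHd (lI _); apply: leq_trans dY; rewrite ltn_neqAle dimvS // andbT.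
    apply: contra yI => /eqP E; suff -> : (I * <[y]> = Y)%VS by [].
    by apply/eqP; rewrite eqEdim IyY E leqnn.
  by rewrite prodvA II memv_mul ?memv_line.
exists m.+1; apply/eqP; rewrite -subv0 -(kill fullv) ?subvf //.
by apply/subvP => x xI; rewrite -[x]mulr1 memv_mul ?memvf.
Qed.

End LocalAlgebra.

Section CompletePrimitive.
Variables (K : closedFieldType) (A : falgType K) (L : finType) (e : L -> A).
Hypothesis he : complete_primitive e.

Let e_idem i : e i * e i = e i. Proof. by have [/(_ i)[]] := he. Qed.

Lemma local_block i : exists N : {vspace A},
  [/\ blk e i i = (<[e i]> + N)%VS, e i \notin N, (blk e i i * N <= N)%VS,
      (N * blk e i i <= N)%VS & exists n, (N ^+ n = 0)%VS].
Proof.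
pose U := blk e i i.
have ei : e i \in U by apply/(cat_homP he); rewrite !e_idem.
have ei0 : e i != 0 by have [/(_ i)[]] := he.
have Ul x : x \in U -> e i * x = x by move=> /(cat_homP he) ->; rewrite !mulrA e_idem.
have Ur x : x \in U -> x * e i = x by move=> /(cat_homP he) ->; rewrite -!mulrA e_idem.
have aU : is_aspace U.
  apply/andP; split; last by apply/prodvP => x y; apply: (cat_homM he).
  by apply/has_algidP; exists (e i); split=> // x xU; rewrite Ul ?Ur.
pose D : {aspace A} := ASpace aU.
have algE : algid D = e i by rewrite -(Ul _ (memv_algid D)) algidr.
pose v : 'Hom(subvs_of D, A) := linfun (@vsval K A D).
have vE x : v x = vsval x by rewrite lfunE.
have [f g ff gg fg gf E|N [NE N1 lN rN [n Nn]]] := @local_algebra K (subvs_of D).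
  have [_ _ prim] : primitive_idempotent (e i) by have [/(_ i)] := he.
  have [f0|g0] := prim (vsval f) (vsval g) (congr1 vsval ff) (congr1 vsval gg)
    (congr1 vsval fg) (congr1 vsval gf) (etrans (esym algE) (congr1 vsval E)).
    by left; apply: subvs_inj.
  by right; apply: subvs_inj.
have vfull : limg v = U by exact: limg_vsval.
have vM (V W : {vspace subvs_of D}) : (v @: V * v @: W <= v @: (V * W))%VS.
  apply/prodvP => _ _ /memv_imgP[x xV ->] /memv_imgP[y yW ->].
  by rewrite !vE -[_ * _]/(vsval (x * y)) -vE memv_img ?memv_mul.
exists (v @: N)%VS; split.
- by rewrite -[blk e i i]/U -vfull NE limgD limg_line vE -algE.
- apply: contra N1 => /memv_imgP[x xN E].
  suff -> : 1 = x by [].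
  by apply: subvs_inj; rewrite -[RHS]vE -E -algE.
- by rewrite -[blk e i i]/U -vfull; apply: subv_trans (vM _ _) (limgS _ lN).
- by rewrite -[blk e i i]/U -vfull; apply: subv_trans (vM _ _) (limgS _ rN).
exists n.+1; apply/eqP; rewrite -subv0.
suff: ((v @: N) ^+ n.+1 <= v @: (N ^+ n.+1))%VS.
  by rewrite [(N ^+ n.+1)%VS]expvSl Nn prodv0 limg0.
elim: n {Nn} => [|n IHn]; first by rewrite !expv1.
by rewrite expvSl [X in (_ <= _ @: X)%VS]expvSl; apply: subv_trans (prodvSr _ IHn) (vM _ _).
Qed.

(** The height of [i] is the number of indices below [i] in the given partial order; antisymmetry
    makes it strictly increasing. *)
Lemma complete_primitive_local : directed e ->
  exists N h, local_directed e N h.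
Proof.
case=> r [rr ra rt rd].
have /fin_all_exists[N NP] := local_block.
have [_ orth sum1] := he.
exists N, (fun i => #|[pred m | r m i]|); split=> //.
- move=> i j ij b0; have rji : r j i by apply: rd; rewrite -/(blk e i j).
  apply/proper_card/properP; split.
    by apply/subsetP => m; rewrite !inE => /rt; apply.
  exists i; rewrite inE ?rr //; apply: contra ij => rij; apply/eqP/ra.
  by rewrite rij.
- by move=> i; have [] := NP i.
- by move=> i; have [] := NP i.
- by move=> i; have [] := NP i.
- by move=> i; have [] := NP i.
have /fin_all_exists[n nP] : forall i, exists n, (N i ^+ n = 0)%VS by move=> i; have [] := NP i.
exists (\max_i n i) => i; have le : (n i <= \max_i n i)%N by apply: leq_bigmax.
by rewrite -(subnK le) expvD nP prodv0.
Qed.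

End CompletePrimitive.

(** * The associated graded algebra *)

Section Graded.
Variables (K : fieldType) (A : falgType K) (L : finType) (e : L -> A).
Variables (he : complete_primitive e) (hd : directed e).
Variables (N : L -> {vspace A}) (h : L -> nat).
Hypothesis H : local_directed e N h.

Local Notation J := (offdiag_ideal he hd).
Local Notation B := (assoc_graded he hd).
Local Notation eB := (assoc_graded_idem he hd).
Local Notation cls := (gr_cls J).
Local Notation bound := (gr_bound A).

Definition jpow n i j : {vspace A} := (<[e i]> * ipow J n * <[e j]>)%VS.

Lemma jpow_blk n i j : (jpow n i j <= blk e i j)%VS.
Proof. by rewrite prodvSl // prodvSr // subvf. Qed.

Lemma jpow_ipow n i j : (jpow n i j <= ipow J n)%VS.
Proof.
have mulr : (ipow J n * {:A} <= ipow J n)%VS.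
  have := ipowD J n 0; by rewrite addn0.
apply: subv_trans mulr; apply: prodvS (subvf _).
by apply: subv_trans (ipow_mull J n); apply: prodvSl (subvf _).
Qed.

Lemma mem_jpow n i j x : x \in ipow J n -> x \in blk e i j -> x \in jpow n i j.
Proof. by move=> xn /(blkP H) <-; rewrite !memv_mul ?memv_line. Qed.

Lemma mem_jpowE n i j x : (x \in jpow n i j) = (x \in ipow J n) && (x \in blk e i j).
Proof.
apply/idP/andP => [xj|[]]; last exact: mem_jpow.
by rewrite (subvP (jpow_ipow _ _ _) _ xj) (subvP (jpow_blk _ _ _) _ xj).
Qed.

Lemma jpow0 i j : jpow 0 i j = blk e i j.
Proof. by []. Qed.

Lemma ipow1 : ipow J 1 = (\sum_j \sum_(i | i != j) blk e i j)%VS.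
Proof. by rewrite /ipow expv1. Qed.

Lemma jpow1 i j : jpow 1 i j = if i == j then 0%VS else blk e i j.
Proof.
apply/vspaceP => x; rewrite mem_jpowE ipow1; case: eqVneq => [<-|ij]; last first.
  apply/andb_idl => xb; rewrite memvE (sumv_sup j) // (sumv_sup i) // -memvE.
apply/idP/idP => [/andP[]|]; last first.
  by rewrite memv0 => /eqP ->; rewrite !mem0v.
move=> /memv_sumP[y yP ->]; rewrite memv0 => /(blkP H) <-.
rewrite mulr_sumr mulr_suml big1 ?eqxx // => l _.
have /memv_sumP[z zP ->] := yP l isT; rewrite mulr_sumr mulr_suml big1 // => m ml.
rewrite -(blk_l H (zP m ml)) -(blk_r H (zP m ml)).
have [im|im] := eqVneq i m; last first.
  by rewrite !mulrA (ld_orth H im) !mul0r.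
by rewrite -!mulrA (ld_orth H (i := l)) ?mulr0 // -1?im eq_sym im.
Qed.

Lemma jpowS n i j : jpow n.+1 i j = (\sum_(m | m != i) blk e i m * jpow n m j)%VS.
Proof.
apply: subv_anti; apply/andP; split; last first.
  apply/subv_sumP => m mi; apply/prodvP => x y xb.
  rewrite mem_jpowE => /andP[yn yb]; apply: mem_jpow; last exact: (blkM H xb yb).
  have : x \in jpow 1 i m by rewrite jpow1 eq_sym (negPf mi).
  rewrite mem_jpowE => /andP[x1 _]; exact: (memv_ipowM x1 yn).
rewrite /jpow ipowSl prodvA -[X in (X <= _)%VS]prodvA; apply/prodvP => x y xP yP.
have eix := e_line_left H xP.
have yj : y * e j = y by move: yP => /memv_cosetP[z _ ->]; rewrite -mulrA (ld_idem H).
rewrite [y](peirce_sum H) mulr_sumr (bigD1 i) //=.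
have x1 : x \in ipow J 1.
  apply: (subvP (ipow_mull J 1)); have -> : ipow J 1 = J :> {vspace A} by rewrite /ipow expv1.
  by apply: subvP xP; apply: prodvSl (subvf _).
have yn : y \in ipow J n.
  have := ipowD J n 0; rewrite addn0 => /subvP; apply.
  by apply: subvP yP; apply: prodvSr (subvf _).
have term m : x * (e m * y) = x * e m * (e m * y) by rewrite -[RHS]mulrA [X in _ = x * X]mulrA (ld_idem H).
have xm m : x * e m \in jpow 1 i m.
  by rewrite -eix mem_jpow ?mem_blk // eix; have /subvP := ipowD J 1 0; apply; rewrite memv_mul ?memvf.
have -> : x * (e i * y) = 0.
  have /eqP xi0 : x * e i == 0 by have := xm i; rewrite jpow1 eqxx memv0.
  by rewrite term xi0 mul0r.
rewrite add0r; apply: memv_sumr => m mi; rewrite term memv_mul //.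
  by have := xm m; rewrite jpow1 eq_sym (negPf mi).
rewrite mem_jpow //; first by have /subvP := ipow_mull J n; apply; rewrite memv_mul ?memvf.
by rewrite -yj mulrA mem_blk.
Qed.

Lemma jpow2 i j : i != j -> jpow 2 i j = sq e i j.
Proof.
move=> ij; rewrite jpowS /sq (bigID (fun m => m == j)) /=.
rewrite big1 ?add0v => [|m /andP[_ /eqP ->]]; last by rewrite jpow1 eqxx prodv0.
by apply: eq_bigr => m /andP[_ /negPf mj]; rewrite jpow1 mj.
Qed.

Lemma jpow_diag n i : jpow n.+1 i i = 0%VS.
Proof.
rewrite jpowS big1 // => m mi; apply/eqP; rewrite -subv0 -(blk_mul0 H (i := i) (j := m)) 1?eq_sym //.
exact/prodvSr/jpow_blk.
Qed.

(** Every factor from [J] raises the height by at least one. *)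
Lemma jpow_height n i j : jpow n i j != 0%VS -> (h j + n <= h i)%N.
Proof.
elim: n i => [|n IHn] i.
  rewrite jpow0 addn0; have [->//|ij] := eqVneq i j.
  by move=> /(ld_dir H ij)/ltnW.
apply: contraR; rewrite -ltnNge => hij; rewrite jpowS big1 // => m mi.
have [hmi|hmi] := boolP (h m < h i)%N; last by rewrite (blk0 H hmi) 1?eq_sym // prod0v.
suff -> : jpow n m j = 0%VS by rewrite prodv0.
apply/eqP; apply: contraTT hij => /IHn hmj; rewrite -leqNgt addnS.
exact: leq_trans hmi.
Qed.

(** Bounded heights make some power of [J] zero, and by [ipow_stable] the powers are constant from
    the exponent [\dim {:A}] on. *)
Lemma ipow_nil n : (\dim {:A} <= n)%N -> ipow J n = 0%VS.
Proof.
move=> dn; have [m mn m0] : exists2 m, (n <= m)%N & ipow J m = 0%VS.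
  exists (n + (\max_i h i).+1)%N; first exact: leq_addr.
  apply/eqP; rewrite -subv0; apply/subvP => x xm; rewrite memv0.
  rewrite [x](peirce_sum H) big1 // => i _; rewrite [_ * x](peirce_sumr H) big1 // => j _.
  apply/eqP; rewrite -memv0; have xj : e i * x * e j \in jpow (n + (\max_i h i).+1) i j.
    by rewrite !memv_mul ?memv_line.
  have [<-//|/jpow_height] := eqVneq (jpow (n + (\max_i h i).+1) i j) 0%VS.
  rewrite addnCA addnA => hh; have := leq_bigmax (F := h) i.
  by rewrite leqNgt; case/negP; apply: leq_trans hh; rewrite addnS ltnS leq_addl.
rewrite -m0; elim: m mn {m0} => [|m IHm]; first by rewrite leqn0 => /eqP ->.
rewrite leq_eqVlt => /predU1P[-> //|]; rewrite ltnS => nm.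
by rewrite IHm // ipow_stable // (leq_trans dn).
Qed.

(** The Peirce component at [i], [j] of the ideal of degrees at least [m] in the graded algebra.
    General [m] serves the recursion [gsum_rec], which compares it with e_i J^m e_j. *)
Definition gsum m i j : {vspace B} := (\sum_(n < bound | (m <= n)%N) cls n @: jpow n i j)%VS.

Lemma cls_big n x : (bound <= n)%N -> cls n x = 0.
Proof.
move=> bn; apply: gr_eqP => q; rewrite gr_clsE ltn_eqF ?(leq_trans (ltn_ord q)) //.
by rewrite /gr_coef ffunE.
Qed.

Lemma mem_gsum m n i j x : x \in jpow n i j -> (m <= n)%N -> cls n x \in gsum m i j.
Proof.
move=> xj mn; have [nb|nb] := ltnP n bound; last by rewrite cls_big ?mem0v.
by rewrite memvE (sumv_sup (Ordinal nb)) //= -memvE memv_img.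
Qed.

Lemma gsum_sub m i j (V : {vspace B}) :
  (forall n x, (m <= n)%N -> x \in jpow n i j -> cls n x \in V) -> (gsum m i j <= V)%VS.
Proof.
move=> nV; apply/subv_sumP => n mn; apply/subvP => _ /memv_imgP[x xj ->].
exact: nV.
Qed.

Lemma clsM a b x y : x \in ipow J a -> y \in ipow J b -> cls a x * cls b y = cls (a + b) (x * y).
Proof. exact: gr_clsM. Qed.

Lemma blk_gr i j : blk eB i j = gsum 0 i j.
Proof.
apply: subv_anti; apply/andP; split.
  apply/subvP => _ /memv_cosetP[u + ->]; rewrite -limg_amull => /memv_imgP[f _ ->].
  rewrite lfunE /= [f]gr_decomp mulr_sumr mulr_suml; apply: memv_suml => n _.
  have cn := gr_coef_ipow f n.
  rewrite /assoc_graded_idem clsM ?memvf // clsM ?memvf //; last first.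
    by apply: (memv_ipowM (i := 0)) cn; rewrite memvf.
  rewrite addn0 add0n; apply: mem_gsum => //.
  by rewrite !memv_mul ?memv_line.
apply: gsum_sub => n x _ xj; have xn := subvP (jpow_ipow n i j) _ xj.
have /(blkP H) <- := subvP (jpow_blk n i j) _ xj.
have -> : cls n (e i * x * e j) = eB i * cls n x * eB j.
  rewrite /assoc_graded_idem clsM ?memvf // clsM ?memvf ?addn0 //.
  by apply: (memv_ipowM (i := 0)) xn; rewrite memvf.
by rewrite !memv_mul ?memv_line ?memvf.
Qed.

Lemma cls_lower n x : x \in ipow J n.+1 -> cls n x = 0.
Proof.
move=> xn; apply/eqP; rewrite gr_cls_eq0 //; exact: (subvP (ipowS J n)).
Qed.

Lemma gsum_diag i : gsum 0 i i = (cls 0 @: blk e i i)%VS.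
Proof.
apply: subv_anti; apply/andP; split; last first.
  by apply/subvP => _ /memv_imgP[x xb ->]; apply: mem_gsum.
apply: gsum_sub => [[|n] x _ xj]; first exact: memv_img.
by move: xj; rewrite jpow_diag memv0 => /eqP ->; rewrite linear0 mem0v.
Qed.

Lemma cls0_inj i x : x \in blk e i i -> cls 0 x = 0 -> x = 0.
Proof.
move=> xb /eqP; rewrite gr_cls_eq0 ?memvf // => x1; apply/eqP; rewrite -memv0.
by have := mem_jpow x1 xb; rewrite jpow1 eqxx.
Qed.

Lemma cls_prod a b (V W : {vspace A}) : (V <= ipow J a)%VS -> (W <= ipow J b)%VS ->
  (cls a @: V * cls b @: W = cls (a + b) @: (V * W))%VS.
Proof.
move=> /subvP Va /subvP Wb; apply: subv_anti; apply/andP; split.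
  apply/prodvP => _ _ /memv_imgP[x xV ->] /memv_imgP[y yW ->].
  by rewrite clsM ?Va ?Wb // memv_img // memv_mul.
apply/subvP => _ /memv_imgP[z zVW ->].
suff /subvP/(_ _ zVW) : (V * W <= cls (a + b) @^-1: (cls a @: V * cls b @: W))%VS.
  by rewrite -memv_preim.
apply/prodvP => x y xV yW; rewrite -memv_preim -clsM ?Va ?Wb //.
by rewrite memv_mul // memv_img.
Qed.

Lemma cls0_prod (V W : {vspace A}) : (cls 0 @: V * cls 0 @: W = cls 0 @: (V * W))%VS.
Proof. by rewrite cls_prod ?subvf. Qed.

Definition NB i : {vspace B} := (cls 0 @: N i)%VS.

(** Since e_i J^n e_i is zero for n > 0, the local algebras e_i A e_i reappear unchanged in degree
    0, and the same heights work. *)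
Lemma graded_local : local_directed eB NB h.
Proof.
split.
- by move=> i; rewrite /assoc_graded_idem clsM ?memvf // (ld_idem H).
- by move=> i j ij; rewrite /assoc_graded_idem clsM ?memvf // (ld_orth H) // linear0.
- by rewrite /assoc_graded_idem -linear_sum (ld_sum H); apply/esym/gr_one_cls.
- move=> i j ij b0; apply: (ld_dir H) => //; apply: contraNneq b0 => b0.
  rewrite blk_gr -subv0; apply: gsum_sub => n x _ /(subvP (jpow_blk _ _ _)).
  by rewrite b0 memv0 => /eqP ->; rewrite linear0 mem0v.
- by move=> i; rewrite blk_gr gsum_diag (ld_dec H) limgD limg_line.
- move=> i; apply/negP => /memv_imgP[n nN E].
  suff E' : e i - n = 0 by case/negP: (ld_notin H i); rewrite -(subrK n (e i)) E' add0r.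
  apply: (@cls0_inj i); first by rewrite memvB ?(e_blk H) // (subvP (N_blk H i)).
  by rewrite linearB /= -E subrr.
- by move=> i; rewrite blk_gr gsum_diag cls0_prod limgS // (ld_mull H).
- by move=> i; rewrite blk_gr gsum_diag cls0_prod limgS // (ld_mulr H).
have [n Nn] := N_nil H; exists n.+1 => i.
have -> : (NB i ^+ n.+1 = cls 0 @: (N i ^+ n.+1))%VS.
  elim: n {Nn} => [|n IHn]; first by rewrite !expv1.
  by rewrite expvSl IHn cls0_prod -expvSl.
by rewrite expvSl Nn prodv0 limg0.
Qed.

Definition coefB (q : 'I_bound) : 'Hom(B, A) := linfun (gr_ev q \o @vsval K _ (gr_space J)).

Lemma coefBE q f : coefB q f = gr_coef f q.
Proof. by rewrite lfunE /= gr_evE. Qed.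

Lemma coefB_gsum (q : 'I_bound) m i j f : (q < m)%N -> f \in gsum m i j -> coefB q f = 0.
Proof.
move=> qm; suff : (gsum m i j <= lker (coefB q))%VS.
  by move/subvP=> sub /sub; rewrite memv_ker => /eqP.
apply: gsum_sub => n x mn _; rewrite memv_ker coefBE gr_clsE ltn_eqF //.
exact: leq_trans mn.
Qed.

Lemma cls_gsum_cap n m i j (V : {vspace A}) : (n < m)%N ->
  (cls n @: V :&: gsum m i j = 0)%VS.
Proof.
move=> nm; apply/eqP; rewrite -subv0; apply/subvP => _ /memv_capP[/memv_imgP[x _ ->] xg].
rewrite memv0; apply/eqP/gr_eqP => q; rewrite gr_clsE [in RHS]/gr_coef ffunE.
case: eqP => // qn; have qm : (q < m)%N by rewrite qn.
by have := coefB_gsum qm xg; rewrite coefBE gr_clsE qn eqxx.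
Qed.

Lemma dim_cls n (V : {vspace A}) : (V <= ipow J n)%VS ->
  (\dim (cls n @: V) + \dim (V :&: ipow J n.+1) = \dim V)%N.
Proof.
move=> Vn; rewrite -(limg_ker_dim (cls n) V) addnC; congr (\dim _ + _)%N.
apply/vspaceP => x; rewrite !memv_cap; case xV: (x \in V) => //=.
by rewrite memv_ker gr_cls_eq0 // (subvP Vn).
Qed.

Lemma gsum_rec m i j : gsum m i j = (cls m @: jpow m i j + gsum m.+1 i j)%VS.
Proof.
apply: subv_anti; apply/andP; split.
  apply: gsum_sub => n x; rewrite leq_eqVlt => /predU1P[<- xj|mn xj].
    by rewrite (subvP (addvSl _ _)) // memv_img.
  by rewrite (subvP (addvSr _ _)) // mem_gsum.
rewrite subv_add; apply/andP; split.
  by apply/subvP => _ /memv_imgP[x xj ->]; apply: mem_gsum.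
by apply: gsum_sub => n x mn xj; apply: mem_gsum => //; apply: ltnW.
Qed.

(** When [m] grows by one, both sides lose the dimension of e_i J^m e_j modulo e_i J^(m+1) e_j, and
    both vanish for large [m]. *)
Lemma dim_gsum m i j : \dim (gsum m i j) = \dim (jpow m i j).
Proof.
have [n] := ubnP (bound - m); elim: n m => // n IHn m; rewrite ltnS => mn.
have [mb|mb] := ltnP m bound; last first.
  have -> : gsum m i j = 0%VS.
    apply/eqP; rewrite -subv0; apply: gsum_sub => q x mq _.
    by rewrite cls_big ?mem0v // (leq_trans mb).
  have -> : jpow m i j = 0%VS.
    by rewrite /jpow ipow_nil ?prodv0 ?prod0v // (leq_trans _ mb).
  by rewrite !dimv0.
rewrite gsum_rec dimv_disjoint_sum ?cls_gsum_cap // IHn; last first.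
  by apply: leq_trans mn; apply: ltn_sub2l.
rewrite -(dim_cls (jpow_ipow m i j)); congr (_ + \dim _)%N.
apply/vspaceP => x; rewrite memv_cap !mem_jpowE.
apply/andP/andP => [[xm xb]|[/andP[_ ->] ->]//].
by rewrite xb xm (subvP (ipowS J m) _ xm).
Qed.

Lemma dim_blk_gr i j : \dim (blk eB i j) = \dim (blk e i j).
Proof. by rewrite blk_gr dim_gsum. Qed.

Lemma gsum01 i j : i != j -> gsum 0 i j = gsum 1 i j.
Proof.
move=> ij; rewrite gsum_rec; apply/addv_idPr/subvP => _ /memv_imgP[x xj ->].
by rewrite cls_lower ?mem0v //; have := jpow_ipow 1 i j; rewrite jpow1 (negPf ij) => /subvP; apply.
Qed.

Lemma gsum_mul a b i m j : (gsum a i m * gsum b m j <= gsum (a + b) i j)%VS.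
Proof.
apply/prodvP => _ _ /memv_sumP[y yP ->] /memv_sumP[z zP ->].
rewrite mulr_suml; apply: memv_suml => p pa; rewrite mulr_sumr; apply: memv_suml => q qb.
have /memv_imgP[u + ->] := yP p pa; have /memv_imgP[v + ->] := zP q qb.
rewrite !mem_jpowE => /andP[vn vb] /andP[un ub]; rewrite clsM //.
apply: mem_gsum; last exact: leq_add.
by rewrite mem_jpow ?(blkM H ub vb) // memv_ipowM.
Qed.

(** One factor from [J] is split off on the left; it contributes only through an index other than
    [j], because e_j J^n e_j is zero for n > 0. *)
Lemma sq_gr i j : i != j -> sq eB i j = gsum 2 i j.
Proof.
move=> ij; apply: subv_anti; apply/andP; split.
  apply/subv_sumP => m /andP[mi mj]; rewrite !blk_gr !gsum01 1?eq_sym //.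
    by have := gsum_mul 1 1 i m j.
  by rewrite eq_sym.
apply: gsum_sub => -[//|n] x; rewrite ltnS => n1 xj.
suff /subvP/(_ _ xj) : (jpow n.+1 i j <= cls n.+1 @^-1: sq eB i j)%VS by rewrite -memv_preim.
rewrite jpowS; apply/subv_sumP => m mi; apply/prodvP => u v ub vj; rewrite -memv_preim.
have uj : u \in jpow 1 i m by rewrite jpow1 eq_sym (negPf mi).
have [mj|mj] := eqVneq m j.
  move: vj; rewrite mj; case: n n1 {xj} => // n _.
  by rewrite jpow_diag memv0 => /eqP ->; rewrite mulr0 linear0 mem0v.
rewrite -add1n -clsM; last 2 first.
- exact: (subvP (jpow_ipow 1 i m)).
- exact: (subvP (jpow_ipow n m j)).
by rewrite memvE (sumv_sup m) ?mi // -memvE !blk_gr memv_mul ?mem_gsum.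
Qed.

(** Degree one retains [V] modulo e_i J^2 e_j, and the degrees from 2 on have the total dimension of
    e_i J^2 e_j. Hence [rad_l] and [rad_r] have the same dimensions in both algebras. *)
Lemma dim_gr1 i j (V : {vspace A}) : i != j -> (sq e i j <= V)%VS -> (V <= blk e i j)%VS ->
  \dim (cls 1 @: V + gsum 2 i j) = \dim V.
Proof.
move=> ij sV Vb; rewrite dimv_disjoint_sum ?cls_gsum_cap // dim_gsum jpow2 //.
have V1 : (V <= ipow J 1)%VS.
  by apply: subv_trans Vb _; have := jpow_ipow 1 i j; rewrite jpow1 (negPf ij).
rewrite -(dim_cls V1); congr (_ + \dim _)%N; apply/vspaceP => x.
rewrite -jpow2 // mem_jpowE memv_cap; apply/andP/andP => [[x2 xb]|[xV x2]].
  by split=> //; apply: (subvP sV); rewrite -jpow2 // mem_jpowE x2.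
by rewrite x2 (subvP Vb).
Qed.

Lemma cls1_sq i j : i != j -> (cls 1 @: sq e i j = 0)%VS.
Proof.
move=> ij; apply/eqP; rewrite -subv0; apply/subvP => _ /memv_imgP[x xs ->].
by rewrite cls_lower ?mem0v // (subvP (jpow_ipow 2 i j)) // jpow2.
Qed.

Lemma blk_ipow1 i j : i != j -> (blk e i j <= ipow J 1)%VS.
Proof. by move=> ij; have := jpow_ipow 1 i j; rewrite jpow1 (negPf ij). Qed.

Lemma blk_gr1 i j : i != j -> blk eB i j = (cls 1 @: blk e i j + gsum 2 i j)%VS.
Proof. by move=> ij; rewrite blk_gr gsum01 // gsum_rec jpow1 (negPf ij). Qed.

Lemma cls01_prod i j : i != j ->
  (cls 0 @: N i * cls 1 @: blk e i j = cls 1 @: (N i * blk e i j))%VS.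
Proof. by move=> ij; rewrite cls_prod ?subvf ?blk_ipow1. Qed.

Lemma cls10_prod i j : i != j ->
  (cls 1 @: blk e i j * cls 0 @: N j = cls 1 @: (blk e i j * N j))%VS.
Proof. by move=> ij; rewrite cls_prod ?subvf ?blk_ipow1. Qed.

Lemma NB_gsum i : (NB i <= gsum 0 i i)%VS.
Proof. by rewrite gsum_diag limgS // (N_blk H). Qed.

Lemma dim_rad_l_gr i j : i != j -> \dim (rad_l eB NB i j) = \dim (rad_l e N i j).
Proof.
move=> ij; rewrite -(dim_gr1 ij (addvSl _ _ : _ <= rad_l e N i j)%VS (rad_l_blk H i j)).
congr (\dim _); rewrite /rad_l sq_gr // blk_gr1 // limgD cls1_sq // add0v prodvDr.
rewrite cls01_prod // addvA [(gsum 2 i j + _)%VS]addvC -addvA; congr (_ + _)%VS.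
apply/addv_idPl; apply: subv_trans (prodvSl _ (NB_gsum i)) _.
exact: (gsum_mul 0 2 i i j).
Qed.

Lemma dim_rad_r_gr i j : i != j -> \dim (rad_r eB NB i j) = \dim (rad_r e N i j).
Proof.
move=> ij; rewrite -(dim_gr1 ij (addvSl _ _ : _ <= rad_r e N i j)%VS (rad_r_blk H i j)).
congr (\dim _); rewrite /rad_r sq_gr // blk_gr1 // limgD cls1_sq // add0v prodvDl.
rewrite cls10_prod // addvA [(gsum 2 i j + _)%VS]addvC -addvA; congr (_ + _)%VS.
apply/addv_idPl; apply: subv_trans (prodvSr _ (NB_gsum j)) _.
exact: (gsum_mul 2 0 i j j).
Qed.

Lemma dim_sq_gr i j : i != j -> \dim (sq eB i j) = \dim (sq e i j).
Proof. by move=> ij; rewrite sq_gr // dim_gsum jpow2. Qed.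

Lemma mult_gr i j : mult eB NB i j = mult e N i j.
Proof. by rewrite /mult; case: eqVneq => // ij; rewrite dim_blk_gr dim_rad_l_gr. Qed.

Lemma dim_pcol_gr j : \dim (pcol eB j) = \dim (pcol e j).
Proof.
rewrite (dim_pcol graded_local) (dim_pcol H).
by apply: eq_bigr => i _; rewrite dim_blk_gr.
Qed.

Lemma offdiag_projective_gr : offdiag_projective eB NB <-> offdiag_projective e N.
Proof.
have E1 j : (\sum_l \dim (pcol eB l) * mult eB NB l j = \sum_l \dim (pcol e l) * mult e N l j)%N.
  by apply: eq_bigr => l _; rewrite dim_pcol_gr mult_gr.
have E2 j : (\sum_(i | i != j) \dim (blk eB i j) = \sum_(i | i != j) \dim (blk e i j))%N.
  by apply: eq_bigr => i _; rewrite dim_blk_gr.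
by split=> P j; have := P j; rewrite E1 E2.
Qed.

Lemma arrows_right_free_gr : arrows_right_free eB NB <-> arrows_right_free e N.
Proof.
by split=> XR i j ij; have := XR i j ij; rewrite !dim_blk_gr dim_sq_gr // dim_rad_r_gr.
Qed.

Lemma dim_gr_part n : (\dim (gr_part J n) + \dim (ipow J n.+1) = \dim (ipow J n))%N.
Proof.
rewrite -[RHS](dim_cls (subvv (ipow J n))); congr (_ + \dim _)%N.
by apply/esym/capv_idPr/ipowS.
Qed.

Lemma sum_dim_gr_part m : (\dim {:A} <= m)%N ->
  (\sum_(n < m) \dim (gr_part J n) = \dim {:A})%N.
Proof.
move=> dm; have E q : (\sum_(n < q) \dim (gr_part J n) + \dim (ipow J q) = \dim {:A})%N.
  elim: q => [|q IHq]; first by rewrite big_ord0.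
  by rewrite big_ord_recr /= -addnA dim_gr_part.
by rewrite -(E m) ipow_nil // dimv0 addn0.
Qed.

End Graded.

(** * Projective modules *)

Section FinfunSpace.
Variables (K : fieldType) (V : vectType K) (T : finType).

Let single_fun (t : T) (d : V) : {ffun T -> V} := [ffun s => if s == t then d else 0].
Let single_lin t : linear (single_fun t).
Proof. by move=> c d d'; apply/ffunP => s; rewrite !ffunE; case: eqP; rewrite // scaler0 addr0. Qed.

Definition ffun_single (t : T) : 'Hom(V, {ffun T -> V}) :=
  lfun_of (@single_lin t).

Lemma ffun_singleE t d s : ffun_single t d s = if s == t then d else 0.
Proof. by rewrite lfun_ofE ffunE. Qed.

Lemma dim_ffun_single (P : pred T) (U : T -> {vspace V}) :
  \dim (\sum_(t | P t) ffun_single t @: U t) = (\sum_(t | P t) \dim (U t))%N.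
Proof.
have dir : directv (\sum_(t | P t) ffun_single t @: U t)%VS.
  apply/directv_sum_independent => u uP u0 t Pt.
  have /memv_imgP[d _ uE] := uP t Pt; rewrite uE; suff -> : d = 0 by rewrite linear0.
  have /ffunP/(_ t) := u0; rewrite sum_ffunE ffunE (bigD1 t) //= uE ffun_singleE eqxx.
  rewrite big1 ?addr0 // => s /andP[Ps st]; have /memv_imgP[d' _ ->] := uP s Ps.
  by rewrite ffun_singleE eq_sym (negPf st).
rewrite (directvP dir) /=; apply: eq_bigr => t _.
apply: limg_dim_eq; apply/eqP; rewrite -subv0; apply/subvP => d /memv_capP[_].
by rewrite memv_ker memv0 => /eqP/ffunP/(_ t); rewrite ffun_singleE eqxx ffunE => /eqP.
Qed.

End FinfunSpace.
Arguments ffun_single {K} V {T} t.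

(* The product mul is a parameter in order to cover left and right modules; rd is
   the radical, rd ^+ n its powers for the product of D itself, and pd i is the
   projective D eps_i. *)
Section ProjectiveDimension.
Variables (K : fieldType) (D : falgType K) (mul : D -> D -> D).
Variables (I : finType) (eps : I -> D) (rd : {vspace D}) (pd : I -> {vspace D}).

Record semiperfect : Prop := {
  sp_mulA : associative mul;
  sp_mul_l : forall b, linear (mul^~ b);
  sp_mul_r : forall a, linear (mul a);
  sp_idem : forall i, mul (eps i) (eps i) = eps i;
  sp_orth : forall i j, i != j -> mul (eps i) (eps j) = 0;
  sp_sum : \sum_i eps i = 1;
  sp_mull : forall a b, b \in rd -> mul a b \in rd;
  sp_pow : forall k a b, a \in (rd ^+ k.+1)%VS -> b \in rd -> mul a b \in (rd ^+ k.+2)%VS;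
  sp_nil : exists n, (rd ^+ n = 0)%VS;
  sp_proj : forall i a, (a \in pd i) = (mul a (eps i) == a);
  sp_dec : forall i a, exists c, mul a (eps i) - c *: eps i \in rd
}.
Hypothesis H : semiperfect.

Implicit Types (X M : fdmod mul).

Lemma act_mulg X a b (x : X) : act X (mul a b) x = act X a (act X b x).
Proof. by rewrite actM comp_lfunE. Qed.

Let mulr0' a : mul a 0 = 0.
Proof. by have := sp_mul_r H a (-1) 0 0; rewrite scaler0 addr0 scaleN1r addNr. Qed.

Lemma eps_pd i : eps i \in pd i.
Proof. by rewrite (sp_proj H) (sp_idem H). Qed.

Lemma mul_pd i a b : b \in pd i -> mul a b \in pd i.
Proof. by rewrite !(sp_proj H) -(sp_mulA H) => /eqP ->. Qed.

Definition radm X : {vspace X} := actv rd (fullv : {vspace X}).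
(** The multiplicity of [D eps_i] in the projective cover of [X]. *)
Definition topdim X i : nat :=
  (\dim (act X (eps i) @: fullv) - \dim (act X (eps i) @: radm X))%N.

Section Family.
Variables (T : finType) (P : pred T) (l : T -> I).

Definition based X (b : T -> X) : Prop :=
  (forall t, P t -> act X (eps (l t)) (b t) = b t) /\
  (forall x, x \in (\sum_(t | P t) orbm (b t) @: pd (l t))%VS).

(** The family defines a surjection onto [X] from the direct sum of the [D eps_(l t)]; the
    inequality makes it bijective. The restriction to [P] lets a basis be a subfamily of a product,
    as for tensor products. *)
Definition free_on X (b : T -> X) : Prop :=
  based b /\ (\sum_(t | P t) \dim (pd (l t)) <= \dim {:X})%N.

Lemma based_dim X (b : T -> X) : based b -> (\dim {:X} <= \sum_(t | P t) \dim (pd (l t)))%N.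
Proof.
case=> _ bX; have sub : (fullv <= \sum_(t | P t) orbm (b t) @: pd (l t))%VS by apply/subvP.
apply: leq_trans (dimvS sub) _; apply: leq_trans (dim_sum_le _ _) _.
by apply: leq_sum => t _; apply: dimv_img_le.
Qed.

Section Graph.
Variables (X M : fdmod mul) (b : T -> X) (m : T -> M).
Hypothesis bF : free_on b.
Hypothesis mE : forall t, P t -> act M (eps (l t)) (m t) = m t.

Let gam_fun t (d : D) : (X * M)%type := (act X d (b t), act M d (m t)).
Let gam_lin t : linear (gam_fun t).
Proof.
move=> c d d'; rewrite /gam_fun -!orbmE !linearP /=; congr pair.
Qed.
Let gam t : 'Hom(D, (X * M)%type) := lfun_of (@gam_lin t).
Let gamE t d : gam t d = (act X d (b t), act M d (m t)).
Proof. exact: lfun_ofE. Qed.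

Let Gam : {vspace (X * M)%type} := (\sum_(t | P t) gam t @: pd (l t))%VS.
Let pr1 : 'Hom((X * M)%type, X) := linfun fst.
Let pr2 : 'Hom((X * M)%type, M) := linfun snd.

(* Gam is the graph of the homomorphism: it projects onto X and its dimension is
   at most that of X. *)
Lemma free_hom : exists2 g : 'Hom(X, M), is_modhom g & forall t, P t -> g (b t) = m t.
Proof.
have [[be bX] dX] := bF.
have pr1E z : pr1 z = z.1 by rewrite lfunE.
have pr2E z : pr2 z = z.2 by rewrite lfunE.
have surj x : exists2 z, z \in Gam & z.1 = x.
  have /memv_sumP[y yP ->] := bX x.
  have [z zP] : exists z : T -> (X * M)%type, forall t, P t -> z t \in (gam t @: pd (l t))%VS /\ (z t).1 = y t.
    apply: (fin_all_exists (P := fun t z => P t -> z \in (gam t @: pd (l t))%VS /\ z.1 = y t)) => t.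
    case Pt: (P t); last by exists 0.
    have /memv_imgP[d dl yE] := yP t Pt; exists (gam t d) => _.
    by rewrite memv_img // yE orbmE gamE.
  exists (\sum_(t | P t) z t).
    by apply: memv_sumr => t Pt; have [] := zP t Pt.
  rewrite -pr1E linear_sum; apply: eq_bigr => t Pt /=; rewrite pr1E; by have [] := zP t Pt.
have dG : (\dim Gam <= \dim {:X})%N.
  apply: leq_trans dX; apply: leq_trans (dim_sum_le _ _) _.
  by apply: leq_sum => t _; apply: dimv_img_le.
pose psi : 'Hom(subvs_of Gam, X) := (pr1 \o linfun (@vsval K _ Gam))%VF.
have psiE z : psi z = (vsval z).1 by rewrite comp_lfunE pr1E lfunE.
have psi_surj : limg psi = fullv.
  apply/vspaceP => x; rewrite memvf; have [z zG <-] := surj x.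
  by apply/memv_imgP; exists (vsproj Gam z); rewrite ?memvf // psiE vsprojK.
have psi_inj : lker psi == 0%VS.
  rewrite -dimv_eq0 -leqn0; have := limg_ker_dim psi fullv; rewrite capfv psi_surj.
  by rewrite [X in _ = X -> _]dimvf => E; move: dG; rewrite -[X in (X <= _)%N]E -[X in (_ <= X)%N]add0n leq_add2r.
pose g : 'Hom(X, M) := (pr2 \o linfun (@vsval K _ Gam) \o psi^-1)%VF.
have gE z : z \in Gam -> g z.1 = z.2.
  move=> zG; have E : (psi^-1)%VF z.1 = vsproj Gam z.
    by rewrite -[in LHS](vsprojK zG) -psiE lker0_lfunK.
  by rewrite /g 2!comp_lfunE E pr2E lfunE /= vsprojK.
exists g.
  move=> a x; have [z zG <-] := surj x.
  have azG : (act X a z.1, act M a z.2) \in Gam.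
    have /memv_sumP[y yP zE] := zG.
    have -> : (act X a z.1, act M a z.2) = \sum_(t | P t) (act X a (y t).1, act M a (y t).2).
      have s1 (F : T -> (X * M)%type) : (\sum_(t | P t) F t).1 = \sum_(t | P t) (F t).1.
        by rewrite -pr1E linear_sum; apply: eq_bigr => t _; apply: pr1E.
      have s2 (F : T -> (X * M)%type) : (\sum_(t | P t) F t).2 = \sum_(t | P t) (F t).2.
        by rewrite -pr2E linear_sum; apply: eq_bigr => t _; apply: pr2E.
      by apply: injective_projections; rewrite ?s1 ?s2 /= zE ?s1 ?s2 linear_sum.
    apply: memv_sumr => t Pt; have /memv_imgP[d dl ->] := yP t Pt.
    by rewrite gamE /= -!act_mulg -gamE memv_img // mul_pd.
  by rewrite gE // (gE _ azG).
move=> t Pt; have := gE (gam t (eps (l t))); rewrite gamE /= be // mE //; apply.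
rewrite -(be t Pt) -(mE Pt) -gamE memvE (sumv_sup t) // -memvE memv_img //.
exact: eps_pd.
Qed.

End Graph.

Lemma free_projective X (b : T -> X) : free_on b -> projective X.
Proof.
move=> bF M M' p f [homp sp] homf; have [[be bX] _] := bF.
have lift y : p ((p^-1)%VF y) = y by rewrite limg_lfunVK // sp memvf.
pose m t := act M (eps (l t)) ((p^-1)%VF (f (b t))).
have [|g homg gE] := @free_hom X M b m bF.
  by move=> t _; rewrite -act_mulg (sp_idem H).
exists g => //; apply/lfunP => x; rewrite comp_lfunE.
have /memv_sumP[y yP ->] := bX x; rewrite !linear_sum; apply: eq_bigr => t Pt /=.
have /memv_imgP[d _ ->] := yP t Pt.
by rewrite orbmE homg homp homf gE // homp lift -homf be.
Qed.

End Family.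

Lemma rad_nakayama X (Y : {vspace X}) : stable Y ->
  (forall x, x \in (Y + radm X)%VS) -> Y = fullv.
Proof.
move=> stY YX; have [n rn] := sp_nil H.
have main k : forall x, x \in (Y + actv (rd ^+ k.+1) fullv)%VS.
  elim: k => [|k IHk] x; first by rewrite expv1.
  have [y yY [z zr ->]] := memv_addP (IHk x); rewrite memvD //.
    by rewrite (subvP (addvSl _ _)).
  apply: subvP zr; apply: actv_sub => a w ak _.
  have [u uY [v vr ->]] := memv_addP (YX w).
  rewrite linearD /=; rewrite memv_add ?stY //.
  suff /subvP/(_ _ vr) : (radm X <= act X a @^-1: actv (rd ^+ k.+2) fullv)%VS by rewrite -memv_preim.
  apply: actv_sub => c w' cr _; rewrite -memv_preim -act_mulg mem_actv ?memvf //.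
  exact: (sp_pow H).
apply/vspaceP => x; rewrite memvf; have := main n x.
suff -> : actv (rd ^+ n.+1) (fullv : {vspace X}) = 0%VS by rewrite addv0.
apply/eqP; rewrite -subv0 expvSl rn prodv0; apply: actv_sub => a y; rewrite memv0.
by move=> /eqP -> _; rewrite linear0 zero_lfunE mem0v.
Qed.

Lemma sum_pd_stable (T : finType) (P : pred T) (l : T -> I) X (b : T -> X) :
  stable (\sum_(t | P t) orbm (b t) @: pd (l t))%VS.
Proof.
move=> a _ /memv_sumP[y yP ->]; rewrite linear_sum; apply: memv_sumr => t Pt /=.
have /memv_imgP[d dl ->] := yP t Pt.
by rewrite orbmE -act_mulg -orbmE memv_img // mul_pd.
Qed.

Definition rad_independent (T : finType) (P : pred T) X (b : T -> X) : Prop :=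
  forall c : T -> K, \sum_(t | P t) c t *: b t \in radm X -> forall t, P t -> c t = 0.

Lemma eps_radm X i : (act X (eps i) @: radm X <= radm X)%VS.
Proof.
apply/subvP => _ /memv_imgP[x xr ->].
suff /subvP/(_ _ xr) : (radm X <= act X (eps i) @^-1: radm X)%VS by rewrite -memv_preim.
apply: actv_sub => a y ar _; rewrite -memv_preim -act_mulg mem_actv ?memvf //.
exact: (sp_mull H).
Qed.

(** The family consists of bases of complements of [eps_i rad X] in [eps_i X]; it generates [X] by
    Nakayama. *)
Lemma top_basis X : exists (T : finType) (P : pred T) (l : T -> I) (b : T -> X),
  [/\ based P l b, rad_independent P b
    & forall phi : I -> nat, (\sum_(t | P t) phi (l t) = \sum_i phi i * topdim X i)%N].
Proof.
pose E i := (act X (eps i) @: fullv)%VS; pose R i := (act X (eps i) @: radm X)%VS.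
have RE i : (R i <= E i)%VS by apply/limgS/subvf.
pose C i := (E i :\: R i)%VS.
have EE i x : x \in E i -> act X (eps i) x = x.
  by move=> /memv_imgP[y _ ->]; rewrite -act_mulg (sp_idem H).
have E0 i j x : i != j -> x \in E j -> act X (eps i) x = 0.
  by move=> ij /memv_imgP[y _ ->]; rewrite -act_mulg (sp_orth H) // linear0 zero_lfunE.
pose T : finType := {i : I & 'I_(\dim (C i))}.
pose b (t : T) : X := (vbasis (C (tag t)))`_(tagged t).
have bC t : b t \in C (tag t) by apply/vbasis_mem/mem_nth; rewrite size_tuple.
have bE t : act X (eps (tag t)) (b t) = b t.
  by apply: EE; apply: (subvP (diffvSl _ _)) (bC t).
have sumT (V : nmodType) (F : forall i, 'I_(\dim (C i)) -> V) :
    \sum_(t : T) F (tag t) (tagged t) = \sum_i \sum_(s < \dim (C i)) F i s.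
  by rewrite (sig_big_dep (fun=> true) (fun _ _ => true)).
have sum_sig (V : nmodType) (G : T -> V) :
    \sum_t G t = \sum_i \sum_(s < \dim (C i)) G (existT _ i s).
  by rewrite -(sumT _ (fun i s => G (existT _ i s))); apply: eq_bigr => -[].
have dC i : \dim (C i) = topdim X i by rewrite dim_diffv.
exists T, xpredT, (fun t => tag t), b; split; last first.
- move=> phi; rewrite sum_sig; apply: eq_bigr => i _ /=.
  by rewrite sum_nat_const card_ord dC mulnC.
- move=> c cr [i s] _ /=.
  have iR : act X (eps i) (\sum_(t : T) c t *: b t) \in R i by rewrite memv_img.
  have E1 : act X (eps i) (\sum_(t : T) c t *: b t) =
      \sum_(s' < \dim (C i)) c (existT _ i s') *: (vbasis (C i))`_s'.
    rewrite linear_sum sum_sig (bigD1 i) //= [X in _ + X]big1 ?addr0.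
      by apply: eq_bigr => s' _; rewrite linearZ /= (bE (existT _ i s')).
    move=> j ji; apply: big1 => s' _; rewrite linearZ /= (E0 i j) ?scaler0 1?eq_sym //.
    exact: (subvP (diffvSl _ _)) (bC (existT _ j s')).
  have /eqP : \sum_(s' < \dim (C i)) c (existT _ i s') *: (vbasis (C i))`_s' = 0.
    apply/eqP; rewrite -memv0 -(capv_diff (E i) (R i)) memv_cap -E1 iR andbT E1.
    by apply: memv_suml => s' _; apply/memvZ/(bC (existT _ i s')).
  have /freeP fC : free (vbasis (C i)) by apply: basis_free (vbasisP _).
  by move=> /eqP E2; apply: (fC (fun s' => c (existT _ i s')) E2 s).
split=> // x; set Y := (\sum_(t | xpredT t) _)%VS.
suff -> : Y = fullv by rewrite memvf.
apply: rad_nakayama; first exact: sum_pd_stable.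
move=> z; rewrite -(act_one z) -(sp_sum H) act_sum; apply: memv_suml => i _.
have : act X (eps i) z \in E i by rewrite memv_img ?memvf.
rewrite -(diffv_addK (RE i)) => /memv_addP[c cC [r rR ->]]; rewrite memv_add //; last first.
  exact: (subvP (eps_radm X i)).
rewrite (coord_vbasis cC); apply: memv_suml => s _; rewrite memvZ //.
rewrite memvE (sumv_sup (existT _ i s)) // -memvE.
by have := memv_img (orbm (b (existT _ i s))) (eps_pd i); rewrite orbmE (bE (existT _ i s)).
Qed.

Lemma topdim_bound X : (\dim {:X} <= \sum_i \dim (pd i) * topdim X i)%N.
Proof.
have [T [P [l [b [bb _ bS]]]]] := top_basis X.
by rewrite -(bS (fun i => \dim (pd i))); apply: based_dim bb.
Qed.

Section FreeModule.
Variable T : finType.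

Let fact_fun (a : D) (f : {ffun T -> D}) : {ffun T -> D} := [ffun t => mul a (f t)].
Let fact_lin a : linear (fact_fun a).
Proof. by move=> c f g; apply/ffunP => t; rewrite !ffunE (sp_mul_r H). Qed.
Let fact_lfun a : 'End({ffun T -> D}) :=
  lfun_of (@fact_lin a).
Let fact_lfunE a f : fact_lfun a f = [ffun t => mul a (f t)].
Proof. exact: lfun_ofE. Qed.
Let fact_lfun_lin : linear fact_lfun.
Proof.
move=> c a b; apply/lfunP => f; rewrite add_lfunE scale_lfunE !fact_lfunE.
by apply/ffunP => t; rewrite !ffunE (sp_mul_l H).
Qed.
Let fact : 'Hom(D, 'End({ffun T -> D})) := lfun_of fact_lfun_lin.
Let factE a f : fact a f = [ffun t => mul a (f t)].
Proof. by rewrite lfun_ofE fact_lfunE. Qed.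

Hypothesis mul1 : left_id 1 mul.

Let fact1 : fact 1 = \1%VF.
Proof. by apply/lfunP => f; rewrite factE id_lfunE; apply/ffunP => t; rewrite ffunE mul1. Qed.
Let factM a b : fact (mul a b) = (fact a \o fact b)%VF.
Proof.
apply/lfunP => f; rewrite comp_lfunE !factE; apply/ffunP => t; rewrite !ffunE.
by rewrite (sp_mulA H).
Qed.

Definition free_module : fdmod mul := FdMod fact1 factM.

Lemma act_free a (f : free_module) : act free_module a f = [ffun t => mul a (f t)].
Proof. exact: factE. Qed.

End FreeModule.

(** The surjection from the free module on [T] has a section. Projected to the sum of the
    [D eps_(l t)], this section hits the standard generators modulo the radical, because [b] is
    independent there. As the radical is nilpotent, it is onto, which bounds the dimension of that
    sum by the dimension of [X]. *)
Lemma projective_free (mul1 : left_id 1 mul) (T : finType) (P : pred T) (l : T -> I) X (b : T -> X) :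
  based P l b -> rad_independent P b -> projective X -> free_on P l b.
Proof.
move=> bb ind projX; split=> //; have [be bX] := bb.
pose F := free_module T mul1.
have pl (f : F) : \sum_(t | P t) act X ((f : {ffun T -> D}) t) (b t) =
    \sum_(t | P t) orbm (b t) ((f : {ffun T -> D}) t).
  by apply: eq_bigr => t _; rewrite orbmE.
pose p_fun (f : F) : X := \sum_(t | P t) orbm (b t) ((f : {ffun T -> D}) t).
have p_lin : linear p_fun.
  move=> c f g; rewrite /p_fun scaler_sumr -big_split /=; apply: eq_bigr => t _.
  by rewrite !ffunE linearP.
pose p : 'Hom(F, X) := lfun_of p_lin.
have pE f : p f = \sum_(t | P t) act X ((f : {ffun T -> D}) t) (b t) by rewrite lfun_ofE /p_fun pl.
have homp : is_modhom p.
  move=> a f; rewrite !pE linear_sum; apply: eq_bigr => t _.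
  by rewrite act_free ffunE act_mulg.
have sp : limg p = fullv.
  apply/vspaceP => x; rewrite memvf; apply/memv_imgP.
  have /memv_sumP[y yP ->] := bX x.
  have [z zP] : exists z : T -> D, forall t, P t -> orbm (b t) (z t) = y t.
    apply: (fin_all_exists (P := fun t z => P t -> orbm (b t) z = y t)) => t.
    case Pt: (P t); last by exists 0.
    by have /memv_imgP[d _ ->] := yP t Pt; exists d.
  exists ([ffun t => z t] : {ffun T -> D}); rewrite ?memvf // pE.
  by apply: eq_bigr => t Pt; rewrite ffunE -zP // orbmE.
have hom1 : is_modhom (M := X) (N := X) \1%VF by move=> a x; rewrite !id_lfunE.
have [g homg pg] := projX F X p \1%VF (conj homp sp) hom1.
have pgE x : p (g x) = x by rewrite -comp_lfunE pg id_lfunE.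
(* [R 0] has to be everything, while [rd ^+ 0] is only the line of 1. *)
pose R k : {vspace D} := if k is k'.+1 then (rd ^+ k'.+1)%VS else fullv.
pose io (t : T) : 'Hom(D, {ffun T -> D}) := ffun_single D t.
have ioE t d s : io t d s = if s == t then d else 0 by apply: ffun_singleE.
pose Fk k : {vspace {ffun T -> D}} := (\sum_(t | P t) io t @: (pd (l t) :&: R k))%VS.
pose g'_fun (x : X) : {ffun T -> D} := [ffun t => if P t then mul ((g x : {ffun T -> D}) t) (eps (l t)) else 0].
have g'_lin : linear g'_fun.
  move=> c x y; apply/ffunP => t; rewrite !ffunE linearP /= !ffunE.
  by case: (P t); rewrite ?(sp_mul_l H) // scaler0 addr0.
pose g' : 'Hom(X, {ffun T -> D}) := lfun_of g'_lin.
have g'E x t : g' x t = if P t then mul ((g x : {ffun T -> D}) t) (eps (l t)) else 0.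
  by rewrite lfun_ofE ffunE.
have g'hom a x : g' (act X a x) = [ffun t => mul a (g' x t)].
  apply/ffunP => t; rewrite ffunE !g'E homg act_free ffunE.
  by case: (P t); rewrite ?mulr0' // (sp_mulA H).
have pg' x : \sum_(t | P t) act X (g' x t) (b t) = x.
  rewrite -[RHS]pgE pE; apply: eq_bigr => t Pt; rewrite g'E Pt act_mulg be //.
have ffun_sum (f : {ffun T -> D}) k : (forall t, P t -> f t \in (pd (l t) :&: R k)%VS) ->
    (forall t, ~~ P t -> f t = 0) -> f \in Fk k.
  move=> fP f0; have -> : f = \sum_(t | P t) io t (f t).
    apply/ffunP => s; rewrite sum_ffunE; case Ps: (P s); last first.
      rewrite f0 ?Ps // big1 // => t Pt; rewrite ioE; case: eqP => // st.
      by rewrite st Pt in Ps.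
    rewrite (bigD1 s) //= ioE eqxx big1 ?addr0 // => t /andP[_ ts].
    by rewrite ioE eq_sym (negPf ts).
  by apply: memv_sumr => t Pt; rewrite memv_img ?fP.
(* Modulo the image of [g'] layer [k] moves into layer [k.+1], as [g' (b t)] differs from the
   standard generator at [t] by an element of the radical. *)
have step k : (Fk k <= limg g' + Fk k.+1)%VS.
  apply/subv_sumP => t Pt; apply/subvP => _ /memv_imgP[d /memv_capP[dl dR] ->].
  pose kt : {ffun T -> D} := [ffun s => g' (b t) s - io t (eps (l t)) s].
  have kP s : P s -> kt s \in (pd (l s) :&: rd)%VS.
    have cE : forall s, exists c, P s -> g' (b t) s - c *: eps (l s) \in rd.
      move=> s'; have [c cP] := sp_dec H (l s') ((g (b t) : {ffun T -> D}) s').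
      by exists c => Ps; rewrite g'E Ps.
    have /fin_all_exists[c cP] := cE.
    (* The expansion [pg'] of [b t], read modulo the radical, forces the scalar parts of [g' (b t)]
       by independence. *)
    have c0 : forall s, P s -> c s - (s == t)%:R = 0.
      apply: ind.
      have -> : \sum_(s | P s) (c s - (s == t)%:R) *: b s =
          - \sum_(s | P s) act X (g' (b t) s - c s *: eps (l s)) (b s).
        rewrite -sumrN.
        have -> : \sum_(s | P s) (c s - (s == t)%:R) *: b s = \sum_(s | P s) c s *: b s - b t.
          under eq_bigr => s' _ do rewrite scalerBl.
          rewrite sumrB; congr (_ - _); rewrite (bigD1 t) //= eqxx scale1r big1 ?addr0 // => s'.
          by case/andP => _ /negPf ->; rewrite scale0r.
        rewrite -[X in _ - X = _](pg' (b t)) -sumrB; apply: eq_bigr => s' Ps.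
        by rewrite -[in RHS]orbmE linearB linearZ /= !orbmE be // opprB.
      rewrite memvN; apply: memv_suml => s' Ps; rewrite mem_actv ?memvf //.
      exact: cP.
    move=> Ps; rewrite ffunE ioE memv_cap; apply/andP; split.
      rewrite memvB //; last by case: eqP => [->|_]; rewrite ?eps_pd ?mem0v.
      by rewrite g'E Ps mul_pd ?eps_pd.
    have /eqP := c0 s Ps; rewrite subr_eq0 => /eqP cs.
    have := cP s Ps; rewrite cs; case: eqP => [->|_]; rewrite ?scale1r ?scale0r //.
  have k0 s : ~~ P s -> kt s = 0.
    move=> Ps; rewrite ffunE ioE g'E (negPf Ps); case: eqP => [st|_]; last by rewrite subr0.
    by rewrite st Pt in Ps.
  have -> : io t d = g' (act X d (b t)) - [ffun s => mul d (kt s)].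
    apply/ffunP => s; rewrite g'hom !ffunE !ioE.
    have mB u v : mul d (u - v) = mul d u - mul d v.
      by have := sp_mul_r H d (-1) v u; rewrite scaleN1r addrC scaleN1r [- _ + _]addrC.
    rewrite mB opprB addrCA subrr addr0; case: eqP => [_|_]; last by rewrite mulr0'.
    by apply/esym/eqP; rewrite -(sp_proj H).
  rewrite memv_add ?memv_img ?memvf // memvN; apply: ffun_sum => s Ps; rewrite ffunE; last first.
    by rewrite k0 // mulr0'.
  have := kP s Ps; rewrite !memv_cap => /andP[kl kr]; rewrite mul_pd //=.
  case: k dR => [_|k dR] /=; first by rewrite expv1 (sp_mull H).
  exact: (sp_pow H).
have main k : (Fk 0%N <= limg g' + Fk k)%VS.
  elim: k => [|k IHk]; first exact: addvSr.
  apply: subv_trans IHk _; rewrite subv_add addvSl /=; exact: step.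
have [n rn] := sp_nil H.
have Fn : Fk n.+1 = 0%VS.
  apply: big1 => t _; rewrite /= expvSl rn prodv0 capv0 limg0 //.
have F0 : (Fk 0%N <= limg g')%VS by have := main n.+1; rewrite Fn addv0.
have dF0 : \dim (Fk 0%N) = (\sum_(t | P t) \dim (pd (l t)))%N.
  by rewrite dim_ffun_single; apply: eq_bigr => t _; rewrite capvf.
rewrite -dF0; apply: leq_trans (dimvS F0) _; exact: dimv_img_le.
Qed.

Lemma projective_iff (mul1 : left_id 1 mul) X :
  projective X <-> \dim {:X} = (\sum_i \dim (pd i) * topdim X i)%N.
Proof.
have [T [P [l [b [bb ind bS]]]]] := top_basis X.
have dS := bS (fun i => \dim (pd i)); split=> [projX|dX].
  have [_ dX] := projective_free mul1 bb ind projX.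
  by apply/eqP; rewrite eqn_leq topdim_bound -dS.
by apply: (@free_projective _ P l _ b); split=> //; rewrite dS dX.
Qed.

End ProjectiveDimension.

(** * The bimodule J / J^2 *)

Section Arrows.
Variables (K : fieldType) (A : falgType K) (L : finType) (e : L -> A).
Variables (N : L -> {vspace A}) (h : L -> nat).
Hypothesis H : local_directed e N h.

Local Notation blk := (blk e).

Lemma blk_gen_space i j : i != j ->
  blk i j = (blk i i * gen_space e N i j + sq e i j)%VS.
Proof.
move=> ij; apply: subv_anti; apply/andP; split; last first.
  rewrite subv_add (sq_blk H) andbT; apply: subv_trans (prod_blk H i i j).
  by apply: prodvSr; rewrite /gen_space (negPf ij) diffvSl.
have [b Nb] := N_nil H; apply: (nakayama (Nb i)).
  rewrite prodvDr; apply: addvS.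
    rewrite prodvA prodvSl //; exact: subv_trans (prodvSl _ (N_blk H i)) (prod_blk H _ _ _).
  rewrite /sq big_distrr /=; apply/subv_sumP => m /andP[mi mj]; rewrite (sumv_sup m) ?mi //.
  by rewrite (rad_right_mul H).
have gE : (blk i j <= gen_space e N i j + rad_l e N i j)%VS.
  by rewrite /gen_space (negPf ij) diffv_addK // (rad_l_blk H).
apply: subv_trans gE _; rewrite subv_add; apply/andP; split.
  apply: subv_trans (addvSr _ _); apply: subv_trans (addvSl _ _).
  apply/subvP => x xg; have xb : x \in blk i j.
    by move: xg; rewrite /gen_space (negPf ij) => /(subvP (diffvSl _ _)).
  by rewrite -(blk_l H xb) memv_mul ?(e_blk H).
by rewrite /rad_l addvC addvS ?addvSr.
Qed.

(** A module over a local algebra is at most as large as the free module on its top. Freeness is the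
    equality case, here and in [arrows_right_le]. *)
Lemma arrows_left_le i j : i != j ->
  (\dim (blk i j) - \dim (sq e i j) <= \dim (blk i i) * mult e N i j)%N.
Proof.
move=> ij; rewrite leq_subLR {1}(blk_gen_space ij) addnC.
apply: leq_trans (dimv_add_le _ _) _; rewrite leq_add2r -(dim_gen_space H).
exact: dim_prodv.
Qed.

Lemma arrows_right_le i j : i != j ->
  (\dim (blk i j) - \dim (sq e i j) <=
   \dim (blk j j) * (\dim (blk i j) - \dim (rad_r e N i j)))%N.
Proof.
move=> ij; have [b Nb] := N_nil H.
have BB : (blk i j * blk j j + sq e i j = blk i j)%VS.
  apply/eqP; rewrite eqEsubv subv_add (prod_blk H) (sq_blk H) /=.
  apply: subv_trans (addvSl _ _); apply/subvP => x xP.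
  by rewrite -(blk_r H xP) memv_mul ?(e_blk H).
have := @dim_prod_bound _ _ (N j) b (blk i j) (rad_r e N i j) (sq e i j) (blk j j) 0 (sq e i j).
rewrite BB dimv0 subn0 leq_subLR mulnC; apply=> //.
- exact: sub0v.
- exact: subv_trans (prodvSl _ (N_blk H j)) (prod_blk H _ _ _).
- by rewrite prodv0 subvv.
- exact: (rad_r_blk H).
- rewrite /sq big_distrl /=; apply/subv_sumP => m Um; rewrite (sumv_sup m) //.
  by rewrite -prodvA prodvSr // (prod_blk H).
- by rewrite prodv0 sub0v.
Qed.

End Arrows.

(** * The diagonal algebra and its radical *)

Section Diagonal.
Variables (K : fieldType) (A : falgType K) (L : finType) (e : L -> A).
Variables (he : complete_primitive e) (hd : directed e).
Variables (N : L -> {vspace A}) (h : L -> nat).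
Hypothesis H : local_directed e N h.

Local Notation blk := (blk e).
Local Notation Da := (diag_aspace he).
Local Notation D := (diag_alg he).
Local Notation J := (offdiag_ideal he hd).
Local Notation X := (assoc_graded1 he hd).
Local Notation B := (assoc_graded he hd).
Local Notation cls := (gr_cls J).

Definition deps i : D := vsproj Da (e i).
Definition vsD : 'Hom(D, A) := linfun (@vsval K A Da).
Definition nilrad : {vspace A} := (\sum_i N i)%VS.
Definition drad : {vspace D} := (vsD @^-1: nilrad)%VS.
Definition dblk i : {vspace D} := (vsD @^-1: blk i i)%VS.

Lemma vsDE x : vsD x = vsval x. Proof. exact: lfunE. Qed.

Lemma mem_drad x : (x \in drad) = (vsval x \in nilrad).
Proof. by rewrite -memv_preim vsDE. Qed.

Lemma mem_dblk i x : (x \in dblk i) = (vsval x \in blk i i).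
Proof. by rewrite -memv_preim vsDE. Qed.

Lemma blk_diag i : (blk i i <= Da)%VS.
Proof. by rewrite (sumv_sup i). Qed.

Lemma val_deps i : vsval (deps i) = e i.
Proof. by rewrite vsprojK // (subvP (blk_diag i)) // (e_blk H). Qed.

Lemma vsval1 : vsval (1 : D) = 1.
Proof. by apply/eqP; rewrite -[vsval 1]/(algid Da) algid_eq1 diag_aspace1. Qed.

Lemma diag_e x i : x \in (Da : {vspace A}) -> x * e i = e i * x.
Proof.
move=> /memv_sumP[y yP ->]; rewrite mulr_suml mulr_sumr; apply: eq_bigr => j _.
have yj : y j \in blk j j by apply: yP.
have [<-|ij] := eqVneq j i; first by rewrite (blk_r H yj) (blk_l H yj).
by rewrite -{1}(blk_r H yj) -{2}(blk_l H yj) -mulrA (ld_orth H) // mulrA (ld_orth H) 1?eq_sym // mul0r mulr0.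
Qed.

Lemma diag_eblk x i : x \in (Da : {vspace A}) -> x * e i \in blk i i.
Proof.
by move=> xD; apply: (mem_blkE H); rewrite -?(diag_e _ xD) -?mulrA ?(ld_idem H) //
  mulrA -(diag_e _ xD) -mulrA (ld_idem H).
Qed.

Lemma nilrad_mull x y : x \in (Da : {vspace A}) -> y \in nilrad -> x * y \in nilrad.
Proof.
move=> xD /memv_sumP[z zP ->]; rewrite mulr_sumr; apply: memv_sumr => i _.
rewrite -(blk_l H (subvP (N_blk H i) _ (zP i isT))) mulrA.
by apply: (subvP (ld_mull H i)); rewrite memv_mul ?diag_eblk ?zP.
Qed.

Lemma nilrad_mulr x y : x \in (Da : {vspace A}) -> y \in nilrad -> y * x \in nilrad.
Proof.
move=> xD /memv_sumP[z zP ->]; rewrite mulr_suml; apply: memv_sumr => i _.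
rewrite -(blk_r H (subvP (N_blk H i) _ (zP i isT))) -mulrA -(diag_e _ xD).
by apply: (subvP (ld_mulr H i)); rewrite memv_mul ?diag_eblk ?zP.
Qed.

Lemma N_pow_orth k i : (N i ^+ k.+1 <= blk i i)%VS.
Proof.
elim: k => [|k IHk]; first by rewrite expv1 (N_blk H).
by rewrite expvSl; apply: subv_trans (prodvS (N_blk H i) IHk) (prod_blk H i i i).
Qed.

Lemma nilrad_pow k : (nilrad ^+ k.+1 <= \sum_i N i ^+ k.+1)%VS.
Proof.
elim: k => [|k IHk].
  by rewrite expv1; apply/subv_sumP => i _; rewrite (sumv_sup i) // expv1.
rewrite expvSl; apply: subv_trans (prodvSr _ IHk) _.
rewrite big_distrl /=; apply/subv_sumP => i _; rewrite big_distrr /=.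
apply/subv_sumP => j _; have [<-|ij] := eqVneq i j; last first.
  apply/prodvP => x y /(subvP (N_blk H i)) xi /(subvP (N_pow_orth k j)) yj.
  by rewrite (blkM0 H ij xi yj) mem0v.
by rewrite (sumv_sup i) // [X in (_ <= X)%VS]expvSl.
Qed.

Lemma drad_pow k : (vsD @: (drad ^+ k.+1) <= nilrad ^+ k.+1)%VS.
Proof.
have sub0 : (vsD @: drad <= nilrad)%VS.
  by apply/subvP => _ /memv_imgP[x xr ->]; rewrite vsDE -mem_drad.
elim: k => [|k IHk]; first by rewrite !expv1.
rewrite expvSl [X in (_ <= X)%VS]expvSl.
suff : (drad * drad ^+ k.+1 <= vsD @^-1: (nilrad * nilrad ^+ k.+1))%VS.
  move=> /subvP sub; apply/subvP => _ /memv_imgP[x /sub xr ->]; by rewrite -memv_preim in xr.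
apply/prodvP => x y xr yr; rewrite -memv_preim vsDE.
have -> : vsval (x * y) = vsD x * vsD y by rewrite !vsDE.
by rewrite memv_mul //; [apply: (subvP sub0) | apply: (subvP IHk)]; rewrite memv_img.
Qed.

Lemma drad_nil : exists n, (drad ^+ n = 0)%VS.
Proof.
have [n Nn] := N_nil H; exists n.+1; apply/eqP; rewrite -subv0; apply/subvP => x xr.
have : vsD x \in (\sum_i N i ^+ n.+1)%VS.
  by apply: (subvP (nilrad_pow n)); apply: (subvP (drad_pow n)); rewrite memv_img.
rewrite big1 => [|i _]; last by rewrite expvSl Nn prodv0.
by rewrite !memv0 vsDE => /eqP x0; apply/eqP/subvs_inj.
Qed.

Lemma deps_dec i x : exists c, x * deps i - c *: deps i \in drad.
Proof.
have := diag_eblk i (subvsP x); rewrite (ld_dec H) => /memv_addP[_ /vlineP[c ->] [n nN xE]].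
exists c; rewrite mem_drad.
have -> : vsval (x * deps i - c *: deps i) = vsval x * e i - c *: e i.
  by rewrite -(val_deps i).
by rewrite xE addrC addKr memvE (sumv_sup i) // -memvE.
Qed.

Lemma deps_sum : \sum_i deps i = 1.
Proof.
apply: subvs_inj; rewrite vsval1 -(ld_sum H) linear_sum.
by apply: eq_bigr => i _; apply: val_deps.
Qed.

Lemma deps_mul i j : deps i * deps j = if i == j then deps i else 0.
Proof.
apply: subvs_inj; have -> : vsval (deps i * deps j) = e i * e j.
  by rewrite -(val_deps i) -(val_deps j).
by rewrite (e_mul H); case: eqP => _; rewrite ?val_deps.
Qed.

Lemma deps_comm i x : deps i * x = x * deps i.
Proof.
apply: subvs_inj; have -> : vsval (deps i * x) = e i * vsval x by rewrite -(val_deps i).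
have -> : vsval (x * deps i) = vsval x * e i by rewrite -(val_deps i).
by rewrite diag_e ?subvsP.
Qed.

Lemma mem_dblkE i x : (x \in dblk i) = (x * deps i == x).
Proof.
have xE : vsval (x * deps i) = vsval x * e i by rewrite -(val_deps i).
rewrite mem_dblk; apply/idP/eqP => [xb|xe].
  by apply: subvs_inj; rewrite xE (blk_r H xb).
by rewrite -xe xE diag_eblk ?subvsP.
Qed.

Lemma diag_semiperfect_l : semiperfect *%R deps drad dblk.
Proof.
split.
- exact: mulrA.
- by move=> b c x y; rewrite mulrDl scalerAl.
- by move=> a c x y; rewrite mulrDr scalerAr.
- by move=> i; rewrite deps_mul eqxx.
- by move=> i j /negPf ij; rewrite deps_mul ij.
- exact: deps_sum.
- by move=> a b; rewrite !mem_drad; apply: nilrad_mull; apply: subvsP.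
- by move=> k a b ar br; rewrite expvSr memv_mul.
- exact: drad_nil.
- exact: mem_dblkE.
- by move=> i a; apply: deps_dec.
Qed.

Lemma diag_semiperfect_r : semiperfect (fun a b : D => b * a) deps drad dblk.
Proof.
split.
- by move=> x y z; rewrite mulrA.
- by move=> b c x y; rewrite mulrDr scalerAr.
- by move=> a c x y; rewrite mulrDl scalerAl.
- by move=> i; rewrite deps_mul eqxx.
- by move=> i j /negPf ij; rewrite deps_mul eq_sym ij.
- exact: deps_sum.
- by move=> a b; rewrite !mem_drad; apply: nilrad_mulr; apply: subvsP.
- by move=> k a b ar br; rewrite expvSl memv_mul.
- exact: drad_nil.
- by move=> i a; rewrite mem_dblkE deps_comm.
- by move=> i a; rewrite deps_comm; apply: deps_dec.
Qed.

Lemma dim_dblk i : \dim (dblk i) = \dim (blk i i).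
Proof.
rewrite -(limg_dim_eq (f := vsD)); last by rewrite lker_vsval capv0.
congr (\dim _); apply/vspaceP => x; apply/idP/idP => [/memv_imgP[y yb ->]|xb].
  by rewrite vsDE -mem_dblk.
have xD := subvP (blk_diag i) _ xb; have E : vsval (vsproj Da x) = x by rewrite vsprojK.
by apply/memv_imgP; exists (vsproj Da x); rewrite ?vsDE ?mem_dblk ?E.
Qed.

End Diagonal.

Section PeirceSums.
Variables (K : fieldType) (A : falgType K) (L : finType) (e : L -> A).
Variables (N : L -> {vspace A}) (h : L -> nat).
Hypothesis H : local_directed e N h.

Lemma peirce_blk i j p u : u \in blk e p.1 p.2 ->
  e i * u * e j = if p == (i, j) then u else 0.
Proof.
case: p => k l /= ub; have [<-|ik] := eqVneq k i.
  rewrite (blk_l H ub); have [<-|jl] := eqVneq l j; first by rewrite eqxx (blk_r H ub).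
  rewrite -(blk_r H ub) -mulrA (ld_orth H jl) mulr0.
  by case: eqP => // -[E]; rewrite E eqxx in jl.
rewrite -(blk_l H ub) mulrA (ld_orth H) 1?eq_sym // !mul0r.
by case: eqP => // -[E]; rewrite E eqxx in ik.
Qed.

Lemma dim_blk_sum (P : pred (L * L)) (V : L * L -> {vspace A}) :
  (forall p, P p -> V p <= blk e p.1 p.2)%VS ->
  \dim (\sum_(p | P p) V p) = (\sum_(p | P p) \dim (V p))%N.
Proof.
move=> Vb; suff /directvP -> : directv (\sum_(p | P p) V p) by [].
apply/directv_sum_independent => u uP u0 [i j] Pij.
have : e i * (\sum_(p | P p) u p) * e j = 0 by rewrite u0 mulr0 mul0r.
rewrite mulr_sumr mulr_suml (bigD1 (i, j)) //= big1 ?addr0 => [|p /andP[Pp pij]].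
  by rewrite (@peirce_blk i j (i, j)) ?eqxx // (subvP (Vb _ Pij)) ?uP.
by rewrite (@peirce_blk i j p) ?(negPf pij) // (subvP (Vb _ Pp)) ?uP.
Qed.

Lemma limg_amull_blk (P : pred (L * L)) (V : L * L -> {vspace A}) i :
  (forall p, P p -> V p <= blk e p.1 p.2)%VS ->
  (amull (e i) @: (\sum_(p | P p) V p) = \sum_(p | P p && (p.1 == i)) V p)%VS.
Proof.
move=> Vb; rewrite limg_sum (bigID (fun p => p.1 == i)) /=.
rewrite [X in (_ + X)%VS]big1 ?addv0 => [|p /andP[Pp pi]].
  apply: eq_bigr => p /andP[Pp /eqP pi].
  rewrite -[RHS]lim1g; apply: eq_in_limg => x xV.
  by rewrite id_lfunE lfunE /= -pi (blk_l H (subvP (Vb _ Pp) _ xV)).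
apply/eqP; rewrite -subv0; apply/subvP => _ /memv_imgP[x xV ->].
rewrite lfunE /= -(blk_l H (subvP (Vb _ Pp) _ xV)) mulrA (ld_orth H) 1?eq_sym //.
by rewrite mul0r mem0v.
Qed.

Lemma limg_amulr_blk (P : pred (L * L)) (V : L * L -> {vspace A}) i :
  (forall p, P p -> V p <= blk e p.1 p.2)%VS ->
  (amulr (e i) @: (\sum_(p | P p) V p) = \sum_(p | P p && (p.2 == i)) V p)%VS.
Proof.
move=> Vb; rewrite limg_sum (bigID (fun p => p.2 == i)) /=.
rewrite [X in (_ + X)%VS]big1 ?addv0 => [|p /andP[Pp pi]].
  apply: eq_bigr => p /andP[Pp /eqP pi].
  rewrite -[RHS]lim1g; apply: eq_in_limg => x xV.
  by rewrite id_lfunE lfunE /= -pi (blk_r H (subvP (Vb _ Pp) _ xV)).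
apply/eqP; rewrite -subv0; apply/subvP => _ /memv_imgP[x xV ->].
rewrite lfunE /= -(blk_r H (subvP (Vb _ Pp) _ xV)) -mulrA (ld_orth H) //.
by rewrite mulr0 mem0v.
Qed.

End PeirceSums.

Section Degree1.
Variables (K : fieldType) (A : falgType K) (L : finType) (e : L -> A).
Variables (he : complete_primitive e) (hd : directed e).
Variables (N : L -> {vspace A}) (h : L -> nat).
Hypothesis H : local_directed e N h.

Local Notation eB := (assoc_graded_idem he hd).
Local Notation blkB := (blk eB).
Local Notation blk := (blk e).
Local Notation Da := (diag_aspace he).
Local Notation D := (diag_alg he).
Local Notation J := (offdiag_ideal he hd).
Local Notation X := (assoc_graded1 he hd).
Local Notation Xr := (bimod_right X).
Local Notation B := (assoc_graded he hd).
Local Notation cls := (gr_cls J).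
Local Notation deps := (deps he).
Local Notation drad := (drad he N).
Local Notation dblk := (dblk he).

Definition vsX : 'Hom(X, B) := linfun (@vsval K B (gr_part J 1)).

Lemma vsXE x : vsX x = vsval x. Proof. exact: lfunE. Qed.

Lemma vsX_act a x : vsX (act X a x) = cls 0 (vsval a) * vsX x.
Proof. by rewrite !vsXE /= (lfunE (@gr_lact_fun _ _ _ _ _)) gr_lactE. Qed.

Lemma vsX_ract a x : vsX (ract X a x) = vsX x * cls 0 (vsval a).
Proof. by rewrite !vsXE /= (lfunE (@gr_ract_fun _ _ _ _ _)) gr_ractE. Qed.

Lemma vsX_inj : injective vsX.
Proof. by move=> x y; rewrite !vsXE; apply: subvs_inj. Qed.

Lemma dim_vsX U : \dim (vsX @: U) = \dim U.
Proof. by apply: limg_dim_eq; rewrite lker_vsval capv0. Qed.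

Lemma limg_vsX : limg vsX = (\sum_(p : L * L | p.1 != p.2) cls 1 @: blk p.1 p.2)%VS.
Proof.
rewrite limg_vsval /gr_part ipow1 limg_sum.
under eq_bigr do rewrite limg_sum.
by rewrite (exchange_big_dep xpredT) //= pair_big_dep.
Qed.

Lemma cls1_blk p : p.1 != p.2 -> (cls 1 @: blk p.1 p.2 <= blkB p.1 p.2)%VS.
Proof. by move=> op; rewrite (blk_gr1 _ _ H op) addvSl. Qed.

Lemma dim_cls1 p (V : {vspace A}) : p.1 != p.2 -> (sq e p.1 p.2 <= V)%VS -> (V <= blk p.1 p.2)%VS ->
  \dim (cls 1 @: V) = (\dim V - \dim (sq e p.1 p.2))%N.
Proof.
move=> op sV Vb; have V1 := subv_trans Vb (blk_ipow1 he hd H op).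
rewrite -(dim_cls V1); suff -> : (V :&: ipow J 2 = sq e p.1 p.2)%VS by rewrite addnK.
apply/vspaceP => x; rewrite -(jpow2 he hd H op) (mem_jpowE _ _ H) memv_cap.
apply/andP/andP => [[xV x2]|[x2 xb]]; first by rewrite (subvP Vb).
by split=> //; apply: (subvP sV); rewrite -(jpow2 he hd H op) (mem_jpowE _ _ H) x2.
Qed.

Lemma limg_vsD : (vsD he @: drad = nilrad N)%VS.
Proof.
apply/vspaceP => x; apply/idP/idP => [/memv_imgP[y yr ->]|xN].
  by rewrite vsDE -mem_drad.
have xD : x \in (Da : {vspace A}).
  apply: subvP xN; apply/subv_sumP => i _; exact: subv_trans (N_blk H i) (blk_diag he i).
have E : vsval (vsproj Da x) = x by rewrite vsprojK.
by apply/memv_imgP; exists (vsproj Da x); rewrite ?vsDE ?mem_drad E.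
Qed.

Lemma vsX_actv (U : {vspace D}) (W : {vspace X}) :
  (vsX @: (actv U W : {vspace X}) = cls 0 @: (vsD he @: U) * vsX @: W)%VS.
Proof.
apply: subv_anti; apply/andP; split.
  suff sub : (actv U W <= vsX @^-1: (cls 0 @: (vsD he @: U) * vsX @: W))%VS.
    by apply/subvP => _ /memv_imgP[x /(subvP sub) xa ->]; rewrite memv_preim.
  apply: actv_sub => a y aU yW; rewrite -memv_preim vsX_act memv_mul ?memv_img //.
  by rewrite -vsDE memv_img.
apply/prodvP => _ _ /memv_imgP[_ /memv_imgP[a aU ->] ->] /memv_imgP[y yW ->].
by rewrite vsDE -vsX_act memv_img // mem_actv.
Qed.

Lemma vsX_actv_r (U : {vspace D}) (W : {vspace X}) :
  (vsX @: (actv U (W : {vspace Xr}) : {vspace Xr}) = vsX @: W * cls 0 @: (vsD he @: U))%VS.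
Proof.
apply: subv_anti; apply/andP; split.
  suff sub : (actv U (W : {vspace Xr}) <= vsX @^-1: (vsX @: W * cls 0 @: (vsD he @: U)))%VS.
    by apply/subvP => _ /memv_imgP[x /(subvP sub) xa ->]; rewrite memv_preim.
  apply: actv_sub => a y aU yW; rewrite -memv_preim vsX_ract memv_mul ?memv_img //.
  by rewrite -vsDE memv_img.
apply/prodvP => _ _ /memv_imgP[y yW ->] /memv_imgP[_ /memv_imgP[a aU ->] ->].
rewrite vsDE -vsX_ract memv_img //; exact: (mem_actv (M := Xr)).
Qed.

Lemma dim_graded1 : \dim {:X} = (\sum_(p : L * L | p.1 != p.2) (\dim (blk p.1 p.2) - \dim (sq e p.1 p.2)))%N.
Proof.
rewrite -dim_vsX limg_vsX (dim_blk_sum (graded_local he hd H)); last exact: cls1_blk.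
by apply: eq_bigr => p op; rewrite (dim_cls1 op) ?(sq_blk H).
Qed.

Lemma limg_vsX_radm : (vsX @: (radm drad X : {vspace X}) = \sum_(p : L * L | p.1 != p.2) cls 1 @: rad_l e N p.1 p.2)%VS.
Proof.
have clsE p : p.1 != p.2 -> (cls 1 @: rad_l e N p.1 p.2 = cls 0 @: N p.1 * cls 1 @: blk p.1 p.2)%VS.
  by move=> op; rewrite (cls01_prod he hd H op) limgD (cls1_sq he hd H op) add0v.
rewrite vsX_actv limg_vsD limg_vsX /nilrad limg_sum; apply: subv_anti; apply/andP; split.
  rewrite big_distrl /=; apply/subv_sumP => i _; rewrite big_distrr /=.
  apply/subv_sumP => p op; have [->|ip] := eqVneq i p.1; first by rewrite (sumv_sup p) // clsE.
  apply/prodvP => _ _ /memv_imgP[x xN ->] /memv_imgP[y yb ->].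
  rewrite clsM ?memvf ?(subvP (blk_ipow1 he hd H op)) //.
  by rewrite (blkM0 H ip (subvP (N_blk H i) _ xN) yb) linear0 mem0v.
apply/subv_sumP => p op; rewrite clsE // prodvS //; first by rewrite (sumv_sup p.1).
by rewrite (sumv_sup p).
Qed.

Lemma limg_vsX_radm_r :
  (vsX @: (radm drad Xr : {vspace Xr}) = \sum_(p : L * L | p.1 != p.2) cls 1 @: rad_r e N p.1 p.2)%VS.
Proof.
have clsE p : p.1 != p.2 -> (cls 1 @: rad_r e N p.1 p.2 = cls 1 @: blk p.1 p.2 * cls 0 @: N p.2)%VS.
  by move=> op; rewrite (cls10_prod he hd H op) limgD (cls1_sq he hd H op) add0v.
rewrite vsX_actv_r limg_vsD limg_vsX /nilrad limg_sum; apply: subv_anti; apply/andP; split.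
  rewrite big_distrl /=; apply/subv_sumP => p op; rewrite big_distrr /=.
  apply/subv_sumP => i _; have [->|ip] := eqVneq i p.2; first by rewrite (sumv_sup p) // clsE.
  apply/prodvP => _ _ /memv_imgP[y yb ->] /memv_imgP[x xN ->].
  rewrite clsM ?memvf ?(subvP (blk_ipow1 he hd H op)) // eq_sym in ip *.
  by rewrite (blkM0 H ip yb (subvP (N_blk H i) _ xN)) linear0 mem0v.
apply/subv_sumP => p op; rewrite clsE // prodvS //; first by rewrite (sumv_sup p).
by rewrite (sumv_sup p.2).
Qed.

Lemma vsX_act_img a (U : {vspace X}) :
  (vsX @: (act X a @: U) = amull (cls 0 (vsval a)) @: (vsX @: U))%VS.
Proof.
rewrite -!limg_comp; apply: eq_in_limg => x _.
by rewrite !comp_lfunE vsX_act [RHS]lfunE.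
Qed.

Lemma vsX_ract_img a (U : {vspace X}) :
  (vsX @: (ract X a @: U) = amulr (cls 0 (vsval a)) @: (vsX @: U))%VS.
Proof.
rewrite -!limg_comp; apply: eq_in_limg => x _.
by rewrite !comp_lfunE vsX_ract [RHS]lfunE.
Qed.

Lemma pair_fst (F : L * L -> nat) i :
  (\sum_(p : L * L | (p.1 != p.2) && (p.1 == i)) F p = \sum_(j | i != j) F (i, j))%N.
Proof.
have := pair_big_dep (op := addn) (pred1 i) (fun i j => i != j) (fun i j => F (i, j)).
rewrite big_pred1_eq => ->.
by apply: eq_big => -[k l] //=; rewrite andbC.
Qed.

Lemma pair_snd (F : L * L -> nat) j :
  (\sum_(p : L * L | (p.1 != p.2) && (p.2 == j)) F p = \sum_(i | i != j) F (i, j))%N.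
Proof.
have := pair_big_dep (op := addn) xpredT (fun i l => (i != l) && (l == j)) (fun i j => F (i, j)).
move=> E; transitivity (\sum_i \sum_(l | (i != l) && (l == j)) F (i, l))%N.
  by rewrite E; apply: eq_big => -[].
rewrite [RHS]big_mkcond; apply: eq_bigr => i _.
rewrite big_mkcondl big_pred1_eq //.
Qed.

Lemma topdim_graded1 i : topdim deps drad X i = (\sum_j mult e N i j)%N.
Proof.
rewrite /topdim -!dim_vsX !vsX_act_img limg_vsX limg_vsX_radm (val_deps he H).
have GL := graded_local he hd H.
have rl p : p.1 != p.2 -> (cls 1 @: rad_l e N p.1 p.2 <= blkB p.1 p.2)%VS.
  by move=> op; apply: subv_trans (cls1_blk op); rewrite limgS ?(rad_l_blk H).
rewrite (limg_amull_blk GL _ cls1_blk) (limg_amull_blk GL _ rl).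
rewrite !(dim_blk_sum GL) => [|p /andP[op _]|p /andP[op _]]; [|exact: rl|exact: cls1_blk].
rewrite !pair_fst -sumnB => [|j ij]; last by rewrite dimvS // limgS // (rad_l_blk H).
rewrite [RHS](bigD1 i) //= mult_diag add0n.
apply: eq_big => [j|j ij]; first by rewrite eq_sym.
rewrite multE // !(@dim_cls1 (i, j)) ?(sq_blk H) ?(rad_l_blk H) ?addvSl //=.
by rewrite subnBA ?subnK ?dimvS ?(sq_blk H) ?addvSl.
Qed.

Lemma topdim_graded1_r j :
  topdim deps drad Xr j = (\sum_(i | i != j) (\dim (blk i j) - \dim (rad_r e N i j)))%N.
Proof.
rewrite /topdim -!dim_vsX !vsX_ract_img limg_vsX limg_vsX_radm_r (val_deps he H).
have GL := graded_local he hd H.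
have rr p : p.1 != p.2 -> (cls 1 @: rad_r e N p.1 p.2 <= blkB p.1 p.2)%VS.
  by move=> op; apply: subv_trans (cls1_blk op); rewrite limgS ?(rad_r_blk H).
rewrite (limg_amulr_blk GL _ cls1_blk) (limg_amulr_blk GL _ rr).
rewrite !(dim_blk_sum GL) => [|p /andP[op _]|p /andP[op _]]; [|exact: rr|exact: cls1_blk].
rewrite !pair_snd -sumnB => [|i ij]; last by rewrite dimvS // limgS // (rad_r_blk H).
apply: eq_bigr => i ij.
rewrite !(@dim_cls1 (i, j)) ?(sq_blk H) ?(rad_r_blk H) ?addvSl //=.
by rewrite subnBA ?subnK ?dimvS ?(sq_blk H) ?addvSl.
Qed.

Lemma sum_off (F : L -> L -> nat) :
  (\sum_(p : L * L | p.1 != p.2) F p.1 p.2 = \sum_i \sum_(j | i != j) F i j)%N.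
Proof. by rewrite pair_big_dep. Qed.

Lemma sum_mult (F : L -> nat) :
  (\sum_i F i * \sum_j mult e N i j = \sum_(p : L * L | p.1 != p.2) F p.1 * mult e N p.1 p.2)%N.
Proof.
rewrite [RHS](sum_off (fun i j => F i * mult e N i j)%N); apply: eq_bigr => i _; rewrite big_distrr /= (bigD1 i) //=.
rewrite mult_diag muln0 add0n; by apply: eq_bigl => j; rewrite eq_sym.
Qed.

Lemma eq_sum_le (I : finType) (P : pred I) (F G : I -> nat) :
  (forall i, P i -> F i <= G i)%N ->
  (\sum_(i | P i) F i = \sum_(i | P i) G i)%N <-> (forall i, P i -> F i = G i).
Proof.
move=> FG; split=> [E i Pi|E]; last exact: eq_bigr.
have := leqif_sum (fun i Pi => (conj (FG i Pi) (erefl (F i == G i)) : F i <= G i ?= iff (F i == G i))%N).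
by case=> _; rewrite E eqxx => /esym/forall_inP/(_ i Pi)/eqP.
Qed.

Definition arrows_left_free_on : Prop := forall i j, i != j ->
  (\dim (blk i j) - \dim (sq e i j) = \dim (blk i i) * mult e N i j)%N.

(** The bound [arrows_left_le] holds pair by pair, so the single equality of sums given by
    [projective_iff] is an equality for every pair. *)
Lemma projective_graded1 : projective X <-> arrows_left_free_on.
Proof.
rewrite (projective_iff (diag_semiperfect_l he H) (@mul1r _)) dim_graded1.
under eq_bigr do rewrite topdim_graded1 (dim_dblk he).
rewrite (sum_mult (fun i => \dim (blk i i))) eq_sum_le; last by move=> p; apply: (arrows_left_le H).
split=> E => [i j ij|[i j]]; [exact: (E (i, j))|exact: E].
Qed.

Lemma projective_graded1_r : projective Xr <-> arrows_right_free e N.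
Proof.
rewrite (projective_iff (diag_semiperfect_r he H) (@mulr1 _)) [X in X = _]dim_graded1.
under eq_bigr do rewrite topdim_graded1_r (dim_dblk he) big_distrr /=.
rewrite (exchange_big_dep xpredT) //= -(sum_off (fun i j => _)).
rewrite eq_sum_le; last by move=> p; apply: (arrows_right_le H).
split=> E => [i j ij|[i j]]; [exact: (E (i, j))|exact: E].
Qed.

End Degree1.

(** * Tensor powers *)

Section TensorFree.
Variables (K : fieldType) (D : falgType K) (I : finType) (eps : I -> D).
Variables (rd : {vspace D}) (pd : I -> {vspace D}).
Hypothesis H : semiperfect *%R eps rd pd.
Variables (X : bimodule D) (TX : finType) (lX jX : TX -> I) (bX : TX -> X).
Hypothesis X_free : free_on eps pd xpredT lX bX.
Hypothesis bX_r : forall t, ract X (eps (jX t)) (bX t) = bX t.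

Let eps_mul i j : eps i * eps j = if i == j then eps i else 0.
Proof. by case: eqVneq => [->|ij]; [apply: (sp_idem H)|apply: (sp_orth H)]. Qed.

Let pd_eps i a : a \in pd i -> a * eps i = a.
Proof. by rewrite (sp_proj H) => /eqP. Qed.

Lemma ract_eps i t : ract X (eps i) (bX t) = if jX t == i then bX t else 0.
Proof.
rewrite -{1}bX_r -comp_lfunE -ractM eps_mul; case: eqP => _; last by rewrite linear0 zero_lfunE.
by rewrite bX_r.
Qed.

Section Step.
Variables (Y : lmodule D) (TY : finType) (P : pred TY) (lY : TY -> I) (bY : TY -> Y).
Hypothesis Y_free : free_on eps pd P lY bY.

Let Z := tensor_mod X Y.
Let bZ (p : TX * TY) : Z := tensor (bX p.1) (bY p.2).
Let PZ (p : TX * TY) := P p.2 && (jX p.1 == lY p.2).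

(** Scalars moved across the tensor sign are absorbed on the left, and [bX t] survives
    multiplication by an idempotent only if it is that of [jX t]; so only pairs with matching inner
    idempotents remain. *)
Lemma tensor_based : based eps pd PZ (fun p => lX p.1) bZ.
Proof.
have [[eX sX] _] := X_free; have [[eY sY] _] := Y_free.
split=> [p _|]; first by rewrite act_tensor eX.
set S := (\sum_(p | PZ p) _)%VS.
have [bl br] := @tensor_bilinear _ _ X Y.
have key x s : P s -> tensor (ract X (eps (lY s)) x) (bY s) \in S.
  move=> Ps; have /memv_sumP[y yP ->] := sX x.
  pose f := lfun_of (bl (bY s)).
  have fE u : f u = tensor u (bY s) by rewrite lfun_ofE.
  rewrite -fE !linear_sum; apply: memv_suml => t _ /=.
  have /memv_imgP[d dl ->] := yP t isT; rewrite orbmE fE -act_ract ract_eps.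
  case: eqP => [jt|_]; last by rewrite linear0 -fE linear0 mem0v.
  rewrite memvE (sumv_sup (t, s)) ?/PZ /= ?Ps ?jt ?eqxx // -memvE.
  by rewrite -act_tensor -[act _ d _]orbmE memv_img.
elim/tensor_ext => [c z z' zS z'S||x y]; first by rewrite memvD ?memvZ.
  exact: mem0v.
have /memv_sumP[w wP ->] := sY y.
pose f := lfun_of (br x).
have fE u : f u = tensor x u by rewrite lfun_ofE.
rewrite -fE linear_sum; apply: memv_suml => s Ps /=.
have /memv_imgP[d dl ->] := wP s Ps; rewrite orbmE fE -tensor_balanced.
by rewrite -(pd_eps dl) ractM comp_lfunE key.
Qed.

(** A lower bound for the dimension of a quotient needs a map out of it. The coordinate functions
    dual to the two bases combine to a balanced map whose image contains the sum of the [pd (lX t)]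
    over the matching pairs. *)
Lemma tensor_free : free_on eps pd PZ (fun p => lX p.1) bZ.
Proof.
split; first exact: tensor_based.
have [[eX sX] _] := X_free; have [[eY sY] _] := Y_free.
have dualX t : exists c : 'Hom(X, D), (forall a x, c (act X a x) = a * c x) /\
    forall t', c (bX t') = if t' == t then eps (lX t) else 0.
  have [|g gh gE] := @free_hom _ _ _ _ _ _ _ H _ _ _ X (regmod D) bX (fun t' => if t' == t then eps (lX t) else 0) X_free.
    by move=> t' _; rewrite regmodE; case: eqP => [->|_]; rewrite ?mulr0 // eps_mul eqxx.
  by exists g; split=> [a x|t']; [rewrite gh regmodE | apply: gE].
have dualY s : exists c : 'Hom(Y, D), (forall a x, c (act Y a x) = a * c x) /\
    forall s', P s' -> c (bY s') = if s' == s then eps (lY s) else 0.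
  have [|g gh gE] := @free_hom _ _ _ _ _ _ _ H _ _ _ Y (regmod D) bY (fun t' => if t' == s then eps (lY s) else 0) Y_free.
    by move=> t' _; rewrite regmodE; case: eqP => [->|_]; rewrite ?mulr0 // eps_mul eqxx.
  by exists g; split=> [a x|t']; [rewrite gh regmodE | apply: gE].
have /fin_all_exists[cX cXP] := dualX; have /fin_all_exists[cY cYP] := dualY.
pose f (x : X) (y : Y) : {ffun TX * TY -> D} :=
  [ffun p => cX p.1 (ract X (cY p.2 y) x)].
have f_bil : bilinear_map f.
  split=> [y c x x'|x c y y']; apply/ffunP => p; rewrite !ffunE !linearP //=.
  by rewrite add_lfunE scale_lfunE linearP.
have f_bal x a y : f (ract X a x) y = f x (act Y a y).
  apply/ffunP => p; rewrite !ffunE; have [-> _] := cYP p.2.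
  by rewrite ractM comp_lfunE.
pose F : 'Hom(Z, {ffun TX * TY -> D}) := lfun_of (@tensor_lift_linear _ _ X Y _ f).
have FE x y : F (tensor x y) = f x y by rewrite lfun_ofE tensor_liftE.
rewrite -(dim_ffun_single PZ (fun p => pd (lX p.1))).
apply: leq_trans (dimv_img_le F fullv); apply/dimvS/subv_sumP => -[t s] /andP[Ps /eqP /= jt].
apply/subvP => _ /memv_imgP[d dl ->]; apply/memv_imgP; exists (tensor (act X d (bX t)) (bY s)).
  exact: memvf.
rewrite FE; apply/ffunP => -[t' s']; rewrite ffun_singleE ffunE /=.
have [_ ->//] := cYP s'; rewrite xpair_eqE eq_sym [X in _ && X]eq_sym.
have [ss|ss] := eqVneq s s'; last by rewrite andbF linear0 zero_lfunE linear0.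
rewrite -act_ract -ss ract_eps jt eqxx; have [-> ->] := cXP t'.
by rewrite andbT; case: eqP => [<-|_]; rewrite ?mulr0 // pd_eps.
Qed.

End Step.

Definition tensor_step (phi : I -> nat) (j : I) : nat :=
  (\sum_(t | jX t == j) phi (lX t))%N.

Lemma regmod_free : free_on eps pd xpredT id (eps : I -> regmod D).
Proof.
split; first split=> [i _|x]; first by rewrite regmodE eps_mul eqxx.
  rewrite -[x]mulr1 -(sp_sum H) mulr_sumr; apply: memv_sumr => i _ /=.
  rewrite -[x * _](pd_eps (i := i)) ?mul_pd ?(eps_pd H) //; last exact: (mul_pd H _ (eps_pd H i)).
  rewrite -[X in X \in _]regmodE -orbmE memv_img //; exact: (mul_pd H _ (eps_pd H i)).
rewrite (@dim_idem_sum _ _ I (fun i => amulr (eps i)) fullv).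
- apply: leq_sum => i _; apply/dimvS/subvP => x xp; apply/memv_imgP; exists x.
    exact: memvf.
  by rewrite lfunE /= pd_eps.
- by move=> x; under eq_bigr do rewrite lfunE /=; rewrite -mulr_sumr (sp_sum H) mulr1.
- by move=> i j x ij; rewrite !lfunE /= -mulrA (sp_orth H) 1?eq_sym // mulr0.
- by move=> i; apply: subvf.
Qed.

(** The count is stated for every weight [phi], because the induction replaces [phi] by
    [tensor_step phi]. *)
Lemma tpow_free n : exists (T : finType) (P : pred T) (l : T -> I) (b : T -> tpow X n),
  free_on eps pd P l b /\
  forall phi : I -> nat, (\sum_(t | P t) phi (l t) = \sum_j iter n tensor_step phi j)%N.
Proof.
elim: n => [|n [T [P [l [b [bF bS]]]]]].
  by exists I, xpredT, id, (eps : I -> regmod D); split=> //; apply: regmod_free.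
do 4 eexists; split; first exact: (tensor_free bF).
move=> phi; rewrite iterSr -bS.
have -> := pair_big_dep (op := addn) P (fun s t => jX t == l s) (fun s t => phi (lX t)).
rewrite [RHS](reindex (fun p : TX * T => (p.2, p.1))) //.
by exists (fun p => (p.2, p.1)) => -[].
Qed.

Lemma dim_tpow n : \dim {:tpow X n} = (\sum_j iter n tensor_step (fun i => \dim (pd i)) j)%N.
Proof.
have [T [P [l [b [[bb bd] bS]]]]] := tpow_free n.
by rewrite -bS; apply/eqP; rewrite eqn_leq bd (based_dim bb).
Qed.

End TensorFree.

(** * A basis of arrows for J / J^2 *)

Section ArrowBasis.
Variables (K : fieldType) (A : falgType K) (L : finType) (e : L -> A).
Variables (he : complete_primitive e) (hd : directed e).
Variables (N : L -> {vspace A}) (h : L -> nat).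
Hypothesis H : local_directed e N h.

Local Notation blk := (blk e).
Local Notation Da := (diag_aspace he).
Local Notation D := (diag_alg he).
Local Notation J := (offdiag_ideal he hd).
Local Notation X := (assoc_graded1 he hd).
Local Notation cls := (gr_cls J).
Local Notation deps := (deps he).
Local Notation dblk := (dblk he).
Local Notation vsX := (vsX he hd).
Local Notation gen p := (gen_space e N p.1 p.2).

(** Indexes lifts of bases of the tops of the e_i (J / J^2) e_j. Here [arrow_src] is the index [i]
    of the left idempotent and [arrow_tgt] the index [j] of the right one. *)
Definition arrow : finType := {p : L * L & 'I_(\dim (gen p))}.
Definition arrow_src (t : arrow) : L := (tag t).1.
Definition arrow_tgt (t : arrow) : L := (tag t).2.
Definition arrow_rep (t : arrow) : A := (vbasis (gen (tag t)))`_(tagged t).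
Definition arrow_elt (t : arrow) : X := vsproj (gr_part J 1) (cls 1 (arrow_rep t)).

Lemma gen_blk i j : (gen_space e N i j <= blk i j)%VS.
Proof. by rewrite /gen_space; case: eqP => _; [apply: sub0v | apply: diffvSl]. Qed.

Lemma arrow_rep_gen t : arrow_rep t \in gen (tag t).
Proof. by apply/vbasis_mem/mem_nth; rewrite size_tuple. Qed.

Lemma arrow_rep_blk t : arrow_rep t \in blk (arrow_src t) (arrow_tgt t).
Proof. exact: subvP (gen_blk _ _) _ (arrow_rep_gen t). Qed.

Lemma arrow_off (t : arrow) : arrow_src t != arrow_tgt t.
Proof.
case: t => [[i j] s]; rewrite /arrow_src /arrow_tgt /=; apply/eqP => ij.
by case: s => s /=; rewrite /gen_space ij eqxx dimv0.
Qed.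

Lemma arrow_rep_J t : arrow_rep t \in ipow J 1.
Proof. exact: subvP (blk_ipow1 he hd H (arrow_off t)) _ (arrow_rep_blk t). Qed.

Lemma vsX_arrow t : vsX (arrow_elt t) = cls 1 (arrow_rep t).
Proof. by rewrite vsXE vsprojK // memv_img // arrow_rep_J. Qed.

Lemma act_arrow t : act X (deps (arrow_src t)) (arrow_elt t) = arrow_elt t.
Proof.
apply: vsX_inj; rewrite vsX_act vsX_arrow (val_deps he H) clsM ?memvf ?arrow_rep_J //.
by rewrite (blk_l H (arrow_rep_blk t)).
Qed.

Lemma ract_arrow t : ract X (deps (arrow_tgt t)) (arrow_elt t) = arrow_elt t.
Proof.
apply: vsX_inj; rewrite vsX_ract vsX_arrow (val_deps he H) clsM ?memvf ?arrow_rep_J //.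
by rewrite (blk_r H (arrow_rep_blk t)).
Qed.

Lemma sum_arrow (F : L -> L -> nat) :
  (\sum_(t : arrow) F (arrow_src t) (arrow_tgt t) = \sum_i \sum_j F i j * mult e N i j)%N.
Proof.
rewrite pair_big_dep /=.
transitivity (\sum_(p : L * L) \sum_(s < \dim (gen p)) F p.1 p.2)%N.
  by rewrite (sig_big_dep (op := addn) xpredT (fun _ _ => true)).
by apply: eq_big => [[]//|[i j] _]; rewrite sum_nat_const card_ord (dim_gen_space H) mulnC.
Qed.

Lemma arrow_based : based deps dblk xpredT arrow_src arrow_elt.
Proof.
split=> [t _|x]; first exact: act_arrow.
set S := (\sum_(t | xpredT t) _)%VS.
suff /subvP/(_ (vsX x)) : (limg vsX <= vsX @: S)%VS.
  by rewrite memv_img ?memvf // => /(_ isT) /memv_imgP[y yS /vsX_inj ->].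
rewrite limg_vsX; apply/subv_sumP => -[i j] /= ij.
rewrite (blk_gen_space H ij) limgD (cls1_sq he hd H ij) addv0.
apply/subvP => _ /memv_imgP[z zP ->]; rewrite memv_preim.
suff /subvP/(_ _ zP) : (blk i i * gen_space e N i j <= cls 1 @^-1: (vsX @: S))%VS.
  by rewrite -!memv_preim.
apply/prodvP => a g ab gg; rewrite -memv_preim.
rewrite (coord_vbasis gg) mulr_sumr linear_sum; apply: memv_suml => s _ /=.
rewrite -scalerAr linearZ memvZ //=.
pose t : arrow := existT _ (i, j) s.
have aD := subvP (blk_diag he i) _ ab; have aE : vsval (vsproj Da a) = a by rewrite vsprojK.
have -> : cls 1 (a * (vbasis (gen_space e N i j))`_s) = vsX (orbm (arrow_elt t) (vsproj Da a)).
  by rewrite orbmE vsX_act vsX_arrow aE clsM ?memvf ?arrow_rep_J.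
by rewrite memv_img // memvE (sumv_sup t) // -memvE memv_img // mem_dblk aE.
Qed.

Lemma arrow_free : arrows_left_free_on e N -> free_on deps dblk xpredT arrow_src arrow_elt.
Proof.
move=> XL; split; first exact: arrow_based.
rewrite (sum_arrow (fun i _ => \dim (dblk i))) (dim_graded1 he hd H).
rewrite (sum_off (fun i j => \dim (blk i j) - \dim (sq e i j))%N) leq_sum // => i _.
rewrite (bigD1 i) //= mult_diag muln0 add0n.
under eq_bigl do rewrite eq_sym.
by apply: leq_sum => j ij; rewrite XL // (dim_dblk he).
Qed.

(** The operator tau: the effect on dimension vectors of tensoring once more with J / J^2. *)
Definition mult_step (phi : L -> nat) (j : L) : nat := (\sum_i phi i * mult e N i j)%N.

Lemma dim_tpow_graded n : arrows_left_free_on e N ->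
  \dim {:tpow X n} = (\sum_j iter n mult_step (fun i => \dim (blk i i)) j)%N.
Proof.
move=> XL; rewrite (dim_tpow (diag_semiperfect_l he H) (arrow_free XL) ract_arrow).
have step phi phi' j : phi =1 phi' -> tensor_step arrow_src arrow_tgt phi j = mult_step phi' j.
  move=> pp; rewrite /tensor_step /mult_step big_mkcond /=.
  rewrite (sum_arrow (fun i l => if l == j then phi i else 0)%N); apply: eq_bigr => i _.
  rewrite (bigD1 j) //= eqxx big1 ?addn0 ?pp // => l /negPf ->; exact: mul0n.
apply: eq_bigr => j _; elim: n j => [|n IHn] j /=; first exact: dim_dblk.
exact: step.
Qed.

End ArrowBasis.

(** * The canonical map from the tensor algebra *)

Section CanonicalMap.
Variables (K : fieldType) (A : falgType K) (L : finType) (e : L -> A).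
Variables (he : complete_primitive e) (hd : directed e).

Local Notation Da := (diag_aspace he).
Local Notation D := (diag_alg he).
Local Notation J := (offdiag_ideal he hd).
Local Notation X := (assoc_graded1 he hd).
Local Notation B := (assoc_graded he hd).
Local Notation cls := (gr_cls J).
Local Notation vsX := (vsX he hd).
Local Notation vsD := (vsD he).

Fixpoint can n : 'Hom(tpow X n, B) :=
  match n return 'Hom(tpow X n, B) with
  | 0 => (cls 0 \o vsD)%VF
  | m.+1 => lfun_of (@tensor_lift_linear _ _ X (tpow X m) _ (fun x s => vsX x * can m s))
  end.

Lemma can0 (a : D) : can 0 a = cls 0 (vsval a).
Proof. by rewrite comp_lfunE vsDE. Qed.

Lemma can_act n (b : D) (s : tpow X n) :
  can n (act (tpow X n) b s) = cls 0 (vsval b) * can n s.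
Proof.
elim: n b s => [|n IHn] b s; first by rewrite regmodE !can0 clsM ?memvf.
have f_bil : bilinear_map (fun (x : X) (s : tpow X n) => vsX x * can n s).
  split=> [t c x x'|x c t t']; first by rewrite linearP mulrDl scalerAl.
  by rewrite linearP mulrDr scalerAr.
have f_bal (x : X) a (t : tpow X n) :
    vsX (ract X a x) * can n t = vsX x * can n (act (tpow X n) a t).
  by rewrite IHn vsX_ract mulrA.
have canE x t : can n.+1 (tensor x t) = vsX x * can n t by rewrite lfun_ofE tensor_liftE.
elim/tensor_ext: s => [c s s' Es Es'||x t].
- by rewrite !linearP /= Es Es' mulrDr scalerAr.
- by rewrite !linear0 mulr0.
- by rewrite act_tensor !canE vsX_act mulrA.
Qed.

Lemma canS n x (s : tpow X n) : can n.+1 (tensor x s) = vsX x * can n s.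
Proof.
rewrite lfun_ofE tensor_liftE // => [|y a t]; last by rewrite can_act vsX_ract mulrA.
split=> [t c y y'|y c t t']; first by rewrite linearP mulrDl scalerAl.
by rewrite linearP mulrDr scalerAr.
Qed.

Lemma canM m n (s : tpow X m) (t : tpow X n) :
  can (m + n) (tmul s t) = can m s * can n t.
Proof.
elim: m s => [|m IHm] s; first by rewrite can0 -can_act.
have [lin _ _] := tmul_props X m.+1 n.
have lin0 : tmul (0 : tpow X m.+1) t = 0.
  by have := lin t (-1) 0 0; rewrite scaler0 addr0 scaleN1r addNr.
elim/tensor_ext: s => [c s s' Es Es'||x s].
- by rewrite lin !linearP /= Es Es' mulrDl scalerAl.
- by rewrite lin0 !linear0 mul0r.
- by rewrite tmulS !canS IHm mulrA.
Qed.

(** The induction uses J^(n+1) = J J^n. In degree 0 the off-diagonal components vanish modulo [J],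
    so A_0 already covers A / J. *)
Lemma limg_can n : limg (can n) = gr_part J n.
Proof.
elim: n => [|n IHn].
  apply: subv_anti; apply/andP; split; apply/subvP => _ /memv_imgP[x _ ->].
    by rewrite can0 memv_img ?memvf.
  rewrite (peirce he x) linear_sum; apply: memv_suml => l _; rewrite linear_sum.
  apply: memv_suml => m _ /=; have xh := cat_hom_mem e l m x.
  have [lm|lm] := eqVneq l m; last first.
    rewrite cls_lower ?mem0v // /ipow expv1; exact: subvP (cat_hom_sub e lm) _ xh.
  have xD : e m * x * e l \in (Da : {vspace A}).
    by apply: subvP xh; rewrite lm; apply: blk_diag.
  apply/memv_imgP; exists (vsproj Da (e m * x * e l)); first exact: memvf.
  by rewrite can0 vsprojK.
apply: subv_anti; apply/andP; split.
  apply/subvP => _ /memv_imgP[s _ ->]; elim/tensor_ext: s => [c s s' Es Es'||x s].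
  - by rewrite linearP memvD ?memvZ.
  - by rewrite linear0 mem0v.
  rewrite canS vsXE; apply: gr_partM (subvsP x) _.
  by rewrite -IHn memv_img ?memvf.
rewrite /gr_part ipowSl; apply/subvP => _ /memv_imgP[z zP ->]; rewrite memv_preim.
apply: subvP zP; apply/prodvP => u v uJ vn; rewrite -memv_preim.
have u1 : u \in ipow J 1 by rewrite /ipow expv1.
have : cls n v \in limg (can n) by rewrite IHn memv_img.
case/memv_imgP => s _ vE; rewrite -add1n -clsM // vE.
have uE : vsX (vsproj (gr_part J 1) (cls 1 u)) = cls 1 u by rewrite vsXE vsprojK // memv_img.
by rewrite -uE -canS memv_img ?memvf.
Qed.

(** The canonical map is onto in each degree, so it is bijective as soon as the dimensions allow it;
    conversely any isomorphism of the required kind gives the dimensions. *)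
Lemma graded_is_tensor_algebra_dim : graded_is_tensor_algebra he hd <->
  forall n, (\dim {:tpow X n} <= \dim (gr_part J n))%N.
Proof.
split=> [[phi [_ _ _ phiP]] n|dT].
  by have [k0 <-] := phiP n; rewrite (limg_dim_eq (f := phi n)) // k0 capv0.
exists can; split=> [a|x|m n s t|n].
- exact: can0.
- by rewrite canS can0 vsval1 -gr_one_cls mulr1 vsXE.
- exact: canM.
split; last exact: limg_can.
apply/eqP; rewrite -dimv_eq0 -leqn0; have := limg_ker_dim (can n) fullv.
by rewrite capfv limg_can => E; have := dT n; rewrite -[X in (X <= _)%N]E -[X in (_ <= X)%N]add0n leq_add2r.
Qed.

End CanonicalMap.

(** * The dimension count *)

Section Iteration.
Variables (L : finType) (tau : (L -> nat) -> L -> nat).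
Hypothesis tau_le : forall phi psi, (forall j, phi j <= psi j)%N -> forall j, (tau phi j <= tau psi j)%N.
Hypothesis tauD : forall phi psi j, tau (fun i => phi i + psi i)%N j = (tau phi j + tau psi j)%N.
Implicit Types phi psi : L -> nat.

Lemma iter_le n phi psi : (forall j, phi j <= psi j)%N ->
  forall j, (iter n tau phi j <= iter n tau psi j)%N.
Proof. by move=> pp; elim: n => // n IHn j /=; apply: tau_le. Qed.

Lemma tau_ext phi psi : phi =1 psi -> tau phi =1 tau psi.
Proof.
move=> pp j; apply/eqP; rewrite eqn_leq.
by apply/andP; split; apply: tau_le => i; rewrite pp.
Qed.

Lemma iterD n phi psi j :
  iter n tau (fun i => phi i + psi i)%N j = (iter n tau phi j + iter n tau psi j)%N.
Proof.
by elim: n j => // n IHn j /=; rewrite -tauD; apply: tau_ext.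
Qed.

Lemma tau0 j : tau (fun=> 0%N) j = 0%N.
Proof. by have := tauD (fun=> 0%N) (fun=> 0%N) j; rewrite addn0 => /esym/eqP; rewrite -{3}[tau _ j]addn0 eqn_add2l => /eqP. Qed.

Lemma tau_sum m (F : nat -> L -> nat) j :
  tau (fun i => \sum_(n < m) F n i)%N j = (\sum_(n < m) tau (F n) j)%N.
Proof.
elim: m => [|m IHm].
  by rewrite big_ord0 -[RHS](tau0 j); apply: tau_ext => i; rewrite big_ord0.
rewrite big_ord_recr /= -IHm -tauD; apply: tau_ext => i; exact: big_ord_recr.
Qed.

Lemma iter_scale n c phi j : (iter n tau (fun i => c * phi i) j = c * iter n tau phi j)%N.
Proof.
elim: c j => [|c IHc] j.
  rewrite mul0n; elim: n j => // n IHn j /=; rewrite -[RHS](tau0 j); exact: tau_ext.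
rewrite mulSn -IHc -iterD; elim: n j {IHc} => [|n IHn] j /=; first exact: mulSn.
exact: tau_ext.
Qed.

Variables alpha d : L -> nat.
Hypothesis alpha_le : forall j, (alpha j <= d j + tau alpha j)%N.

Lemma alpha_iter_le m j : (alpha j <= \sum_(n < m) iter n tau d j + iter m tau alpha j)%N.
Proof.
elim: m => [|m IHm]; first by rewrite big_ord0.
apply: leq_trans IHm _; rewrite big_ord_recr /= -addnA leq_add2l.
by rewrite -iterS iterSr -iterD; apply: iter_le.
Qed.

(** The equation iterated [m] times leaves the partial Neumann sum plus the remainder
    [iter m tau alpha]. *)
Lemma iter_sum_le m j : (forall i, alpha i = d i + tau alpha i)%N ->
  (\sum_(n < m) iter n tau d j <= alpha j)%N.
Proof.
move=> aE; suff -> : (alpha j = \sum_(n < m) iter n tau d j + iter m tau alpha j)%N by apply: leq_addr.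
elim: m => [|m ->]; first by rewrite big_ord0.
rewrite big_ord_recr /= -addnA; congr (_ + _)%N; rewrite -iterS iterSr -iterD.
by elim: m j => [|m IHm] j /=; [apply: aE | apply: tau_ext].
Qed.

(* A subsolution of alpha = d + tau alpha of the same total mass as the Neumann
   series of a nilpotent tau is the solution. *)
Lemma alpha_eq m c : (forall i, alpha i <= c * d i)%N -> (forall i, iter m tau d i = 0)%N ->
  (\sum_j alpha j = \sum_j \sum_(n < m) iter n tau d j)%N ->
  forall j, alpha j = (d j + tau alpha j)%N.
Proof.
move=> ac dm E.
have a0 j : iter m tau alpha j = 0%N.
  apply/eqP; rewrite -leqn0; apply: leq_trans (iter_le m ac j) _.
  by rewrite iter_scale dm muln0.
have aS j : alpha j = (\sum_(n < m) iter n tau d j)%N.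
  apply: (eq_sum_le (P := xpredT) _).1 E j isT => i _.
  by have := alpha_iter_le m i; rewrite a0 addn0.
move=> j; rewrite (tau_ext aS) (tau_sum m (fun n => iter n tau d)) {1}aS.
by rewrite -(big_ord_recl m (fun n => iter n tau d j)) big_ord_recr /= dm addn0.
Qed.

End Iteration.

Section TensorCriterion.
Variables (K : fieldType) (A : falgType K) (L : finType) (e : L -> A).
Variables (he : complete_primitive e) (hd : directed e).
Variables (N : L -> {vspace A}) (h : L -> nat).
Hypothesis H : local_directed e N h.

Local Notation blk := (blk e).
Local Notation pcol := (pcol e).
Local Notation J := (offdiag_ideal he hd).
Local Notation X := (assoc_graded1 he hd).
Local Notation step := (mult_step e N).
Local Notation alpha := (fun j => \dim (pcol j)).
Local Notation d := (fun j => \dim (blk j j)).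

Lemma mult_step_le phi psi : (forall j, phi j <= psi j)%N -> forall j, (step phi j <= step psi j)%N.
Proof. by move=> pp j; apply: leq_sum => i _; rewrite leq_mul2r pp orbT. Qed.

Lemma mult_stepD phi psi j : step (fun i => phi i + psi i)%N j = (step phi j + step psi j)%N.
Proof. by rewrite /mult_step -big_split; apply: eq_bigr => i _; apply: mulnDl. Qed.

Lemma pcol_step j : (alpha j <= d j + step alpha j)%N.
Proof.
rewrite /= (dim_pcol H) (bigD1 j) //= leq_add2l -(dim_jcol H).
by apply: leq_trans (dim_jcol_le H j) _; apply: leq_sum => i _; rewrite mulnC.
Qed.

Lemma offdiag_projective_step :
  offdiag_projective e N <-> (forall j, alpha j = d j + step alpha j)%N.
Proof.
rewrite (offdiag_projective_eq H); split=> E j; rewrite [LHS]E /=; congr (_ + _)%N.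
  by apply: eq_bigr => i _; apply: mulnC.
by apply: eq_bigr => i _; apply: mulnC.
Qed.

Lemma sum_dim_pcol : (\sum_j alpha j)%N = \dim {:A}.
Proof. by rewrite (dim_peircer H) // => i; apply: subvf. Qed.

Lemma gr_part_tpow n : (\dim (gr_part J n) <= \dim {:tpow X n})%N.
Proof. by rewrite -limg_can dimv_img_le. Qed.

Lemma offdiag_projective_tensor : offdiag_projective e N ->
  graded_is_tensor_algebra he hd /\ projective X.
Proof.
move=> PP; have XL : arrows_left_free_on e N by move=> i j; apply: (arrows_left_free H PP).
split; last exact/(projective_graded1 he hd H).
apply/graded_is_tensor_algebra_dim => n; apply: eq_leq.
(* Large enough for degree [n] to be counted and for the graded parts to exhaust [A]; one inequality
   between totals then gives equality in each degree. *)
pose m := maxn n.+1 (\dim {:A}).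
have mA : (\dim {:A} <= m)%N by apply: leq_maxr.
have nm : (n < m)%N by apply: leq_maxl.
have := (eq_sum_le (P := xpredT) (fun (q : 'I_m) _ => gr_part_tpow q)).1.
move=> eqs; apply/esym/(eqs _ (Ordinal nm) isT); apply/eqP; rewrite eqn_leq leq_sum => [|q _]; last exact: gr_part_tpow.
rewrite (sum_dim_gr_part he hd H mA) -sum_dim_pcol /=.
under eq_bigr do rewrite (dim_tpow_graded he hd H _ XL).
rewrite exchange_big /=; apply: leq_sum => j _.
exact: (iter_sum_le mult_step_le mult_stepD _ _ (offdiag_projective_step.1 PP)).
Qed.

Lemma tensor_offdiag_projective :
  graded_is_tensor_algebra he hd -> projective X -> offdiag_projective e N.
Proof.
move=> /graded_is_tensor_algebra_dim dT /(projective_graded1 he hd H) XL.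
have tE n : (\sum_j iter n step d j)%N = \dim (gr_part J n).
  rewrite -(dim_tpow_graded he hd H n XL); apply/eqP.
  by rewrite eqn_leq dT gr_part_tpow.
apply/offdiag_projective_step.
(* The power of [J] with exponent [\dim {:A}] is zero, hence so is that tensor power; and [alpha j]
   is at most [\dim {:A}], while [d j] is at least 1. *)
apply: (alpha_eq mult_step_le mult_stepD pcol_step (m := \dim {:A}) (c := \dim {:A})).
- move=> j; apply: leq_trans (dimvS (subvf _)) _; rewrite leq_pmulr // lt0n dimv_eq0.
  by apply: contraNneq (e_neq0 H j) => b0; rewrite -memv0 -b0 (e_blk H).
- have : (\sum_j iter (\dim {:A}) step d j = 0)%N.
    by rewrite tE /gr_part (ipow_nil he hd H) ?limg0 ?dimv0.
  by move/eqP; rewrite sum_nat_eq0 => /forallP dm i; apply/eqP/dm.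
rewrite sum_dim_pcol exchange_big /= -[LHS](sum_dim_gr_part he hd H (leqnn _)).
by apply: eq_bigr => n _; rewrite tE.
Qed.

End TensorCriterion.

Theorem theorem0p2 (k : closedFieldType) (A : falgType k) (L : finType)
    (e : L -> A) (he : complete_primitive e) (hb : basic e)
    (hd : directed e) :
  let B := assoc_graded he hd in
  let eB := assoc_graded_idem he hd in
  let X := assoc_graded1 he hd in
  (((forall r, linear_order r -> standardly_stratified e r) <->
    (forall r, linear_order r -> standardly_stratified eB r)) /\
   ((forall r, linear_order r -> standardly_stratified eB r) <->
    (graded_is_tensor_algebra he hd /\ projective X)))
  /\
  (((forall r, linear_order r -> properly_stratified e r) <->
    (forall r, linear_order r -> properly_stratified eB r)) /\
   ((forall r, linear_order r -> properly_stratified eB r) <->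
    [/\ graded_is_tensor_algebra he hd, projective X
      & projective (bimod_right X)])).
Proof.
move=> B eB X; have [N [h H]] := complete_primitive_local he hd.
have GL := graded_local he hd H.
rewrite (standardly_stratified_iff H) (standardly_stratified_iff GL).
rewrite (properly_stratified_iff H) (properly_stratified_iff GL).
rewrite (offdiag_projective_gr he hd H) (arrows_right_free_gr he hd H).
have PT := offdiag_projective_tensor he hd H; have TP := tensor_offdiag_projective H.
have XR := projective_graded1_r he hd H.
split; split=> //; first by split=> [/PT|[/TP]].
split=> [[/[dup] P /PT[T PX] /XR]|[T PX /XR]]; first by split.
by split=> //; apply: TP T PX.
Qed.
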